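(* Let $F:\mathbb{C}\to\mathbb{R}$ be a $\mathcal{C}^\infty$-smooth subharmonic function that vanishes to infinite order at $0\in\mathbb{C}$ and is radial, i.e., $F(z)=F(|z|)$ for all $z\in\mathbb{C}$. Suppose the boundary of the domain $\Omega_F:=\{(z,w)\in\mathbb{C}^2:\operatorname{Im} w>F(z)\}$ is not Levi-flat around $(0,0)$. (a) Let $f:[0,\infty)\to\mathbb{R}$ be given by the relation $f(|z|)=F(z)$ for all $z\in\mathbb{C}$. Then $f$ is a strictly increasing function on $[0,\infty)$ and $\lim_{r\to\infty}f(r)=+\infty$. Assume, in addition, that there exists a constant $R\in(0,f^{-1}(1))$ such that $\Lambda_f|_{[0,R]}$ satisfies a doubling condition. Then: (b) There exists a constant $C_1>0$ and, for each $\alpha>0$ and each positive integer $N$, there exists a constant $r(\alpha,N)>0$ such that $$\frac{1}{C_1}(\operatorname{Im} w)^{-2}\big(f^{-1}(\operatorname{Im} w)\big)^{-2}\le K_F(z,w)\le C_1(\operatorname{Im} w)^{-2}\big(f^{-1}(\operatorname{Im} w)\big)^{-2}$$ for all $(z,w)\in\mathscr{A}_{\alpha,N}\cap\{(z,w):\operatorname{Im} w<r(\alpha,N)\}$, where $$\mathscr{A}_{\alpha,N}:=\Big\{(z,w)\in\Omega_F:\sqrt{|z|^2+|\operatorname{Re} w|^2}<\alpha(\operatorname{Im} w)^{1/N}\Big\}.$$ (The constant $C_1$ does not depend on $\alpha$ or $N$.) (c) Furthermore, there exists a constant $r_0>0$, independent of all the parameters above, such that the lower bound $$\frac{1}{C_1}(\operatorname{Im}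 w)^{-2}\big(f^{-1}(\operatorname{Im} w)\big)^{-2}\le K_F(z,w)$$ (with the same $C_1$ as in (b)) holds for all $(z,w)\in\Omega_F\cap\{(z,w):\operatorname{Im} w<r_0\}$.
   Context: Vanishing to infinite order: for a radial $F$ with $F(z)=f(|z|)$, this means that $f\in\mathcal{C}^\infty([0,\infty))$, $f^{(n)}(0)=0$ and $\lim_{x\to0^+}f(x)/x^n=0$ for every $n\in\mathbb{N}$ (in particular $f(0)=0$). Levi-flat around $(0,0)$: the Levi form of $\partial\Omega_F$ vanishes identically on some neighbourhood of $(0,0)$ in $\partial\Omega_F$. Doubling condition: an increasing function $g:[0,R]\to\mathbb{R}$ satisfies a doubling condition if $g(0)=0$ and there is a constant $\sigma>1$ (a doubling constant for $g$) such that $2g(x)\le g(\sigma x)$ for all $x\in[0,R/\sigma]$. The function $\Lambda_f$: for $f:[0,\infty)\to\mathbb{R}$ strictly increasing with $f(0)=0$, $\Lambda_f(x):=-1/\log(f(x))$ if $0<x<f^{-1}(1)$, and $\Lambda_f(0):=0$. Bergman kernel: for a domain $\Omega\subset\mathbb{C}^2$, let $A^2(\Omega):=\mathbb{L}^2(\Omega,\mathbb{C})\cap\mathcal{O}(\Omega)$ be the space of square-integrable (with respect to Lebesgue measure) holomorphic functions on $\Omega$, and let $B_\Omega:\Omega\times\Omega\to\mathbb{C}$ be its reproducing (Bergman) kernel. Write $K_\Omega(z,w):=B_\Omega((z,w),(z,w))$ for the kernel on the diagonal, and $K_F:=K_{\Omega_F}$. *)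

(* Defs.v *)
From HB Require Import structures.
From mathcomp Require Import all_boot all_order all_algebra.
From mathcomp Require Import all_classical all_reals all_analysis.
From mathcomp Require Export complex.
Import Order.TTheory GRing.Theory Num.Theory.
Import numFieldNormedType.Exports.

Set Implicit Arguments.
Unset Strict Implicit.
Unset Printing Implicit Defensive.

Local Open Scope classical_set_scope.
Local Open Scope ring_scope.
Local Open Scope complex_scope.

(** Analysis on C and C^2 is done in real coordinates: C = R^2 and C^2 = R^4,
    the latter being ((x1, y1), (x2, y2)) for (x1 + i y1, x2 + i y2). *)

Definition toC {R : realType} (p : R * R) : R[i] := p.1 +i* p.2.

Definition toC2 {R : realType} (q : (R * R) * (R * R)) : R[i] * R[i] :=
  (toC q.1, toC q.2).

(** ** Differentiability classes *)

(** [u] is of class C^k at every point of [D], for [D] open: the iterated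
    directional derivatives of order at most [k] exist and are continuous.
    They are taken in the ambient space, so [D] has to be open. *)
Fixpoint Ck_on {R : realType} {V : normedModType R}
    (k : nat) (D : set V) (u : V -> R) : Prop :=
  (forall x, D x -> {for x, continuous u}) /\
  (if k is k'.+1 then
     forall v, (forall x, D x -> derivable u x v) /\ Ck_on k' D ('D_v u)
   else True).

Definition smooth {R : realType} (F : R[i] -> R) : Prop :=
  forall k, Ck_on k setT (F \o toC).

(** Derivative on the half-line [0, +oo[: two-sided at [x > 0], right derivative
    at [0]; the values of [f] on negative numbers are never used. *)
Definition half_quotient {R : realType} (f : R -> R) (x h : R) : R :=
  h^-1 * (f (x + h) - f x).

Definition half_nbhs {R : realType} (x : R) : set_system R :=
  within [set h | 0 <= x + h] 0^'.

Definition half_derive {R : realType} (f : R -> R) (x : R) : R :=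
  lim (half_quotient f x @ half_nbhs x).

Definition half_smooth {R : realType} (f : R -> R) : Prop :=
  forall n x, 0 <= x ->
    cvg (half_quotient (iter n half_derive f) x @ half_nbhs x).

Definition vanishes_to_infinite_order {R : realType} (f : R -> R) : Prop :=
  [/\ half_smooth f,
      forall n, iter n half_derive f 0 = 0
    & forall n, (f x / x ^+ n) @[x --> 0^'+] --> (0 : R)].

(** ** Subharmonic functions on C *)

Definition upper_semicontinuous {R : realType} {X : topologicalType}
    (u : X -> R) : Prop :=
  lower_semicontinuous (fun x => (- u x)%:E).

Definition circle_mean {R : realType} (F : R[i] -> R) (a : R[i]) (r : R) : R :=
  (2 * pi)^-1 *
  \int[lebesgue_measure]_(t in `[0, 2 * pi]) F (a + (r * cos t) +i* (r * sin t)).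

Definition subharmonic {R : realType} (F : R[i] -> R) : Prop :=
  upper_semicontinuous (F \o toC) /\
  forall a r, 0 < r -> F a <= circle_mean F a r.

(** ** Wirtinger operators on C^2; index 0 is the variable z, index 1 is w *)

Definition dir_x {R : realType} (j : 'I_2) : (R * R) * (R * R) :=
  if j == 0 then ((1, 0), (0, 0)) else ((0, 0), (1, 0)).

Definition dir_y {R : realType} (j : 'I_2) : (R * R) * (R * R) :=
  if j == 0 then ((0, 1), (0, 0)) else ((0, 0), (0, 1)).

Definition cderive {R : realType} (v : (R * R) * (R * R))
    (u : (R * R) * (R * R) -> R[i]) (q : (R * R) * (R * R)) : R[i] :=
  ('D_v (fun x => complex.Re (u x)) q) +i* ('D_v (fun x => complex.Im (u x)) q).

Definition d_z {R : realType} (j : 'I_2)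
    (u : (R * R) * (R * R) -> R[i]) (q : (R * R) * (R * R)) : R[i] :=
  2^-1 * (cderive (dir_x j) u q - 'i * cderive (dir_y j) u q).

Definition d_zbar {R : realType} (j : 'I_2)
    (u : (R * R) * (R * R) -> R[i]) (q : (R * R) * (R * R)) : R[i] :=
  2^-1 * (cderive (dir_x j) u q + 'i * cderive (dir_y j) u q).

(** ** Levi form *)

Definition levi_form {R : realType} (rho : R[i] * R[i] -> R)
    (q : (R * R) * (R * R)) (xi : 'I_2 -> R[i]) : R[i] :=
  let u := fun x => (rho (toC2 x))%:C in
  \sum_(j < 2) \sum_(k < 2) d_z j (d_zbar k u) q * xi j * (xi k)^*.

Definition complex_tangent {R : realType} (rho : R[i] * R[i] -> R)
    (q : (R * R) * (R * R)) (xi : 'I_2 -> R[i]) : Prop :=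
  \sum_(j < 2) d_z j (fun x => (rho (toC2 x))%:C) q * xi j = 0.

Definition boundary {X : topologicalType} (A : set X) : set X :=
  closure A `\` interior A.

(** [rho] is meant to be a defining function of [Omega]. *)
Definition levi_flat_around {R : realType} (Omega : set (R[i] * R[i]))
    (rho : R[i] * R[i] -> R) (q0 : (R * R) * (R * R)) : Prop :=
  \forall q \near q0, boundary (toC2 @^-1` Omega) q ->
    forall xi, complex_tangent rho q xi -> levi_form rho q xi = 0.

(** ** Bergman kernel *)

Definition holomorphic_on {R : realType} (Omega : set (R[i] * R[i]))
    (h : R[i] * R[i] -> R[i]) : Prop :=
  let D := toC2 @^-1` Omega in
  [/\ Ck_on 1 D (fun q => complex.Re (h (toC2 q))),
      Ck_on 1 D (fun q => complex.Im (h (toC2 q)))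
    & forall j q, D q -> d_zbar j (h \o toC2) q = 0].

(** The structure is packed by hand because the sigma-finiteness of [m1 \x m2],
    although proved in the library, is not found by canonical inference (it is
    shadowed by the instance for subprobabilities). *)
Definition lebesgue2 (R : realType) :
    {sigma_finite_measure
       set (measurableTypeR R * measurableTypeR R)%type -> \bar R} :=
  HB.pack (@lebesgue_measure R \x @lebesgue_measure R)%E
    (lebesgue_integral_fubini.measure_function_Measure_isSigmaFinite__to__measure_function_isSigmaFinite
       (@lebesgue_measure R) (@lebesgue_measure R))
    (lebesgue_integral_fubini.measure_function_Measure_isSigmaFinite__to__measure_function_isSFinite
       (@lebesgue_measure R) (@lebesgue_measure R)).

Arguments lebesgue2 R : clear implicits.

Definition lebesgue4 (R : realType) := (lebesgue2 R \x lebesgue2 R)%E.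

Arguments lebesgue4 R : clear implicits.

Definition cintegral {R : realType} (Omega : set (R[i] * R[i]))
    (g : R[i] * R[i] -> R[i]) : R[i] :=
  (\int[lebesgue4 R]_(q in toC2 @^-1` Omega) complex.Re (g (toC2 q))) +i*
  (\int[lebesgue4 R]_(q in toC2 @^-1` Omega) complex.Im (g (toC2 q))).

Definition A2 {R : realType} (Omega : set (R[i] * R[i]))
    (h : R[i] * R[i] -> R[i]) : Prop :=
  holomorphic_on Omega h /\
  (lebesgue4 R).-integrable (toC2 @^-1` Omega)
    (fun q => (complex.Re `|h (toC2 q)| ^+ 2)%:E).

Definition is_bergman_kernel {R : realType} (Omega : set (R[i] * R[i]))
    (B : R[i] * R[i] -> R[i] * R[i] -> R[i]) : Prop :=
  forall q, Omega q ->
    A2 Omega (B ^~ q) /\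
    forall h, A2 Omega h -> h q = cintegral Omega (fun p => h p * (B p q)^*).

(** The reproducing kernel exists and is unique on [Omega * Omega]. *)
Definition bergman_kernel {R : realType} (Omega : set (R[i] * R[i])) :
    R[i] * R[i] -> R[i] * R[i] -> R[i] :=
  xget (fun _ _ => 0) (is_bergman_kernel Omega).

(** ** The model domains *)

Definition Omega_ {R : realType} (F : R[i] -> R) : set (R[i] * R[i]) :=
  [set p | complex.Im p.2 > F p.1].

Definition rho_ {R : realType} (F : R[i] -> R) (p : R[i] * R[i]) : R :=
  F p.1 - complex.Im p.2.

Definition K_ {R : realType} (F : R[i] -> R) (z w : R[i]) : R[i] :=
  bergman_kernel (Omega_ F) (z, w) (z, w).

Definition approach_region {R : realType} (F : R[i] -> R) (alpha : R) (N : nat) :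
    set (R[i] * R[i]) :=
  [set p | Omega_ F p /\
     Num.sqrt (complex.Re `|p.1| ^+ 2 + `|complex.Re p.2| ^+ 2) <
     alpha * complex.Im p.2 `^ (N%:R^-1)].

(** Inverse of [f : [0, +oo[ -> R]. *)
Definition half_inverse {R : realType} (f : R -> R) : R -> R :=
  'pinv_(fun=> 0) `[0, +oo[ f.

(** Only used on [0, f^{-1}(1)[. *)
Definition Lambda {R : realType} (f : R -> R) (x : R) : R :=
  if x == 0 then 0 else - (ln (f x))^-1.

(** Doubling condition for the restriction of [g] to [0, r]. *)
Definition doubling_on {R : realType} (r : R) (g : R -> R) : Prop :=
  [/\ {in `[0, r] &, {homo g : x y / x <= y}},
      g 0 = 0
    & exists2 sigma, 1 < sigma &
        forall x, x \in `[0, r / sigma] -> 2 * g x <= g (sigma * x)].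

(* Main.v *)
Require Import Defs.
From mathcomp Require Import all_boot all_order all_algebra.
From mathcomp Require Import all_classical all_reals all_analysis.
From mathcomp Require Import measurable_realfun ring lra.
Import Order.TTheory GRing.Theory Num.Theory.
Import numFieldNormedType.Exports.
Local Open Scope classical_set_scope.
Local Open Scope ring_scope.
Local Open Scope complex_scope.

(** Write [g] for the inverse of the profile [f] and [t] for [Im w].

    Growth of [f].  For every real [B] the function [F - B ln |z|] still
    satisfies the sub-mean value inequality away from [0].  Being radial, it
    cannot have an interior local maximum once [eps |z|^2] is added, so
    [f(r) - B ln r] is largest at an end of any interval of radii
    ([log_max_principle]).  Negative [B], with the left end tending to [0],
    show that [f] is nondecreasing.  If [f] vanished on some [[0, r[], the
    boundary would be a real hyperplane near the origin, hence Levi-flat; so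
    [f > 0] on the positive half-line, and then a small positive [B] gives
    [f(s) >= f(r) + B (ln s - ln r)] for [s >= r].  This is (a), and it bounds
    [g] by an exponential.

    The Bergman kernel.  A holomorphic function on a domain of C^2 is handled
    as a pair of real C^1 functions satisfying the Cauchy-Riemann equations in
    each variable.  Such functions have the mean value property for the weights
    [bump] ([mean_value4]); hence their values are bounded and Lipschitz on
    compact subsets, with constants controlled by the L^2 norm.
    Therefore L^2 limits of holomorphic functions are holomorphic
    ([hol_pair_limit]), and a variational argument represents the evaluation at
    a point by a function of the space ([riesz]).  The resulting number [K] on
    the diagonal satisfies [|h(p)|^2 <= K |h|^2] for all [h], and
    [K d^2 e^2 <= 16] when the box with half-sides [d] in [z] and [e] in [w]
    around [p] lies in the domain.

    Upper bound.  Doubling of [Lambda f] with constant [sigma] amounts to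
    [f(y / sigma) <= f(y)^2] for small [y], so that [f(g(t) / sigma) <= t^2],
    which is below [t / 2].  The box with half-sides [g(t) / (4 sigma)] and
    [t / 2] around [(z, w)] is thus contained in the domain if both real coordinates
    of [z] are at most [g(t) / (4 sigma)].  In an approach region this is the
    case for small [t]: [f] vanishes to infinite order, so [t^(1/N)] is
    negligible with respect to [g(t)].

    Lower bound.  The slice of the domain at [Im w = s] is a disc of radius
    [g(s)], and for a function of [w] alone the L^2 norm is an integral over
    the half-plane with density of order [g(s)^2].  Iterating the doubling
    inequality gives [g(s) <= g(t) (2 (s + t) / t)^m] for small [s], where
    [sigma <= 2^m].  The test function [exp(i a w) / (w - conj w0)^(m + 2)],
    with [w0] the second coordinate of the point, decays fast enough to
    compensate for this power, and its exponential factor compensates for the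
    growth of [g] at infinity.  Its squared norm is at most a constant times
    [g(t)^2 t^(- 2 m - 2)], while its squared modulus at [w0] is comparable to
    [t^(- 2 m - 4)]. *)

Set Implicit Arguments.
Unset Strict Implicit.
Unset Printing Implicit Defensive.

(** * Radial functions with the sub-mean value property *)

Lemma continuous_is_derive (R : realType) (f df : R -> R) (x : R) :
  is_derive x (1 : R) f (df x) -> {for x, continuous f}.
Proof. by case=> d _; apply: differentiable_continuous; apply/derivable1_diffP. Qed.

(** The second-order term is kept because [no_local_max] compares quantities of
    order two in the radius of a circle. *)
Lemma ln1D_taylor2 (R : realType) (x : R) : `|x| <= 2^-1 ->
  `|ln (1 + x) - x + x ^+ 2 / 2| <= 2 * `|x| ^+ 3.
Proof.
move=> x2; pose g (t : R) := ln (1 + t) - t + t ^+ 2 / 2.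
pose dg (t : R) : R := t ^+ 2 / (1 + t).
have gd (t : R) : `|t| <= 2^-1 -> is_derive t 1 g (dg t).
  move=> t2; have t1 : 0 < 1 + t by move: t2; rewrite ler_norml => /andP[]; lra.
  rewrite /g /dg; have dl : is_derive (1 + t) 1 (@ln R) ((1 + t)^-1) by exact: is_derive1_ln.
  have := @is_derive1_comp _ (@ln R) (fun s => 1 + s) t _ _ dl.
  move=> /(_ 1) dc.
  have {}dc : is_derive t 1 (fun s : R => ln (1 + s)) ((1 + t)^-1).
    rewrite -[X in is_derive _ _ _ X]mulr1; apply: dc.
    by apply: is_derive_eq; rewrite add0r mulr1.
  apply: is_derive_eq; rewrite /GRing.scale /=; field; lra.
have g0 : g 0 = 0 by rewrite /g addr0 ln1 expr0n /= mul0r subr0 addr0.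
have hc a b : `|a| <= 2^-1 -> `|b| <= 2^-1 -> {within `[a, b], continuous g}.
  move=> a2 b2; apply: continuous_in_subspaceT => t; rewrite inE/= in_itv/= => /andP[at_ tb].
  by apply: (@continuous_is_derive _ _ dg); apply: gd; move: a2 b2; rewrite !ler_norml; lra.
have key (t : R) : `|t| <= `|x| -> `|dg t| <= 2 * `|x| ^+ 2.
  move=> tx; rewrite /dg normrM normfV normrX.
  have t2 : `|t| <= 2^-1 by exact: le_trans tx x2.
  have t1 : 2^-1 <= `|1 + t|.
    by rewrite ger0_norm; move: t2; rewrite ler_norml => /andP[]; lra.
  rewrite ler_pdivrMr; last by lra.
  have h1 : `|t| ^+ 2 <= `|x| ^+ 2 by rewrite lerXn2r ?nnegrE.
  have h2 : 0 <= `|x| ^+ 2 by rewrite exprn_ge0.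
  nra.
suff [c cx cE] : exists2 c, `|c| <= `|x| & g x = dg c * x.
  by rewrite -/(g x) cE normrM [X in _ <= _ * X]exprSr mulrA ler_wpM2r// key.
have [x0|x0] := leP 0 x.
  have z2 : `|0 : R| <= 2^-1 by rewrite normr0 invr_ge0.
  have [|c] := @MVT_segment _ g dg 0 x x0 _ (hc _ _ z2 x2).
    move=> t; rewrite in_itv/= => /andP[t0 tx]; apply: gd.
    by rewrite ger0_norm ?ltW//; move: x2; rewrite ger0_norm//; lra.
  rewrite in_itv/= g0 !subr0 => /andP[c0 cx] ->; exists c => //.
  by rewrite !ger0_norm.
have z2 : `|0 : R| <= 2^-1 by rewrite normr0 invr_ge0.
have [|c] := @MVT_segment _ g dg x 0 (ltW x0) _ (hc _ _ x2 z2).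
  move=> t; rewrite in_itv/= => /andP[t0 tx]; apply: gd.
  by rewrite ltr0_norm//; move: x2; rewrite ltr0_norm//; lra.
rewrite in_itv/= g0 => /andP[c0 cx] cE; exists c.
  by rewrite (ltr0_norm x0) ler0_norm//; lra.
by apply/eqP; rewrite -eqr_opp -[- g x]add0r cE; apply/eqP; ring.
Qed.

Lemma continuous_pair (T U V : topologicalType) (f : T -> U) (g : T -> V) x :
  {for x, continuous f} -> {for x, continuous g} ->
  {for x, continuous (fun y => (f y, g y))}.
Proof. by move=> fc gc; exact: (cvg_pair fc gc). Qed.

Section Radial.
Variables (R : realType) (F : R[i] -> R) (f : R -> R).
Hypothesis Fc : continuous (F \o toC).
Hypothesis F_mean : forall a r, 0 < r -> F a <= circle_mean F a r.
Hypothesis F_profile : forall z, f (complex.Re `|z|) = F z.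

Lemma profile_normE x y : F (x +i* y) = f (Num.sqrt (x ^+ 2 + y ^+ 2)).
Proof. by rewrite -F_profile normc_def. Qed.

Lemma profileE x : 0 <= x -> f x = F (x +i* 0).
Proof. by move=> x0; rewrite profile_normE expr0n /= addr0 sqrtr_sqr ger0_norm. Qed.

(** On a circle [cos] and [1 - 2 cos^2] have mean zero, so only the constant
    term of such a bound reaches the centre. *)
Lemma circle_mean_le (x0 r al be ga : R) : 0 < r ->
  (forall t, f (Num.sqrt ((x0 + r * cos t) ^+ 2 + (r * sin t) ^+ 2)) <=
      al * cos t + be * (1 - 2 * cos t ^+ 2) + ga) ->
  F (x0 +i* 0) <= ga.
Proof.
move=> r0 H; apply: (le_trans (F_mean _ r0)).
have pi0 := pi_gt0 R.
rewrite /circle_mean mulrC ler_pdivrMr; last by lra.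
pose h (t : R) := al * cos t + be * (1 - 2 * cos t ^+ 2) + ga.
have hcont : continuous h.
  move=> t; rewrite /h; apply: (@continuous_is_derive _ _ (fun t => - al * sin t + be * 4 * cos t * sin t)).
  by apply: is_derive_eq; rewrite /GRing.scale/=; ring.
have circ : continuous (fun t : R => F ((x0 +i* 0) + (r * cos t +i* (r * sin t)))).
  move=> t; rewrite (_ : (fun _ => _) = (F \o toC) \o (fun t => (x0 + r * cos t, 0 + r * sin t))); last first.
    by apply/funext => s.
  apply: continuous_comp; last exact: Fc.
  by apply: continuous_pair; apply/differentiable_continuous/derivable1_diffP/ex_derive.
apply: (@le_trans _ _ (\int[lebesgue_measure]_(t in `[0, 2 * pi]) h t)).
  apply: le_Rintegral.
  - exact: measurable_itv.
  - apply: continuous_compact_integrable; first exact: segment_compact.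
    exact: continuous_subspaceT.
  - apply: continuous_compact_integrable; first exact: segment_compact.
    exact: continuous_subspaceT.
  - move=> t _; apply: le_trans (H t).
    by rewrite -profile_normE/= le_eqVlt; apply/orP; left; apply/eqP; congr F; apply/eqP; rewrite eq_complex/= add0r !eqxx.
pose G (t : R) := al * sin t - be * (sin t * cos t) + ga * t.
have Gd (t : R) : is_derive t 1 G (h t).
  rewrite /G /h; apply: is_derive_eq; rewrite /GRing.scale/=.
  apply/eqP; rewrite -subr_eq0; apply/eqP.
  transitivity (be * (sin t ^+ 2 - (1 - cos t ^+ 2))); first by ring.
  by rewrite sin2cos2 subrr mulr0.
rewrite /Rintegral (@continuous_FTC2 _ h G); first last.
- by move=> t _; rewrite derive1E; apply: derive_val.
- split.
  + by move=> t _; case: (Gd t).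
  + by apply: cvg_at_right_filter; apply: continuous_is_derive (Gd _).
  + by apply: cvg_at_left_filter; apply: continuous_is_derive (Gd _).
- exact: continuous_subspaceT.
- by lra.
rewrite /G /=.
have -> : 2 * pi = pi *+ 2 :> R by rewrite mulr_natl.
rewrite sin2pi sin0; lra.
Qed.

(** The logarithm is harmonic and [|z|^2] has positive Laplacian.  If [x0] were a
    local maximum, then on the circle of radius [k x0] around it
    [f <= f(x0) - eps x0^2 k^2 + O(k^3)] up to terms of mean zero, against the
    sub-mean value inequality. *)
Lemma no_local_max (B ep x0 de : R) : 0 < x0 -> 0 < ep -> 0 < de ->
  ~ (forall x, 0 < x -> `|x - x0| < de ->
     f x - B * ln x + ep * x ^+ 2 <= f x0 - B * ln x0 + ep * x0 ^+ 2).
Proof.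
move=> x00 ep0 de0 H.
have B0 : 0 <= `|B| by [].
(* [29 |B| k^3] bounds the remainder of [B ln |z|] on the circle, and the last
   entry of the minimum makes it less than [eps x0^2 k^2]. *)
pose k := Num.min (6^-1) (Num.min (de / (2 * x0)) (ep * x0 ^+ 2 / (29 * `|B| + 1))).
have epx : 0 < ep * x0 ^+ 2 by rewrite mulr_gt0// exprn_gt0.
have k0 : 0 < k.
  by rewrite /k !lt_min invr_gt0 ltr0n/= !divr_gt0//; lra.
have k6 : k <= 6^-1 by rewrite /k ge_min lexx.
have kd : k * x0 < de.
  have : k <= de / (2 * x0) by rewrite /k !ge_min lexx orbT.
  by rewrite ler_pdivlMr; nra.
have kB : k * (29 * `|B| + 1) <= ep * x0 ^+ 2.
  have : k <= ep * x0 ^+ 2 / (29 * `|B| + 1) by rewrite /k !ge_min lexx !orbT.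
  by rewrite ler_pdivlMr//; lra.
clearbody k.
pose ga := f x0 + 29 * `|B| * k ^+ 3 - ep * x0 ^+ 2 * k ^+ 2.
suff : F (x0 +i* 0) <= ga.
  rewrite -profileE; last exact: ltW.
  rewrite /ga => h.
  have h1 : 0 <= k ^+ 2 * (29 * `|B| * k - ep * x0 ^+ 2) by nra.
  rewrite pmulr_rge0 ?exprn_gt0// in h1; nra.
apply: (@circle_mean_le x0 (k * x0) (B * k - 2 * ep * x0 ^+ 2 * k) (B * k ^+ 2 / 2) ga);
  first by rewrite mulr_gt0.
move=> t; set c := cos t; set s := sin t.
have s2 : s ^+ 2 = 1 - c ^+ 2 by rewrite /s sin2cos2.
have /andP[cm1 c1] : -1 <= c <= 1 by rewrite cos_geN1 cos_le1.
pose X := 2 * k * c + k ^+ 2.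
have rad : (x0 + k * x0 * c) ^+ 2 + (k * x0 * s) ^+ 2 = x0 ^+ 2 * (1 + X).
  by rewrite [(_ * s) ^+ 2]exprMn s2 /X; ring.
rewrite rad; set x := Num.sqrt _.
have X3 : `|X| <= 3 * k by rewrite /X ler_norml; apply/andP; split; nra.
have X2 : `|X| <= 2^-1 by apply: le_trans X3 _; lra.
have X1 : 0 < 1 + X by move: X2; rewrite ler_norml => /andP[]; lra.
have xE : x ^+ 2 = x0 ^+ 2 * (1 + X) by rewrite sqr_sqrtr// mulr_ge0 ?exprn_ge0 ?ltW.
have x_gt0 : 0 < x by rewrite sqrtr_gt0 mulr_gt0// exprn_gt0.
have sqle a b : 0 <= a -> 0 <= b -> a ^+ 2 <= b ^+ 2 -> a <= b.
  by move=> a0 b0; rewrite ler_sqr.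
have x02 : 0 <= x0 ^+ 2 by rewrite exprn_ge0// ltW.
have xl : x0 * (1 - k) <= x.
  apply: sqle; [by apply: mulr_ge0; lra|exact: ltW|].
  by rewrite xE exprMn; apply: ler_wpM2l => //; rewrite /X; nra.
have xu : x <= x0 * (1 + k).
  apply: sqle; [exact: ltW|by apply: mulr_ge0; lra|].
  by rewrite xE exprMn; apply: ler_wpM2l => //; rewrite /X; nra.
have xd : `|x - x0| < de by rewrite ltr_norml; apply/andP; split; lra.
have {xd}Hx := H _ x_gt0 xd.
have lnE : 2 * (ln x - ln x0) = ln (1 + X).
  have := lnXn 2 x_gt0; rewrite xE lnM ?posrE ?exprn_gt0// lnXn// => e.
  by rewrite !mulr2n in e; lra.
have := ln1D_taylor2 X2; set E := ln (1 + X) - X + _ => EX.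
have {}EX : `|E| <= 54 * k ^+ 3.
  apply: le_trans EX _; have : `|X| ^+ 3 <= (3 * k) ^+ 3 by apply: lerXn2r => //; rewrite nnegrE; lra.
  by rewrite exprMn; lra.
have BE : B * E <= `|B| * (54 * k ^+ 3).
  by apply: le_trans (ler_norm _) _; rewrite normrM ler_wpM2l.
have k3 : 0 < k ^+ 3 by rewrite exprn_gt0.
have k4 : k ^+ 4 <= k ^+ 3 by rewrite [k ^+ 4]exprS; nra.
have k40 : 0 <= k ^+ 4 by rewrite exprn_ge0// ltW.
have BC : - (B * (2 * k ^+ 3 * c + k ^+ 4 / 2)) <= `|B| * (3 * k ^+ 3).
  apply: le_trans (ler_norm _) _; rewrite normrN normrM ler_wpM2l// ler_norml.
  by apply/andP; split; nra.
have BL : 2 * (B * (ln x - ln x0)) = B * E + B * (2 * k * c) + B * k ^+ 2 * (1 - 2 * c ^+ 2)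
   - B * (2 * k ^+ 3 * c + k ^+ 4 / 2).
  by rewrite mulrCA lnE /E /X; field.
rewrite xE /X in Hx; rewrite /ga; nra.
Qed.

Lemma axis_continuous : continuous (fun x : R => F (x +i* 0)).
Proof.
move=> x; rewrite (_ : (fun _ => _) = (F \o toC) \o (fun x => (x, 0))); last by apply/funext.
apply: continuous_comp; last exact: Fc.
by apply: continuous_pair; [exact: cvg_id|exact: cvg_cst].
Qed.

(** A value larger than both end values would remain so after adding a small
    multiple of [|z|^2], and then force an interior maximum. *)
Lemma log_max_principle (B r1 r r2 : R) : 0 < r1 -> r1 <= r -> r <= r2 ->
  f r - B * ln r <= Num.max (f r1 - B * ln r1) (f r2 - B * ln r2).
Proof.
move=> r10 r1r rr2; rewrite leNgt; apply/negP; rewrite gt_max => /andP[h1 h2].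
have r20 : 0 < r2 by exact: lt_le_trans r10 (le_trans r1r rr2).
have r0 : 0 < r by exact: lt_le_trans r10 r1r.
pose v := f r - B * ln r.
pose ep := Num.min (v - (f r1 - B * ln r1)) (v - (f r2 - B * ln r2)) / (2 * r2 ^+ 2).
have r22 : 0 < r2 ^+ 2 by rewrite exprn_gt0.
have ep0 : 0 < ep by rewrite divr_gt0 ?lt_min ?subr_gt0 ?h1 ?h2// mulr_gt0.
have e1 : ep * (2 * r2 ^+ 2) <= v - (f r1 - B * ln r1).
  by rewrite /ep divfK ?ge_min ?lexx// gt_eqF// mulr_gt0.
have e2 : ep * (2 * r2 ^+ 2) <= v - (f r2 - B * ln r2).
  by rewrite /ep divfK ?ge_min ?lexx ?orbT// gt_eqF// mulr_gt0.
clearbody ep.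
pose G x := F (x +i* 0) - B * ln x + ep * x ^+ 2.
have GE x : 0 <= x -> G x = f x - B * ln x + ep * x ^+ 2 by move=> ?; rewrite /G -profileE.
have [] := @EVT_max _ G r1 r2 (le_trans r1r rr2).
  apply: continuous_in_subspaceT => t; rewrite inE/= in_itv/= => /andP[t1 _].
  have t0 : 0 < t by exact: lt_le_trans r10 t1.
  apply: cvgD; first apply: cvgB; first exact: axis_continuous.
    by apply: cvgM; [exact: cvg_cst|exact: continuous_ln].
  apply: (@continuous_is_derive _ (fun x => ep * x ^+ 2) (fun x => ep * (2 * x))).
  by apply: is_derive_eq; rewrite /GRing.scale/=; ring.
move=> c; rewrite in_itv/= => /andP[c1 c2] cmax.
have c0 : 0 < c by exact: lt_le_trans r10 c1.
have crv : G r <= G c by apply: cmax; rewrite in_itv/= r1r.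
rewrite (GE _ (ltW r0)) (GE _ (ltW c0)) -/v in crv.
have cr12 : r1 < c < r2.
  rewrite !lt_neqAle c1 c2 !andbT; apply/andP; split; apply/eqP => e.
    rewrite -e in crv; have : ep * r1 ^+ 2 <= ep * r2 ^+ 2.
      by rewrite ler_pM2l//; apply: lerXn2r; rewrite ?nnegrE; [exact: ltW|exact: ltW|exact: le_trans rr2].
    have : 0 <= ep * r ^+ 2 by rewrite mulr_ge0 ?exprn_ge0// ltW.
    by have := mulr_gt0 ep0 r22; lra.
  rewrite e in crv; have := mulr_gt0 ep0 r22.
  have : 0 <= ep * r ^+ 2 by rewrite mulr_ge0 ?exprn_ge0// ltW.
  by lra.
case/andP: cr12 => rc cr.
apply: (@no_local_max B ep c (Num.min (c - r1) (r2 - c))) => //.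
  by rewrite lt_min !subr_gt0 rc cr.
move=> x x0; rewrite lt_min => /andP[d1 d2].
rewrite -(GE _ (ltW x0)) -(GE _ (ltW c0)); apply: cmax.
by rewrite in_itv/=; move: d1 d2; rewrite !ltr_norml => /andP[? _] /andP[_ ?]; apply/andP; split; lra.
Qed.

Hypothesis f0 : f 0 = 0.

Lemma profile_near0 (e : R) : 0 < e -> exists2 d, 0 < d & forall x, 0 <= x < d -> `|f x| < e.
Proof.
move=> e0; have /cvgrPdist_lt /(_ e e0) := @axis_continuous 0.
move=> /nbhs_ballP[d/= d0 H]; exists d => // x /andP[x0 xd].
have : `|F (0 +i* 0) - F (x +i* 0)| < e.
  by apply: H; rewrite /ball/= sub0r normrN ger0_norm.
by rewrite -!profileE// f0 sub0r normrN.
Qed.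

(** In the maximum principle with [B = - b] the value at the left end [r1] tends to
    [- oo] with [r1], so [f r + b ln r <= f r2 + b ln r2]; then [b] tends to [0]. *)
Lemma profile_nondecreasing r r2 : 0 < r -> r <= r2 -> f r <= f r2.
Proof.
move=> r0 rr2; have r20 : 0 < r2 by exact: lt_le_trans rr2.
have lr : 0 <= ln r2 - ln r by rewrite subr_ge0 ler_ln.
suff H b : 0 < b -> f r - f r2 <= b * (ln r2 - ln r).
  rewrite leNgt; apply/negP => lt.
  have := H ((f r - f r2) / (2 * (ln r2 - ln r + 1))).
  rewrite divr_gt0 ?subr_gt0 ?mulr_gt0 ?ltr_wpDl// => /(_ isT).
  rewrite mulrAC ler_pdivlMr ?mulr_gt0 ?ltr_wpDl//.
  have D0 : 0 < f r - f r2 by rewrite subr_gt0.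
  by have := mulr_ge0 (ltW D0) lr; lra.
move=> b0; have [d d0 dH] := profile_near0 (ltr01 : 0 < 1 :> R).
pose r1 := Num.min (Num.min r (d / 2)) (expR ((f r + b * ln r - 2) / b)).
have r10 : 0 < r1 by rewrite !lt_min r0 divr_gt0//= expR_gt0.
have r1r : r1 <= r by rewrite !ge_min lexx.
have f1 : f r1 < 1.
  have := dH r1; rewrite ltW//= => /(_ _)/ltr_normlW; apply.
  by apply: le_lt_trans (_ : r1 <= d / 2) _; [rewrite !ge_min lexx orbT|lra].
have l1 : b * ln r1 <= f r + b * ln r - 2.
  rewrite mulrC -ler_pdivlMr// -[leRHS]expRK ler_ln ?posrE ?expR_gt0//.
  by rewrite ge_min lexx orbT.
have := @log_max_principle (- b) r1 r r2 r10 r1r rr2.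
by rewrite !mulNr !opprK le_max => /orP[]; lra.
Qed.

Lemma profile_ge0 r : 0 <= r -> 0 <= f r.
Proof.
rewrite le_eqVlt => /predU1P[<-|r0]; first by rewrite f0.
rewrite leNgt; apply/negP => fr.
have [d d0 dH] := @profile_near0 (- f r) ltac:(lra).
have m0 : 0 < Num.min r (d / 2) by rewrite lt_min r0 divr_gt0.
have := @profile_nondecreasing _ _ m0 (_ : _ <= r); rewrite ge_min lexx => /(_ isT) h.
have := dH (Num.min r (d / 2)); rewrite ltW//= => /(_ _)/ltr_normlP[].
  by rewrite gt_min; apply/orP; right; lra.
by move=> h1 h2; lra.
Qed.

Hypothesis f_not0 : forall r, 0 < r -> exists2 x, 0 <= x < r & f x != 0.

Lemma profile_gt0 r : 0 < r -> 0 < f r.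
Proof.
move=> r0; have [x /andP[x0 xr] fx] := f_not0 r0.
have x1 : 0 < x by rewrite lt_neqAle x0 andbT eq_sym; apply: contraNneq fx => ->; rewrite f0.
apply: lt_le_trans (profile_nondecreasing x1 (ltW xr)).
by rewrite lt_neqAle eq_sym fx profile_ge0.
Qed.

(** [B] is so small that the value of [f - B ln] at [r1] stays below its value at
    [r]; the maximum principle on [[r1, s]] then leaves only the end [s]. *)
Lemma profile_log_growth r : 0 < r ->
  exists2 B, 0 < B & forall s, r <= s -> f r + B * (ln s - ln r) <= f s.
Proof.
move=> r0; have fr := profile_gt0 r0.
have [d d0 dH] := profile_near0 fr.
pose r1 := Num.min (r / 2) (d / 2).
have r10 : 0 < r1 by rewrite lt_min !divr_gt0.
have r1r : r1 < r by rewrite gt_min; apply/orP; left; lra.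
have f1 : f r1 < f r.
  have := dH r1; rewrite ltW//= => /(_ _)/ltr_normlW; apply.
  by rewrite gt_min; apply/orP; right; lra.
have lr : 0 < ln r - ln r1 by rewrite subr_gt0 ltr_ln.
pose B := (f r - f r1) / (2 * (ln r - ln r1)).
have B0 : 0 < B by rewrite divr_gt0 ?subr_gt0// mulr_gt0.
have BE : B * (2 * (ln r - ln r1)) = f r - f r1.
  by rewrite /B divfK// gt_eqF// mulr_gt0.
exists B => // s rs; have := @log_max_principle B r1 r s r10 (ltW r1r) rs.
by rewrite le_max => /orP[]; lra.
Qed.

Lemma profile_increasing : {in `[0, +oo[ &, {homo f : x y / x < y}}.
Proof.
move=> x y; rewrite !in_itv/= !andbT => x0 y0 xy.
move: x0; rewrite le_eqVlt => /predU1P[x0|x0].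
  by rewrite -x0 f0 profile_gt0// x0.
have [B B0 /(_ y (ltW xy))] := profile_log_growth x0.
have : 0 < B * (ln y - ln x) by rewrite mulr_gt0// subr_gt0 ltr_ln// posrE (lt_trans x0).
lra.
Qed.

(** For the inverse of [f] this is an exponential bound. *)
Lemma profile_exp_bound : exists2 B : R, 0 < B & forall s, 1 <= s -> B * ln s <= f s.
Proof.
have [B B0 H] := @profile_log_growth 1 ltr01; exists B => // s s1.
by have := H _ s1; have := profile_gt0 ltr01; rewrite ln1; lra.
Qed.

Lemma profile_cvgy : f r @[r --> +oo] --> +oo.
Proof.
have [B B0 H] := profile_exp_bound.
apply/cvgryPge => A; near=> s.
have s1 : 1 <= s by near: s; exact: nbhs_pinfty_ge.
apply: le_trans (H _ s1); rewrite mulrC -ler_pdivrMr//.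
rewrite -[leLHS]expRK ler_ln ?posrE ?expR_gt0//.
Unshelve. all: by end_near.
Qed.
End Radial.

(** * Levi-flatness where the profile vanishes *)

Lemma is_derive_cvg (R : numFieldType) (V W : normedModType R) (f : V -> W) p v l :
  h^-1 *: (f (h *: v + p) - f p) @[h --> 0^'] --> l -> is_derive p v f l.
Proof. by move=> H; apply: DeriveDef; [apply/cvg_ex; exists l|apply/cvg_lim]. Qed.

Lemma is_derive_linear_map (R : numFieldType) (V W : normedModType R) (l : V -> W) p v :
  (forall (h : R) x y, l (h *: x + y) = h *: l x + l y) -> is_derive p v l (l v).
Proof.
move=> lD; apply: is_derive_cvg; apply: cvg_near_cst.
near=> h; rewrite lD addrK scalerA mulVf ?scale1r//.
near: h; exact: nbhs_dnbhs_neq.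
Unshelve. all: by end_near.
Qed.

Section LeviFlat.
Variables (R : realType) (F : R[i] -> R) (f : R -> R).
Hypothesis F_profile : forall z, f (complex.Re `|z|) = F z.

(** Near the origin the defining function is [- Im w], whose second derivatives
    vanish. *)
Lemma levi_flat_of_zero (r : R) : 0 < r -> (forall x, 0 <= x < r -> f x = 0) ->
  levi_flat_around (Omega_ F) (rho_ F) ((0, 0), (0, 0)).
Proof.
move=> r0 fz; rewrite /levi_flat_around.
pose u x := (rho_ F (toC2 x))%:C.
pose B := ball (((0, 0), (0, 0)) : (R * R) * (R * R)) (r / 2).
have Bu x : B x -> u x = (- x.2.2)%:C.
  move=> [[/= x1 x2] _]; rewrite /u /rho_ /toC2/= -F_profile normc_def/= fz ?sub0r//.
  rewrite sqrtr_ge0/= -[ltRHS]ger0_norm ?ltW// -sqrtr_sqr ltr_sqrt ?exprn_gt0//.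
  move: x1 x2; rewrite /ball/= !sub0r !normrN => x1 x2.
  rewrite -[_.1.1 ^+ 2]real_normK ?num_real// -[_.1.2 ^+ 2]real_normK ?num_real//.
  have := normr_ge0 x.1.1; have := normr_ge0 x.1.2; nra.
have dB k x : (\forall y \near x, B y) ->
    d_zbar k u x = 2^-1 * ((- (dir_x k).2.2)%:C + 'i * (- (dir_y k).2.2)%:C).
  move=> xB; rewrite /d_zbar.
  suff cE v : cderive v u x = (- v.2.2)%:C.
    by rewrite !cE.
  rewrite /cderive.
  have -> : 'D_v (fun y => complex.Re (u y)) x = - v.2.2.
    rewrite (@near_eq_derive _ _ _ _ (fun y => - y.2.2)); last first.
      by near=> y; rewrite Bu//; near: y.
    have lin : forall (h : R) (y z : (R * R) * (R * R)),
        - (h *: y + z).2.2 = h *: - y.2.2 - z.2.2 by move=> h y z /=; rewrite scalerN opprD.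
    by have [_ ->] := @is_derive_linear_map _ _ _ (fun y : (R * R) * (R * R) => - y.2.2) x v lin.
  have -> : 'D_v (fun y => complex.Im (u y)) x = 0.
    by rewrite /u/= derive_cst.
  by [].
have nB : \forall q \near ((0, 0), (0, 0)), \forall y \near q, B y.
  by apply: nbhs_interior; apply: nbhsx_ballx; rewrite divr_gt0.
near=> q => _ xi _.
have qB : \forall y \near q, B y by near: q.
rewrite /levi_form big1// => j _; rewrite big1// => k _.
suff -> : d_z j (d_zbar k u) q = 0 by rewrite !mul0r.
rewrite /d_z; suff cE v : cderive v (d_zbar k u) q = 0 by rewrite !cE mulr0 subr0 mulr0.
have qBB : \forall y \near q, \forall z \near y, B z by exact: nbhs_interior.
rewrite /cderive; pose c := 2^-1 * ((- (dir_x k).2.2)%:C + 'i * (- (dir_y k).2.2)%:C) : R[i].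
rewrite (@near_eq_derive _ _ _ _ (cst (complex.Re c))); last first.
  by near=> y; rewrite dB//; near: y.
rewrite derive_cst.
rewrite (@near_eq_derive _ _ _ _ (cst (complex.Im c))); last first.
  by near=> y; rewrite dB//; near: y.
by rewrite derive_cst.
Unshelve. all: by end_near.
Qed.

End LeviFlat.

(** * Borel sets, continuous functions and Fubini on products of real lines *)

(** Countable bases of measurable sets pass to products, so that the open sets of a
    product topology belong to the product sigma-algebra. *)
Definition measurable_base (T : topologicalType) (me : set (set T)) :=
  exists B : nat -> set T, (forall n, me (B n)) /\
    forall O x, open O -> O x -> exists n, B n x /\ B n `<=` O.

Lemma measurable_base_prod (T1 T2 : topologicalType) me1 me2 (me : set (set (T1 * T2))) :
  (forall A B, me1 A -> me2 B -> me (A `*` B)) ->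
  measurable_base me1 -> measurable_base me2 -> measurable_base me.
Proof.
move=> me12 [B1 [mB1 HB1]] [B2 [mB2 HB2]].
exists (fun n => if (unpickle n : option (nat * nat)) is Some p
   then B1 p.1 `*` B2 p.2 else B1 0 `*` B2 0); split.
  by move=> n; case: unpickle => [p|]; exact: me12.
move=> O [x y] oO Oxy.
have : nbhs (x, y) O by exact: open_nbhs_nbhs.
move=> [[/= U V] [Ux Vy] UV].
have [i [Bix BiU]] := HB1 _ x (@open_interior _ U) Ux.
have [j [Bjy BjV]] := HB2 _ y (@open_interior _ V) Vy.
exists (pickle (i, j)); rewrite pickleK/=; split=> // -[a b] /= [Ba Bb].
by apply: UV; split=> /=; apply: interior_subset; [exact: BiU|exact: BjV].
Qed.

Lemma measurable_base_real (R : realType) : measurable_base (measurable : set (set (measurableTypeR R))).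
Proof.
pose I (p : rat * rat) : set R := [set` `]ratr p.1, ratr p.2[ : interval R].
exists (fun n => if (unpickle n : option (rat * rat)) is Some p
   then I p else I (0, 0)); split.
  by move=> n; case: unpickle => [p|]; exact: measurable_itv.
move=> O x oO Ox.
have /nbhs_ballP[e /= e0 eO] : nbhs (x : R) O by exact: open_nbhs_nbhs.
have [a] : exists a : rat, ratr a \in `]x - e, x[ by apply: rat_in_itvoo; rewrite ltrBlDr ltrDl.
have [b] : exists a : rat, ratr a \in `]x, x + e[ by apply: rat_in_itvoo; rewrite ltrDl.
rewrite !in_itv/= => /andP[b1 b2] /andP[a1 a2].
exists (pickle (a, b)); rewrite pickleK/=; split=> [|y]; rewrite /I/= !in_itv/=.
  by rewrite a2.
move=> /andP[y1 y2]; apply: eO; rewrite /ball/= ltr_norml; apply/andP; split; lra.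
Qed.

Lemma measurable_base_open (T : topologicalType) (me : set (set T)) :
  me set0 -> (forall F : nat -> set T, (forall n, me (F n)) -> me (\bigcup_n F n)) ->
  measurable_base me -> forall O, open O -> me O.
Proof.
move=> me0 meU [B [mB HB]] O oO.
rewrite (_ : O = \bigcup_n (if `[<B n `<=` O>] then B n else set0)).
  by apply: meU => n; case: ifP.
apply/seteqP; split=> [x Ox|x [n _]].
  by have [n [Bn BO]] := HB _ _ oO Ox; exists n => //; rewrite asboolT.
by case: ifPn => // /asboolP + Bn; exact.
Qed.

Notation lebesgue3 R := (lebesgue2 R \x @lebesgue_measure R)%E.
Notation mu4 R := (lebesgue2 R \x lebesgue2 R)%E.

Section Borel.
Variable R : realType.
Notation E2 := (measurableTypeR R * measurableTypeR R)%type.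
Notation E3 := (measurableTypeR R * measurableTypeR R * measurableTypeR R)%type.
Notation E4 := ((measurableTypeR R * measurableTypeR R) * (measurableTypeR R * measurableTypeR R))%type.

Lemma measurable_base2 : @measurable_base (R * R)%type (measurable : set (set E2)).
Proof.
apply: measurable_base_prod (@measurable_base_real R) (@measurable_base_real R) => A B mA mB; exact: measurableX.
Qed.

Lemma measurable_base3 : @measurable_base (R * R * R)%type (measurable : set (set E3)).
Proof.
apply: measurable_base_prod measurable_base2 (@measurable_base_real R) => A B mA mB; exact: measurableX.
Qed.

Lemma measurable_base4 : @measurable_base ((R * R) * (R * R))%type (measurable : set (set E4)).
Proof.
apply: measurable_base_prod measurable_base2 measurable_base2 => A B mA mB; exact: measurableX.
Qed.

Lemma open_measurable2 (O : set (R * R)) : open O -> measurable (O : set E2).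
Proof.
by apply: measurable_base_open measurable_base2 O; [exact: measurable0|move=> F mF; exact: bigcup_measurable].
Qed.

Lemma open_measurable3 (O : set (R * R * R)) : open O -> measurable (O : set E3).
Proof.
by apply: measurable_base_open measurable_base3 O; [exact: measurable0|move=> F mF; exact: bigcup_measurable].
Qed.

Lemma open_measurable4 (O : set ((R * R) * (R * R))) : open O -> measurable (O : set E4).
Proof.
by apply: measurable_base_open measurable_base4 O; [exact: measurable0|move=> F mF; exact: bigcup_measurable].
Qed.

Lemma superlevel_open (T : topologicalType) (K : set T) (u : T -> R) c :
  (forall x, K x -> {for x, continuous u}) ->
  K `&` u @^-1` `]c, +oo[ = K `&` interior (u @^-1` `]c, +oo[).
Proof.
move=> uc; apply/seteqP; split=> x [Kx] ux; split=> //; last exact: interior_subset ux.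
apply: (uc x Kx); apply: open_nbhs_nbhs; split => //.
Qed.

Lemma continuous_compact_bounded (T : topologicalType) (K : set T) (u : T -> R) :
  compact K -> (forall x, K x -> {for x, continuous u}) -> [bounded u x | x in K].
Proof.
move=> cK uc; have : compact [set u x | x in K].
  apply: continuous_compact cK; apply: continuous_in_subspaceT => x.
  by rewrite inE => /uc.
move=> /compact_bounded[M [Mr H]]; exists M; split=> // N MN x Kx.
by apply: (H N MN); exists x.
Qed.

Lemma measurable_fun_cont2 (K : set (R * R)) (u : R * R -> R) :
  measurable (K : set E2) -> (forall x, K x -> {for x, continuous u}) ->
  measurable_fun (K : set E2) u.
Proof.
move=> mK uc; apply: (measurability _ (RGenOInfty.measurableE R)).
move=> _ [_ [c ->] <-]; rewrite superlevel_open//.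
by apply: measurableI => //; apply: open_measurable2; exact: open_interior.
Qed.

Lemma measurable_fun_cont3 (K : set (R * R * R)) (u : R * R * R -> R) :
  measurable (K : set E3) -> (forall x, K x -> {for x, continuous u}) ->
  measurable_fun (K : set E3) u.
Proof.
move=> mK uc; apply: (measurability _ (RGenOInfty.measurableE R)).
move=> _ [_ [c ->] <-]; rewrite superlevel_open//.
by apply: measurableI => //; apply: open_measurable3; exact: open_interior.
Qed.

Lemma measurable_fun_cont4 (K : set ((R * R) * (R * R))) (u : (R * R) * (R * R) -> R) :
  measurable (K : set E4) -> (forall x, K x -> {for x, continuous u}) ->
  measurable_fun (K : set E4) u.
Proof.
move=> mK uc; apply: (measurability _ (RGenOInfty.measurableE R)).
move=> _ [_ [c ->] <-]; rewrite superlevel_open//.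
by apply: measurableI => //; apply: open_measurable4; exact: open_interior.
Qed.

Lemma integrable_cont2 (K : set (R * R)) (u : R * R -> R) :
  measurable (K : set E2) -> (lebesgue2 R K < +oo)%E -> compact K ->
  (forall x, K x -> {for x, continuous u}) ->
  (lebesgue2 R).-integrable K (EFin \o u).
Proof.
move=> mK fK cK uc; apply: measurable_bounded_integrable => //.
  exact: measurable_fun_cont2.
exact: continuous_compact_bounded.
Qed.

Lemma integrable_cont3 (K : set (R * R * R)) (u : R * R * R -> R) :
  measurable (K : set E3) -> (lebesgue3 R K < +oo)%E -> compact K ->
  (forall x, K x -> {for x, continuous u}) ->
  (lebesgue3 R).-integrable K (EFin \o u).
Proof.
move=> mK fK cK uc; apply: measurable_bounded_integrable => //.
  exact: measurable_fun_cont3.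
exact: continuous_compact_bounded.
Qed.

Lemma integrable_cont4 (K : set ((R * R) * (R * R))) (u : (R * R) * (R * R) -> R) :
  measurable (K : set E4) -> (mu4 R K < +oo)%E -> compact K ->
  (forall x, K x -> {for x, continuous u}) ->
  (mu4 R).-integrable K (EFin \o u).
Proof.
move=> mK fK cK uc; apply: measurable_bounded_integrable => //.
  exact: measurable_fun_cont4.
exact: continuous_compact_bounded.
Qed.

End Borel.

Section FubiniBox.
Local Open Scope ereal_scope.
Context d1 d2 (T1 : measurableType d1) (T2 : measurableType d2) (R : realType).
Variables (m1 : {sigma_finite_measure set T1 -> \bar R})
  (m2 : {sigma_finite_measure set T2 -> \bar R}).
Variables (A : set T1) (B : set T2) (f : T1 * T2 -> \bar R).
Hypotheses (mA : measurable A) (mB : measurable B).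
Hypothesis fi : (m1 \x m2).-integrable (A `*` B) f.

Let fi' : (m1 \x m2).-integrable setT (f \_ (A `*` B)).
Proof. by have /integrable_mkcond <- := measurableX mA mB. Qed.

Lemma fubini_box1 :
  \int[m1 \x m2]_(x in A `*` B) f x = \int[m1]_(x in A) \int[m2]_(y in B) f (x, y).
Proof.
rewrite integral_mkcond -(integral12_prod_meas1 fi') [RHS]integral_mkcond.
apply: eq_integral => x _; rewrite /fubini_F /patch.
case: ifPn => [|/negP]; rewrite inE => xA.
  rewrite [RHS]integral_mkcond; apply: eq_integral => y _; rewrite /patch.
  by rewrite in_setX (mem_set xA).
by rewrite integral0_eq// => y _; rewrite in_setX; case: ifPn => // /andP[]; rewrite inE.
Qed.

Lemma fubini_box2 :
  \int[m1 \x m2]_(x in A `*` B) f x = \int[m2]_(y in B) \int[m1]_(x in A) f (x, y).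
Proof.
rewrite integral_mkcond -(integral21_prod_meas1 fi') [RHS]integral_mkcond.
apply: eq_integral => y _; rewrite /fubini_G /patch.
case: ifPn => [|/negP]; rewrite inE => yB.
  rewrite [RHS]integral_mkcond; apply: eq_integral => x _; rewrite /patch.
  by rewrite in_setX (mem_set yB) andbT.
by rewrite integral0_eq// => x _; rewrite in_setX; case: ifPn => // /andP[_]; rewrite inE.
Qed.

End FubiniBox.

(** * A compactly supported radial weight on the plane *)

Section Cont.
Context {R : realType} {T : topologicalType}.
Implicit Types (f g : T -> R) (x : T).

Lemma contD f g x : {for x, continuous f} -> {for x, continuous g} ->
  {for x, continuous (fun y => f y + g y)}.
Proof. exact: (@cvgD _ R^o). Qed.
Lemma contN f x : {for x, continuous f} -> {for x, continuous (fun y => - f y)}.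
Proof. exact: (@cvgN _ R^o). Qed.
Lemma contS f g x : {for x, continuous f} -> {for x, continuous g} ->
  {for x, continuous (fun y => f y - g y)}.
Proof. exact: (@cvgB _ R^o). Qed.
Lemma contM f g x : {for x, continuous f} -> {for x, continuous g} ->
  {for x, continuous (fun y => f y * g y)}.
Proof. exact: cvgM. Qed.
Lemma contX f n x : {for x, continuous f} -> {for x, continuous (fun y => f y ^+ n)}.
Proof.
move=> fc; elim: n => [|n IH]; first exact: cvg_cst.
rewrite (_ : (fun y => _) = (fun y => f y * f y ^+ n)); first exact: contM.
by apply/funext => y; rewrite exprS.
Qed.
Lemma contmax f g x : {for x, continuous f} -> {for x, continuous g} ->
  {for x, continuous (fun y => Num.max (f y) (g y))}.
Proof. exact: continuous_max. Qed.
Lemma contcst (U : topologicalType) (c : U) x : {for x, continuous (fun _ => c)}.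
Proof. exact: cvg_cst. Qed.
Lemma contid x : {for x, continuous (fun y => y)}.
Proof. exact: cvg_id. Qed.
Lemma contfst (U V : topologicalType) (h : T -> U * V) x :
  {for x, continuous h} -> {for x, continuous (fun y => (h y).1)}.
Proof. by move=> hc; apply: cvg_comp hc _; exact: cvg_fst. Qed.
Lemma contsnd (U V : topologicalType) (h : T -> U * V) x :
  {for x, continuous h} -> {for x, continuous (fun y => (h y).2)}.
Proof. by move=> hc; apply: cvg_comp hc _; exact: cvg_snd. Qed.
Lemma contcomp (U V : topologicalType) (g : U -> V) (h : T -> U) x :
  {for h x, continuous g} -> {for x, continuous h} -> {for x, continuous (fun y => g (h y))}.
Proof. by move=> gc hc; exact: continuous_comp. Qed.
End Cont.

Ltac cts := repeat lazymatch goal with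
  | |- prop_for _ (inPhantom (forall x, continuous_at x ?f)) =>
    lazymatch f with
    | (fun _ => ?c) => exact: contcst
    | (fun y => y) => exact: contid
    | (fun y => (@?a y + @?b y)%R) => refine (@contD _ _ _ _ _ _ _)
    | (fun y => (- (@?a y))%R) => refine (@contN _ _ _ _ _)
    | (fun y => ((@?a y) * (@?b y))%R) => refine (@contM _ _ _ _ _ _ _)
    | (fun y => ((@?a y) ^+ ?n)%R) => refine (@contX _ _ _ _ _ _)
    | (fun y => Order.max (@?a y) (@?b y)) => refine (@contmax _ _ _ _ _ _ _)
    | (fun y => (@?a y, @?b y)) => refine (@continuous_pair _ _ _ _ _ _ _ _)
    | _ => first
      [ assumption | exact: contid
      | refine (@contfst _ _ _ _ _ _) | refine (@contsnd _ _ _ _ _ _) ]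
    end
  end.

Lemma is_derive_line (R : realType) (V : normedModType R) (f : V -> R) p v (t : R) l :
  is_derive (p + t *: v) v f l -> is_derive (t : R) (1 : R) (fun s : R => f (p + s *: v)) l.
Proof.
move=> [df fl]; apply: is_derive_cvg.
have -> : (fun h : R => h^-1 *: (f (p + (h *: (1 : R) + t) *: v) - f (p + t *: v))) =
   (fun h : R => h^-1 *: ((f \o shift (p + t *: v)) (h *: v) - f (p + t *: v))).
  apply/funext => h /=; congr (_ *: (f _ - _)).
  by rewrite scalerDl [h *: 1]mulr1 addrCA.
by rewrite -fl; exact: df.
Qed.

Section Window.
Variable R : realType.

(** Unlike the positive part itself, its square is of class C^1. *)
Definition pos2 (s : R) := Num.max 0 s ^+ 2.

Lemma is_derive_pos2 (s : R) : is_derive (s : R) (1 : R) pos2 (2 * Num.max 0 s).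
Proof.
apply: is_derive_cvg; apply/cvgrPdist_le => e e0.
near=> h; have h0 : h != 0 by near: h; exact: nbhs_dnbhs_neq.
have he : `|h| <= e.
  near: h; apply: (@cvg_within _ (nbhs (0 : R))).
  by apply/nbhs_ballP; exists e => //= y; rewrite /ball/= sub0r normrN => /ltW.
rewrite [h *: 1]mulr1.
pose D := pos2 (h + s) - pos2 s - h * (2 * Num.max 0 s).
have -> : 2 * Num.max 0 s - h^-1 *: (pos2 (h + s) - pos2 s) = - (h^-1 * D).
  by rewrite /D /GRing.scale/=; field.
rewrite normrN normrM normfV mulrC ler_pdivrMr ?normr_gt0//.
apply: (@le_trans _ _ (`|h| * `|h|)); last by rewrite ler_wpM2r.
rewrite -expr2 real_normK ?num_real// /D /pos2 ler_norml.
have h2 := sqr_ge0 h.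
have [s0|s0] := leP 0 s; have [hs|hs] := leP 0 (h + s); apply/andP; split; nra.
Unshelve. all: by end_near.
Qed.

Lemma continuous_pos2 : continuous pos2.
Proof. move=> s; apply: (@continuous_is_derive _ _ (fun s => 2 * Num.max 0 s)).
exact: is_derive_pos2. Qed.

Definition bump_arg (d : R) (a x : R * R) : R :=
  1 - ((x.1 - a.1) ^+ 2 + (x.2 - a.2) ^+ 2) / d ^+ 2.
Definition bump (d : R) (a x : R * R) : R := pos2 (bump_arg d a x).
(** The gradient of [bump d a] at [x] is [- dbump d a x] times [x - a]. *)
Definition dbump (d : R) (a x : R * R) : R := 4 / d ^+ 2 * Num.max 0 (bump_arg d a x).

Definition seg (c d : R) : set R := [set` `[c - d, c + d]].
Definition box (a : R * R) (d : R) : set (R * R) := seg a.1 d `*` seg a.2 d.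

Lemma bump_arg_le1 d a x : bump_arg d a x <= 1.
Proof. by rewrite /bump_arg gerBl mulr_ge0 ?invr_ge0 ?addr_ge0// sqr_ge0. Qed.

Lemma bump_ge0 d a x : 0 <= bump d a x. Proof. exact: sqr_ge0. Qed.

Lemma bump_le1 d a x : bump d a x <= 1.
Proof.
rewrite /bump /pos2 expr_le1 ?le_max ?lexx//.
by rewrite ge_max ler01 bump_arg_le1.
Qed.

Lemma bump_center_ge d a x : 0 < d -> box a (d / 2) x -> 4^-1 <= bump d a x.
Proof.
move=> d0 [/=]; rewrite /seg/= !in_itv/= => /andP[a1 a2] /andP[b1 b2].
have h : 2^-1 <= bump_arg d a x.
  rewrite /bump_arg lerBrDr -lerBrDl ler_pdivrMr ?exprn_gt0//; nra.
rewrite /bump /pos2 (_ : 4^-1 = 2^-1 ^+ 2); last by field.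
by apply: lerXn2r; rewrite ?nnegrE ?le_max ?lexx ?h ?orbT//; lra.
Qed.

Lemma bump_eq0 d a x : 0 < d -> ~ box a d x -> bump d a x = 0.
Proof.
move=> d0 xd; rewrite /bump /pos2 max_l ?expr0n//.
rewrite /bump_arg subr_le0 ler_pdivlMr ?exprn_gt0// mul1r.
have h1 := sqr_ge0 (x.1 - a.1); have h2 := sqr_ge0 (x.2 - a.2).
rewrite leNgt; apply/negP => h; apply: xd.
by split; rewrite /seg/= in_itv/=; apply/andP; split; rewrite leNgt; apply/negP => ?; nra.
Qed.

Lemma bump_edge d a x : 0 < d -> (x.1 - a.1) ^+ 2 = d ^+ 2 \/ (x.2 - a.2) ^+ 2 = d ^+ 2 ->
  bump d a x = 0.
Proof.
move=> d0 H; rewrite /bump /pos2 max_l ?expr0n//.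
rewrite /bump_arg subr_le0 ler_pdivlMr ?exprn_gt0// mul1r.
have h1 := sqr_ge0 (x.1 - a.1); have h2 := sqr_ge0 (x.2 - a.2).
by case: H => ->; lra.
Qed.

Lemma continuous_bump_arg d a x : {for x, continuous (bump_arg d a)}.
Proof.
suff : {for x, continuous
  (fun y : R * R => 1 - ((y.1 - a.1) ^+ 2 + (y.2 - a.2) ^+ 2) / d ^+ 2)} by [].
by cts.
Qed.

Lemma continuous_bump d a x : {for x, continuous (bump d a)}.
Proof.
apply: (@contcomp _ _ _ pos2 (bump_arg d a)); first exact: continuous_pos2.
exact: continuous_bump_arg.
Qed.

Lemma continuous_dbump d a x : {for x, continuous (dbump d a)}.
Proof.
have := @continuous_bump_arg d a x => c.
suff : {for x, continuous (fun y => 4 / d ^+ 2 * Num.max 0 (bump_arg d a y))} by [].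
by cts.
Qed.

Lemma is_derive_bump1 d a (x y : R) :
  is_derive (x : R) (1 : R) (fun x => bump d a (x, y)) (- (dbump d a (x, y) * (x - a.1))).
Proof.
have H : is_derive (x : R) (1 : R) (fun x => bump_arg d a (x, y)) (- (2 * (x - a.1) / d ^+ 2)).
  by rewrite /bump_arg/=; apply: is_derive_eq; rewrite /GRing.scale/=; ring.
have := @is_derive1_comp _ pos2 (fun x => bump_arg d a (x, y)) x _ _ (is_derive_pos2 _) H.
by move=> H2; apply: (is_derive_eq H2); rewrite /dbump; ring.
Qed.

Lemma is_derive_bump2 d a (x y : R) :
  is_derive (y : R) (1 : R) (fun y => bump d a (x, y)) (- (dbump d a (x, y) * (y - a.2))).
Proof.
have H : is_derive (y : R) (1 : R) (fun y => bump_arg d a (x, y)) (- (2 * (y - a.2) / d ^+ 2)).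
  by rewrite /bump_arg/=; apply: is_derive_eq; rewrite /GRing.scale/=; ring.
have := @is_derive1_comp _ pos2 (fun y => bump_arg d a (x, y)) y _ _ (is_derive_pos2 _) H.
by move=> H2; apply: (is_derive_eq H2); rewrite /dbump; ring.
Qed.

Lemma measurable_seg c d : measurable (seg c d : set (measurableTypeR R)).
Proof. exact: measurable_itv. Qed.

Lemma measurable_box a d :
  measurable (box a d : set (measurableTypeR R * measurableTypeR R)).
Proof. by apply: measurableX; exact: measurable_seg. Qed.

Lemma compact_box a d : compact (box a d).
Proof. by apply: compact_setX; exact: segment_compact. Qed.

Lemma lebesgue_seg c d : 0 < d -> @lebesgue_measure R (seg c d) = (2 * d)%:E.
Proof.
move=> d0; rewrite lebesgue_measure_itv/= lte_fin ifT; last by lra.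
by rewrite -EFinB; congr EFin; ring.
Qed.

Lemma lebesgue2_box a d : 0 < d -> lebesgue2 R (box a d) = (4 * d ^+ 2)%:E.
Proof.
move=> d0; rewrite [LHS]product_measure1E//; try exact: measurable_seg.
transitivity ((2 * d)%:E * (2 * d)%:E)%E; first by congr (_ * _)%E; exact: lebesgue_seg.
by rewrite -EFinM; congr EFin; ring.
Qed.

Lemma box_convex a d x r : 0 <= r <= 1 -> box a d x ->
  box a d (a.1 + r * (x.1 - a.1), a.2 + r * (x.2 - a.2)).
Proof.
move=> /andP[r0 r1] [/=]; rewrite /seg/= !in_itv/= => /andP[a1 a2] /andP[b1 b2].
have d0 : 0 <= d by lra.
by split; rewrite /seg/= in_itv/=; apply/andP; split; nra.
Qed.

Lemma box_center a d : 0 <= d -> box a d a.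
Proof. by move=> d0; split; rewrite /seg/= in_itv/=; apply/andP; split; lra. Qed.

Lemma box_sub a d d' : d <= d' -> box a d `<=` box a d'.
Proof.
move=> dd x [/=]; rewrite /seg/= !in_itv/= => /andP[? ?] /andP[? ?].
by split; rewrite /seg/= in_itv/=; apply/andP; split; lra.
Qed.
End Window.

(** * The weighted mean value property in the plane *)

(** Polar coordinates are avoided as follows.  Let [V] be a harmonic conjugate of
    [U].  Along the ray from [a] to [x] the difference [U x - U a] is the integral
    over [r] in [[0, 1]] of
      [(x1 - a1) Vy - (x2 - a2) Vx]  at  [a + r (x - a)],
    which is, up to the factor [1 / r], the derivative of [V (a + r (x - a))] along
    the rotations of [x] around [a].  Its integral against a radial weight is zero
    for every fixed [r].  In rectangular coordinates: integrate by parts in [x2]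
    the term with [Vy] and in [x1] the term with [Vx]; as the weight is radial, both
    lead to the same integral, that of [B]. *)
Section MeanValue2.
Variables (R : realType) (a : R * R) (d : R) (U V Vx Vy : R * R -> R).
Hypothesis d0 : 0 < d.
Hypothesis Vc : forall x, box a d x -> {for x, continuous V}.
Hypothesis Vxc : forall x, box a d x -> {for x, continuous Vx}.
Hypothesis Vyc : forall x, box a d x -> {for x, continuous Vy}.
Hypothesis dU : forall x, box a d x -> forall v : R * R,
  is_derive x v U (v.1 * Vy x - v.2 * Vx x).
Hypothesis dV : forall x, box a d x -> forall v : R * R,
  is_derive x v V (v.1 * Vx x + v.2 * Vy x).

Let ray (r : R) (x : R * R) := (a.1 + r * (x.1 - a.1), a.2 + r * (x.2 - a.2)).
Let b := bump d a.
Let db := dbump d a.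

Let cont_ray (T : topologicalType) (W : R * R -> R) (r : T -> R) (x : T -> R * R) (t : T) :
  (forall x, box a d x -> {for x, continuous W}) ->
  {for t, continuous r} -> {for t, continuous x} ->
  0 <= r t <= 1 -> box a d (x t) -> {for t, continuous (fun s => W (ray (r s) (x s)))}.
Proof.
move=> Wc rc xc r01 xb; apply: (@contcomp _ _ _ W (fun s => ray (r s) (x s))).
  by apply: Wc; exact: box_convex.
by rewrite /ray; cts.
Qed.

Let cont_b (T : topologicalType) (x : T -> R * R) (t : T) :
  {for t, continuous x} -> {for t, continuous (fun s => b (x s))}.
Proof. by move=> xc; apply: contcomp xc; exact: continuous_bump. Qed.

Let cont_db (T : topologicalType) (x : T -> R * R) (t : T) :
  {for t, continuous x} -> {for t, continuous (fun s => db (x s))}.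
Proof. by move=> xc; apply: contcomp xc; exact: continuous_dbump. Qed.

Let A1 r x := b x * ((x.1 - a.1) * Vy (ray r x)).
Let A2 r x := b x * ((x.2 - a.2) * Vx (ray r x)).
Let B r x := db x * ((x.1 - a.1) * (x.2 - a.2)) * (V (ray r x) / r).

Let contA1 (T : topologicalType) (r : T -> R) (x : T -> R * R) (t : T) :
  {for t, continuous r} -> {for t, continuous x} ->
  0 <= r t <= 1 -> box a d (x t) -> {for t, continuous (fun s => A1 (r s) (x s))}.
Proof.
move=> rc xc r01 xb; have h1 := cont_ray Vyc rc xc r01 xb; have h2 := cont_b xc.
by rewrite /A1; cts.
Qed.

Let contA2 (T : topologicalType) (r : T -> R) (x : T -> R * R) (t : T) :
  {for t, continuous r} -> {for t, continuous x} ->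
  0 <= r t <= 1 -> box a d (x t) -> {for t, continuous (fun s => A2 (r s) (x s))}.
Proof.
move=> rc xc r01 xb; have h1 := cont_ray Vxc rc xc r01 xb; have h2 := cont_b xc.
by rewrite /A2; cts.
Qed.

Let contB (T : topologicalType) (r : R) (x : T -> R * R) (t : T) :
  {for t, continuous x} ->
  0 <= r <= 1 -> box a d (x t) -> {for t, continuous (fun s => B r (x s))}.
Proof.
move=> xc r01 xb.
have h1 := @cont_ray _ V (fun=> r) x t Vc ltac:(by cts) xc r01 xb; have h2 := cont_db xc.
by rewrite /B; cts.
Qed.

Let seg_left c : seg c d (c - d).
Proof. by rewrite /seg/= in_itv/=; apply/andP; split; have := d0; lra. Qed.

Let seg_right c : seg c d (c + d).
Proof. by rewrite /seg/= in_itv/=; apply/andP; split; have := d0; lra. Qed.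

(** [A1 - B] is a derivative in the second coordinate, and the weight vanishes on the
    edges of the box. *)
Lemma int_A1B r x1 : 0 < r <= 1 -> seg a.1 d x1 ->
  (\int[lebesgue_measure]_(y in seg a.2 d) (A1 r (x1, y) - B r (x1, y))%:E = 0)%E.
Proof.
move=> /andP[r0 r1] x1s; have r01 : 0 <= r <= 1 by rewrite (ltW r0).
pose P (y : R) : R := b (x1, y) * ((x1 - a.1) / r * V (ray r (x1, y))).
have dP (y : R) : seg a.2 d y -> is_derive (y : R) (1 : R) P (A1 r (x1, y) - B r (x1, y)).
  move=> ys.
  have xb : box a d (x1, y) by [].
  have h1 : is_derive (y : R) (1 : R) (fun y : R => V (ray r (x1, y))) (r * Vy (ray r (x1, y))).
    pose p := (a.1 + r * (x1 - a.1), a.2 - r * a.2).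
    have e (s : R) : ray r (x1, s) = p + s *: (0, r).
      rewrite /ray /p /=; congr pair; rewrite /GRing.scale/= /GRing.scale/=; ring.
    rewrite (_ : (fun _ => _) = (fun s : R => V (p + s *: (0, r)))); last by apply/funext => s; rewrite e.
    apply: is_derive_line; rewrite -e.
    by apply: (is_derive_eq (dV (box_convex r01 xb) _)); rewrite /= mul0r add0r.
  have h2 := is_derive_bump2 d a x1 y.
  have := is_deriveM h2 (is_deriveM (is_derive_cst ((x1 - a.1) / r) (y : R) (1 : R)) h1).
  move=> h3; apply: (is_derive_eq h3); rewrite /A1 /B /b /db !mulrfctE /cst /GRing.scale/=.
  by field; rewrite gt_eqF.
rewrite (@continuous_FTC2 _ (fun y => A1 r (x1, y) - B r (x1, y)) P); first last.
- by move=> y yd; rewrite derive1E; apply: derive_val; apply: dP; exact: subset_itv_oo_cc yd.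
- split.
  + by move=> y yd; case: (dP y _) => //; exact: subset_itv_oo_cc yd.
  + apply: cvg_at_right_filter; apply: (@continuous_is_derive _ P (fun y => A1 r (x1, y) - B r (x1, y))).
    by apply: dP; exact: seg_left.
  + apply: cvg_at_left_filter; apply: (@continuous_is_derive _ P (fun y => A1 r (x1, y) - B r (x1, y))).
    by apply: dP; exact: seg_right.
- apply: continuous_in_subspaceT => y; rewrite inE => ys.
  have xb : box a d (x1, y) by [].
  have pc : {for y, continuous (fun y : R => (x1, y))} by cts.
  have h1 := @contA1 _ (fun=> r) _ y ltac:(by cts) pc r01 xb.
  have h2 := @contB _ r _ y pc r01 xb.
  exact: (contS h1 h2).
- by rewrite ltrBlDr -addrA ltrDl addr_gt0.
have P0 y : (y - a.2) ^+ 2 = d ^+ 2 -> P y = 0.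
  by move=> yd; rewrite /P /b bump_edge ?mul0r//; right.
by rewrite !P0 ?subee//; ring.
Qed.

Lemma int_A2B r x2 : 0 < r <= 1 -> seg a.2 d x2 ->
  (\int[lebesgue_measure]_(y in seg a.1 d) (A2 r (y, x2) - B r (y, x2))%:E = 0)%E.
Proof.
move=> /andP[r0 r1] x2s; have r01 : 0 <= r <= 1 by rewrite (ltW r0).
pose P (y : R) : R := b (y, x2) * ((x2 - a.2) / r * V (ray r (y, x2))).
have dP (y : R) : seg a.1 d y -> is_derive (y : R) (1 : R) P (A2 r (y, x2) - B r (y, x2)).
  move=> ys.
  have xb : box a d (y, x2) by [].
  have h1 : is_derive (y : R) (1 : R) (fun y : R => V (ray r (y, x2))) (r * Vx (ray r (y, x2))).
    pose p := (a.1 - r * a.1, a.2 + r * (x2 - a.2)).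
    have e (s : R) : ray r (s, x2) = p + s *: (r, 0).
      rewrite /ray /p /=; congr pair; rewrite /GRing.scale/= /GRing.scale/=; ring.
    rewrite (_ : (fun _ => _) = (fun s : R => V (p + s *: (r, 0)))); last by apply/funext => s; rewrite e.
    apply: is_derive_line; rewrite -e.
    by apply: (is_derive_eq (dV (box_convex r01 xb) _)); rewrite /= mul0r addr0.
  have h2 := is_derive_bump1 d a y x2.
  have := is_deriveM h2 (is_deriveM (is_derive_cst ((x2 - a.2) / r) (y : R) (1 : R)) h1).
  move=> h3; apply: (is_derive_eq h3); rewrite /A2 /B /b /db !mulrfctE /cst /GRing.scale/=.
  by field; rewrite gt_eqF.
rewrite (@continuous_FTC2 _ (fun y => A2 r (y, x2) - B r (y, x2)) P); first last.
- by move=> y yd; rewrite derive1E; apply: derive_val; apply: dP; exact: subset_itv_oo_cc yd.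
- split.
  + by move=> y yd; case: (dP y _) => //; exact: subset_itv_oo_cc yd.
  + apply: cvg_at_right_filter; apply: (@continuous_is_derive _ P (fun y => A2 r (y, x2) - B r (y, x2))).
    by apply: dP; exact: seg_left.
  + apply: cvg_at_left_filter; apply: (@continuous_is_derive _ P (fun y => A2 r (y, x2) - B r (y, x2))).
    by apply: dP; exact: seg_right.
- apply: continuous_in_subspaceT => y; rewrite inE => ys.
  have xb : box a d (y, x2) by [].
  have pc : {for y, continuous (fun y : R => (y, x2))} by cts.
  have h1 := @contA2 _ (fun=> r) _ y ltac:(by cts) pc r01 xb.
  have h2 := @contB _ r _ y pc r01 xb.
  exact: (contS h1 h2).
- by rewrite ltrBlDr -addrA ltrDl addr_gt0.
have P0 y : (y - a.1) ^+ 2 = d ^+ 2 -> P y = 0.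
  by move=> yd; rewrite /P /b bump_edge ?mul0r//; left.
by rewrite !P0 ?subee//; ring.
Qed.

Lemma int_ray x : box a d x ->
  (\int[lebesgue_measure]_(r in `[0%R, 1%R]) (A1 r x - A2 r x)%:E = (b x * (U x - U a))%:E)%E.
Proof.
move=> xb; pose P (r : R) : R := b x * U (ray r x).
have rayE (r : R) : ray r x = a + r *: (x - a) by [].
have dP (r : R) : 0 <= r <= 1 -> is_derive (r : R) (1 : R) P (A1 r x - A2 r x).
  move=> r01.
  have h1 : is_derive (r : R) (1 : R) (fun r : R => U (ray r x))
     ((x.1 - a.1) * Vy (ray r x) - (x.2 - a.2) * Vx (ray r x)).
    apply: (@is_derive_line _ _ U a (x - a)).
    by apply: (is_derive_eq (dU (box_convex r01 xb) _)).
  have h3 := is_deriveM (is_derive_cst (b x) (r : R) (1 : R)) h1.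
  apply: (is_derive_eq h3); rewrite /A1 /A2 /cst /= /GRing.scale/=; ring.
rewrite (@continuous_FTC2 _ (fun r => A1 r x - A2 r x) P); first last.
- by move=> y yd; rewrite derive1E; apply: derive_val; apply: dP;
    move: (subset_itv_oo_cc yd); rewrite in_itv.
- split.
  + by move=> y yd; case: (dP y _) => //; move: (subset_itv_oo_cc yd); rewrite in_itv.
  + apply: cvg_at_right_filter; apply: (@continuous_is_derive _ P (fun r => A1 r x - A2 r x)).
    by apply: dP; rewrite lexx ler01.
  + apply: cvg_at_left_filter; apply: (@continuous_is_derive _ P (fun r => A1 r x - A2 r x)).
    by apply: dP; rewrite lexx ler01.
- apply: continuous_in_subspaceT => r; rewrite inE/= in_itv/= => r01.
  have h1 := @contA1 _ (fun r=> r) (fun=> x) r ltac:(by cts) ltac:(by cts) r01 xb.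
  have h2 := @contA2 _ (fun r=> r) (fun=> x) r ltac:(by cts) ltac:(by cts) r01 xb.
  exact: (contS h1 h2).
- exact: ltr01.
rewrite /P -EFinB; congr EFin; rewrite mulrBr; congr (_ * U _ - _ * U _); rewrite /ray.
  by rewrite !mul1r [LHS]surjective_pairing/= !subrKC -surjective_pairing.
by rewrite !mul0r !addr0 -surjective_pairing.
Qed.

(** The slice [r = 0] is left out of the exchange of integrals, because of the factor
    [1 / r] in [B]. *)
Lemma mean_value2 :
  (\int[lebesgue2 R]_(x in box a d) (b x * (U x - U a))%:E = 0)%E.
Proof.
have mS := @measurable_box R a d.
have fS : (lebesgue2 R (box a d) < +oo)%E by rewrite lebesgue2_box// ltry.
have cS := @compact_box R a d.
have msg c : measurable (seg c d : set (measurableTypeR R)) by exact: measurable_seg.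
have slice r : 0 < r <= 1 -> (\int[lebesgue2 R]_(x in box a d) (A1 r x - A2 r x)%:E = 0)%E.
  move=> rr; have r01 : 0 <= r <= 1 by case/andP: rr => /ltW -> ->.
  have i1 : (lebesgue2 R).-integrable (box a d) (EFin \o (fun x => A1 r x - B r x)).
    apply: integrable_cont2 => // x xb.
    have h1 := @contA1 _ (fun=> r) (fun x => x) x ltac:(by cts) ltac:(by cts) r01 xb.
    exact: (contS h1 (@contB _ r (fun x => x) x ltac:(by cts) r01 xb)).
  have i2 : (lebesgue2 R).-integrable (box a d) (EFin \o (fun x => A2 r x - B r x)).
    apply: integrable_cont2 => // x xb.
    have h1 := @contA2 _ (fun=> r) (fun x => x) x ltac:(by cts) ltac:(by cts) r01 xb.
    exact: (contS h1 (@contB _ r (fun x => x) x ltac:(by cts) r01 xb)).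
  have e1 : (\int[lebesgue2 R]_(x in box a d) (A1 r x - B r x)%:E = 0)%E.
    rewrite [LHS](@fubini_box1 _ _ _ _ _ (@lebesgue_measure R) (@lebesgue_measure R) _ _
      (fun x => (A1 r x - B r x)%:E))//.
    by apply: integral0_eq => x xs; exact: int_A1B.
  have e2 : (\int[lebesgue2 R]_(x in box a d) (A2 r x - B r x)%:E = 0)%E.
    rewrite [LHS](@fubini_box2 _ _ _ _ _ (@lebesgue_measure R) (@lebesgue_measure R) _ _
      (fun x => (A2 r x - B r x)%:E))//.
    by apply: integral0_eq => x xs; exact: int_A2B.
  have e3 := integralB_EFin mS i1 i2.
  rewrite /= e1 e2 sube0 in e3; rewrite -[RHS]e3.
  by apply: eq_integral => x _; rewrite -EFinB; congr EFin; ring.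
have i3 : (lebesgue3 R).-integrable (box a d `*` `]0, 1]) (EFin \o (fun q => A1 q.2 q.1 - A2 q.2 q.1)).
  apply: (@integrableS _ _ _ (lebesgue3 R) (box a d `*` [set` `[0%R, 1%R]]) (box a d `*` [set` `]0%R, 1%R]])).
  - by apply: measurableX => //; exact: measurable_itv.
  - by apply: measurableX => //; exact: measurable_itv.
  - by move=> q [q1 q2]; split => //; exact: subset_itv_oc_cc q2.
  apply: integrable_cont3.
  - by apply: measurableX => //; exact: measurable_itv.
  - suff -> : (lebesgue3 R) (box a d `*` [set` `[0%R, 1%R]]) = ((4 * d ^+ 2)%:E * 1%:E)%E.
      by rewrite -EFinM ltry.
    rewrite [LHS]product_measure1E//=; congr (_ * _)%E; first exact: lebesgue2_box.
    by rewrite lebesgue_measure_itv/= lte_fin ltr01 -EFinB subr0.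
  - by apply: compact_setX => //; exact: segment_compact.
  move=> [x r] [/= xb]; rewrite /= in_itv/= => r01.
  have c1 : {for (x, r), continuous (fun q : R * R * R => q.1)} by cts.
  have c2 : {for (x, r), continuous (fun q : R * R * R => q.2)} by cts.
  have h1 := contA1 c2 c1 r01 xb; have h2 := contA2 c2 c1 r01 xb.
  exact: (contS h1 h2).
transitivity (\int[lebesgue3 R]_(q in box a d `*` `]0%R, 1%R]) (A1 q.2 q.1 - A2 q.2 q.1)%:E)%E.
  rewrite [RHS](@fubini_box1 _ _ _ _ _ (lebesgue2 R) (@lebesgue_measure R) _ _
      (fun q => (A1 q.2 q.1 - A2 q.2 q.1)%:E))//.
  apply: eq_integral => x; rewrite inE => xb /=.
  rewrite -int_ray// integral_itv_obnd_cbnd//.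
  apply/measurable_EFinP; apply: subspace_continuous_measurable_fun; first exact: measurable_itv.
  apply: continuous_in_subspaceT => r; rewrite inE/= in_itv/= => /andP[/ltW r0 r1].
  have r01 : 0 <= r <= 1 by rewrite r0.
  have h1 := @contA1 _ (fun r=> r) (fun=> x) r ltac:(by cts) ltac:(by cts) r01 xb.
  have h2 := @contA2 _ (fun r=> r) (fun=> x) r ltac:(by cts) ltac:(by cts) r01 xb.
  exact: (contS h1 h2).
rewrite [LHS](@fubini_box2 _ _ _ _ _ (lebesgue2 R) (@lebesgue_measure R) _ _
      (fun q => (A1 q.2 q.1 - A2 q.2 q.1)%:E))//.
apply: integral0_eq => r /=; rewrite in_itv/= => rr; exact: slice.
Qed.

End MeanValue2.

(** * Directional derivatives of functions of class C^1 *)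

Section Dirs.
Variables (R : realType) (V : normedModType R).
Implicit Types (u : V -> R) (D : set V).

Lemma is_derive_dirZ u x v (c l : R) : is_derive x v u l -> is_derive x (c *: v) u (c * l).
Proof.
move=> [du ul]; have [->|c0] := eqVneq c 0.
  apply: is_derive_cvg; rewrite mul0r scale0r.
  rewrite (_ : (fun _ => _) = (fun=> 0)); first exact: cvg_cst.
  by apply/funext => h; rewrite scaler0 add0r subrr scaler0.
apply: is_derive_cvg.
have key : (c * h)^-1 *: (u ((c * h) *: v + x) - u x) @[h --> 0^'] --> l.
  have -> : (fun h => (c * h)^-1 *: (u ((c * h) *: v + x) - u x)) =
    (fun h : R => h^-1 *: ((u \o shift x) (h *: v) - u x)) \o (fun h => c * h) by [].
  apply: (@cvg_comp _ _ _ _ _ _ (0^')); last by rewrite -ul; exact: du.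
  move=> A; rewrite /dnbhs/= => /nbhs_ballP[e /= e0 eA].
  apply/nbhs_ballP; exists (e / `|c|); first by rewrite /= divr_gt0// normr_gt0.
  move=> h; rewrite /ball/= !sub0r !normrN => hc h0; apply: eA; last by rewrite mulf_neq0.
  by rewrite /ball/= sub0r normrN normrM mulrC -ltr_pdivlMr// normr_gt0.
rewrite (_ : (fun h => _) = (fun h => c * ((c * h)^-1 *: (u ((c * h) *: v + x) - u x)))).
  by apply: cvgM => //; exact: cvg_cst.
apply/funext => h; rewrite scalerA [h * c]mulrC /GRing.scale/= invfM.
by rewrite !mulrA divff// mul1r.
Qed.

(** Additivity in the direction comes from the continuity of the derivatives: go from
    [x] to [x + h e] and then to [x + h e + h f], and apply the mean value theorem to
    the second leg. *)
Lemma is_derive_dirD D u x e f : open D -> Ck_on 1 D u -> D x ->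
  is_derive x (e + f) u ('D_e u x + 'D_f u x).
Proof.
move=> oD [uc uD] Dx.
have [_ [fc _]] := uD f; have {}fc := fc _ Dx.
have nD : nbhs x D by exact: open_nbhs_nbhs.
apply: is_derive_cvg; apply/cvgrPdist_le => ep ep0.
have ep2 : 0 < ep / 2 by rewrite divr_gt0.
have /cvgrPdist_le /(_ _ ep2) nf := fc.
have : nbhs x (D `&` [set t | `|'D_f u x - 'D_f u t| <= ep / 2]) by exact: filterI.
move=> /nbhs_ballP[dl /= dl0 dlH].
have /cvgrPdist_le /(_ _ ep2) ne :
  h^-1 *: (u (h *: e + x) - u x) @[h --> 0^'] --> 'D_e u x.
  by have [de _] := uD e; exact: (de _ Dx).
pose M := `|e| + `|f| + 1.
have M0 : 0 < M by rewrite /M ltr_wpDl ?addr_ge0.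
near=> h.
have h0 : h != 0 by near: h; exact: nbhs_dnbhs_neq.
have hM : `|h| * M < dl.
  rewrite -ltr_pdivlMr//; near: h; apply: (@cvg_within _ (nbhs (0 : R))).
  apply/nbhs_ballP; exists (dl / M); first by rewrite /= divr_gt0.
  by move=> y; rewrite /ball/= sub0r normrN.
have inb s : 0 <= s <= 1 -> ball x dl (h *: e + x + s *: (h *: f)).
  move=> /andP[s0 s1]; rewrite -ball_normE/= addrAC opprD addrCA subrr addr0 normrN.
  apply: le_lt_trans (ler_normD _ _) _; rewrite !normrZ.
  apply: le_lt_trans hM; rewrite /M.
  have := normr_ge0 h; have := normr_ge0 e; have := normr_ge0 f.
  rewrite (ger0_norm s0) => f0 e0 hh.
  have : s * (`|h| * `|f|) <= `|h| * `|f| by rewrite ler_piMl// mulr_ge0.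
  lra.
pose g (s : R) : R := u (h *: e + x + s *: (h *: f)).
have dg (s : R) : 0 <= s <= 1 -> is_derive (s : R) (1 : R) g (h * 'D_f u (h *: e + x + s *: (h *: f))).
  move=> s01; apply: is_derive_line; apply: is_derive_dirZ.
  split; last by []; have [df _] := uD f; apply: df; exact: (dlH _ (inb s s01)).1.
have [||c c01] := @MVT_segment _ g (fun s => h * 'D_f u (h *: e + x + s *: (h *: f))) 0 1 ler01.
- by move=> s; rewrite in_itv/= => /andP[/ltW s0 /ltW s1]; apply: dg; rewrite s0.
- apply: continuous_in_subspaceT => s; rewrite inE/= in_itv/= => s01.
  exact: (@continuous_is_derive _ g (fun s => h * 'D_f u (h *: e + x + s *: (h *: f))) s (dg _ s01)).
rewrite /g subr0 mulr1 scale1r scale0r addr0 => gE.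
have -> : h *: (e + f) + x = h *: e + x + h *: f by rewrite scalerDr addrAC.
have -> : u (h *: e + x + h *: f) = u (h *: e + x) + h * 'D_f u (h *: e + x + c *: (h *: f)).
  by rewrite -gE; ring.
rewrite in_itv/= in c01.
have h1 : `|'D_f u x - 'D_f u (h *: e + x + c *: (h *: f))| <= ep / 2 := (dlH _ (inb c c01)).2.
have h2 : `|'D_e u x - h^-1 *: (u (h *: e + x) - u x)| <= ep / 2 by near: h.
rewrite (splitr ep); apply: le_trans (lerD h2 h1); apply: le_trans (ler_normD _ _).
by rewrite le_eqVlt; apply/orP; left; apply/eqP; congr (`| _ |); rewrite /GRing.scale/=; field.
Unshelve. all: by end_near.
Qed.

Lemma is_derive_dir2 D u x e f (a b : R) : open D -> Ck_on 1 D u -> D x ->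
  is_derive x (a *: e + b *: f) u (a * 'D_e u x + b * 'D_f u x).
Proof.
move=> oD uC Dx; have [_ uD] := uC.
have Z v (c : R) : 'D_(c *: v) u x = c * 'D_v u x.
  have H : is_derive x v u ('D_v u x) by split=> //; have [dv _] := uD v; exact: dv.
  by have [_ ->] := is_derive_dirZ c H.
by rewrite -!Z; exact: is_derive_dirD uC Dx.
Qed.
End Dirs.

(** * Holomorphic functions of two variables as pairs of real functions *)

Section HolomorphicPairs.
Variable R : realType.
Notation P := ((R * R) * (R * R))%type.
Implicit Types (D : set P) (u v : P -> R).

(** The pair of the real and imaginary parts of a holomorphic function. *)
Definition hol_pair D u v :=
  [/\ Ck_on 1 D u, Ck_on 1 D v & forall j q, D q ->
    'D_(dir_x j) u q = 'D_(dir_y j) v q /\ 'D_(dir_y j) u q = - 'D_(dir_x j) v q].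

Lemma Ck1_cont D u q : Ck_on 1 D u -> D q -> {for q, continuous u}.
Proof. by move=> [uc _] /uc. Qed.

Lemma Ck1_derivable D u q (e : P) : Ck_on 1 D u -> D q -> derivable u q e.
Proof. by move=> [_ /(_ e)[du _]] /du. Qed.

Lemma Ck1_dcont D u q (e : P) : Ck_on 1 D u -> D q -> {for q, continuous ('D_e u)}.
Proof. by move=> [_ /(_ e)[_ [du _]]] /du. Qed.

Lemma Ck1_is_derive D u q (e : P) : Ck_on 1 D u -> D q -> is_derive q e u ('D_e u q).
Proof. by move=> uC Dq; split=> //; exact: Ck1_derivable uC Dq. Qed.

Lemma dir0 (v : R * R) : (v, (0, 0)) = v.1 *: dir_x 0 + v.2 *: dir_y 0 :> P.
Proof.
case: v => a b; rewrite /dir_x /dir_y/=.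
transitivity (((a * 1 + b * 0, a * 0 + b * 1), (a * 0 + b * 0, a * 0 + b * 0)) : P); last by [].
by congr ((_, _), (_, _)); ring.
Qed.

Lemma dir1 (v : R * R) : ((0, 0), v) = v.1 *: dir_x 1 + v.2 *: dir_y 1 :> P.
Proof.
case: v => a b; rewrite /dir_x /dir_y/=.
transitivity (((a * 0 + b * 0, a * 0 + b * 0), (a * 1 + b * 0, a * 0 + b * 1)) : P); last by [].
by congr ((_, _), (_, _)); ring.
Qed.

Lemma is_derive_slice1 u (z w v : R * R) l :
  is_derive (z, w) (v, (0, 0)) u l -> is_derive z v (fun z => u (z, w)) l.
Proof.
move=> [du ul]; apply: is_derive_cvg.
rewrite (_ : (fun h => _) =
  (fun h : R => h^-1 *: ((u \o shift (z, w)) (h *: (v, (0, 0))) - u (z, w)))).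
  by rewrite -ul; exact: du.
apply/funext => h /=; congr (_ *: (u _ - _)).
transitivity (h *: v + z, h *: (0 : R * R) + w); last by [].
by rewrite scaler0 add0r.
Qed.

Lemma is_derive_slice2 u (z w v : R * R) l :
  is_derive (z, w) ((0, 0), v) u l -> is_derive w v (fun w => u (z, w)) l.
Proof.
move=> [du ul]; apply: is_derive_cvg.
rewrite (_ : (fun h => _) =
  (fun h : R => h^-1 *: ((u \o shift (z, w)) (h *: ((0, 0), v)) - u (z, w)))).
  by rewrite -ul; exact: du.
apply/funext => h /=; congr (_ *: (u _ - _)).
transitivity (h *: (0 : R * R) + z, h *: v + w); last by [].
by rewrite scaler0 add0r.
Qed.

Lemma cont_slice1 (f : P -> R) (z w : R * R) :
  {for (z, w), continuous f} -> {for z, continuous (fun z => f (z, w))}.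
Proof.
move=> fc; have pc : {for z, continuous (fun z : R * R => (z, w))} by cts.
exact: (@contcomp _ _ _ f (fun z => (z, w)) z fc pc).
Qed.

Lemma cont_slice2 (f : P -> R) (z w : R * R) :
  {for (z, w), continuous f} -> {for w, continuous (fun w => f (z, w))}.
Proof.
move=> fc; have pc : {for w, continuous (fun w : R * R => (z, w))} by cts.
exact: (@contcomp _ _ _ f (fun w => (z, w)) w fc pc).
Qed.

Section Slices.
Variables (D : set P) (u v : P -> R).
Hypotheses (oD : open D) (uv : hol_pair D u v).

Let uC : Ck_on 1 D u. Proof. by case: uv. Qed.
Let vC : Ck_on 1 D v. Proof. by case: uv. Qed.

Lemma mean_value_slice1 a d w : 0 < d -> (forall z, box a d z -> D (z, w)) ->
  (\int[lebesgue2 R]_(z in box a d) (bump d a z * (u (z, w) - u (a, w)))%:E = 0)%E.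
Proof.
move=> d0 DK; have [_ _ CR] := uv.
apply: (@mean_value2 _ a d (fun z => u (z, w)) (fun z => v (z, w))
  (fun z => 'D_(dir_x 0) v (z, w)) (fun z => 'D_(dir_y 0) v (z, w)) d0) => x xb.
- exact: cont_slice1 (Ck1_cont vC (DK _ xb)).
- exact: (@cont_slice1 ('D_(dir_x 0) v) x w (Ck1_dcont vC (DK _ xb))).
- exact: (@cont_slice1 ('D_(dir_y 0) v) x w (Ck1_dcont vC (DK _ xb))).
- move=> e; apply: is_derive_slice1; rewrite dir0.
  apply: (is_derive_eq (is_derive_dir2 _ _ _ _ oD uC (DK _ xb))).
  by have [-> ->] := CR 0 _ (DK _ xb); rewrite mulrN.
- move=> e; apply: is_derive_slice1; rewrite dir0.
  exact: (is_derive_dir2 _ _ _ _ oD vC (DK _ xb)).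
Qed.

Lemma mean_value_slice2 a d z : 0 < d -> (forall w, box a d w -> D (z, w)) ->
  (\int[lebesgue2 R]_(w in box a d) (bump d a w * (u (z, w) - u (z, a)))%:E = 0)%E.
Proof.
move=> d0 DK; have [_ _ CR] := uv.
apply: (@mean_value2 _ a d (fun w => u (z, w)) (fun w => v (z, w))
  (fun w => 'D_(dir_x 1) v (z, w)) (fun w => 'D_(dir_y 1) v (z, w)) d0) => x xb.
- exact: cont_slice2 (Ck1_cont vC (DK _ xb)).
- exact: (@cont_slice2 ('D_(dir_x 1) v) z x (Ck1_dcont vC (DK _ xb))).
- exact: (@cont_slice2 ('D_(dir_y 1) v) z x (Ck1_dcont vC (DK _ xb))).
- move=> e; apply: is_derive_slice2; rewrite dir1.
  apply: (is_derive_eq (is_derive_dir2 _ _ _ _ oD uC (DK _ xb))).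
  by have [-> ->] := CR 1 _ (DK _ xb); rewrite mulrN.
- move=> e; apply: is_derive_slice2; rewrite dir1.
  exact: (is_derive_dir2 _ _ _ _ oD vC (DK _ xb)).
Qed.

Definition qbox (p : P) (d e : R) : set P := box p.1 d `*` box p.2 e.
Definition qbump (d e : R) (p x : P) : R := bump d p.1 x.1 * bump e p.2 x.2.

Lemma continuous_qbump d e p x : {for x, continuous (qbump d e p)}.
Proof.
apply: contM; [apply: (@contcomp _ _ _ (bump d p.1) fst)|apply: (@contcomp _ _ _ (bump e p.2) snd)];
  by [exact: continuous_bump|cts].
Qed.

Lemma measurable_qbox p d e :
  measurable (qbox p d e : set ((measurableTypeR R * measurableTypeR R) *
    (measurableTypeR R * measurableTypeR R))).
Proof. by apply: measurableX; exact: measurable_box. Qed.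

Lemma compact_qbox p d e : compact (qbox p d e).
Proof. by apply: compact_setX; exact: compact_box. Qed.

Lemma lebesgue4_qbox p d e : 0 < d -> 0 < e ->
  mu4 R (qbox p d e) = (16 * d ^+ 2 * e ^+ 2)%:E.
Proof.
move=> d0 e0; rewrite [LHS]product_measure1E; try exact: measurable_box.
transitivity ((4 * d ^+ 2)%:E * (4 * e ^+ 2)%:E)%E.
  by congr (_ * _)%E; exact: lebesgue2_box.
by rewrite -EFinM; congr EFin; ring.
Qed.

Lemma integrable_qbox p d e (f : P -> R) : 0 < d -> 0 < e ->
  (forall x, qbox p d e x -> {for x, continuous f}) ->
  (mu4 R).-integrable (qbox p d e) (EFin \o f).
Proof.
move=> d0 e0 fc; apply: integrable_cont4 => //; first exact: measurable_qbox.
  by rewrite lebesgue4_qbox// ltry.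
exact: compact_qbox.
Qed.

(** The difference [u x - u p] is the change in the second variable followed by that in
    the first one, and each has weighted mean zero on the corresponding slices. *)
Lemma mean_value4 p d e : 0 < d -> 0 < e -> qbox p d e `<=` D ->
  (\int[mu4 R]_(x in qbox p d e) (qbump d e p x * (u x - u p))%:E = 0)%E.
Proof.
case: p => a b d0 e0 QD.
have uc (x : P) : qbox (a, b) d e x -> {for x, continuous u}.
  by move=> xQ; exact: Ck1_cont uC (QD _ xQ).
have bc x := @continuous_qbump d e (a, b) x.
pose f1 (x : P) := qbump d e (a, b) x * (u x - u (x.1, b)).
pose f2 (x : P) := qbump d e (a, b) x * (u (x.1, b) - u (a, b)).
have bb : box b e b by apply: box_center; exact: ltW.
have ubc (x : P) : qbox (a, b) d e x -> {for x, continuous (fun x : P => u (x.1, b))}.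
  move=> [x1 x2]; apply: (@contcomp _ _ _ u (fun x : P => (x.1, b))); last by cts.
  by apply: uc; split.
have c1 (x : P) : qbox (a, b) d e x -> {for x, continuous f1}.
  move=> xQ; have := uc _ xQ; have := ubc _ xQ; have := bc x => ? ? ?.
  by apply: contM => //; exact: contS.
have c2 (x : P) : qbox (a, b) d e x -> {for x, continuous f2}.
  move=> xQ; have := ubc _ xQ; have := bc x => ? ?.
  by apply: contM => //; apply: contS => //; cts.
have i1 := integrable_qbox d0 e0 c1; have i2 := integrable_qbox d0 e0 c2.
have mb c r := @measurable_box R c r.
have box_fin c r : 0 < r -> (lebesgue2 R (box c r) < +oo)%E.
  by move=> r0; rewrite lebesgue2_box// ltry.
have E1 : (\int[mu4 R]_(x in qbox (a, b) d e) (f1 x)%:E = 0)%E.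
  rewrite [LHS](@fubini_box1 _ _ _ _ _ (lebesgue2 R) (lebesgue2 R) _ _ (EFin \o f1))//.
  apply: integral0_eq => z zb.
  under eq_integral => w _ do rewrite /= /f1 /qbump/= -mulrA EFinM.
  rewrite integralZl//.
    rewrite (@mean_value_slice2 b e z) ?mule0// => w wb.
    by apply: QD.
  apply: integrable_cont2; [exact: mb|exact: box_fin|exact: compact_box|].
  move=> w wb; apply: contM; first exact: continuous_bump.
  apply: contS; last by cts.
  by apply: cont_slice2; exact: uc.
have E2 : (\int[mu4 R]_(x in qbox (a, b) d e) (f2 x)%:E = 0)%E.
  rewrite [LHS](@fubini_box2 _ _ _ _ _ (lebesgue2 R) (lebesgue2 R) _ _ (EFin \o f2))//.
  apply: integral0_eq => w wb.
  under eq_integral => z _ do rewrite /= /f2 /qbump/= mulrAC [_ * bump e b w]mulrC EFinM.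
  rewrite integralZl//.
    rewrite (@mean_value_slice1 a d b) ?mule0// => z zb.
    by apply: QD.
  apply: integrable_cont2; [exact: mb|exact: box_fin|exact: compact_box|].
  move=> z zb; apply: contM; first exact: continuous_bump.
  apply: contS; last by cts.
  by apply: cont_slice1; exact: uc.
transitivity (\int[mu4 R]_(x in qbox (a, b) d e) ((f1 x)%:E + (f2 x)%:E))%E.
  by apply: eq_integral => x _; rewrite -EFinD; congr EFin; rewrite /f1 /f2; ring.
have mq := @measurable_qbox (a, b) d e.
by rewrite [LHS](integralD mq i1 i2) /= E1 E2 adde0.
Qed.

End Slices.
End HolomorphicPairs.

(** * Local estimates *)

Section Estimates.
Variable R : realType.
Notation P := ((R * R) * (R * R))%type.
Notation mu := (lebesgue2 R \x lebesgue2 R)%E.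

Lemma qbump_ge0 d e (p x : P) : 0 <= qbump d e p x.
Proof. by rewrite mulr_ge0// bump_ge0. Qed.

Lemma qbump_le1 d e (p x : P) : qbump d e p x <= 1.
Proof. by rewrite /qbump -[1]mulr1 ler_pM// ?bump_ge0// bump_le1. Qed.

Lemma qbump_eq0 d e (p x : P) : 0 < d -> 0 < e -> ~ qbox p d e x -> qbump d e p x = 0.
Proof.
move=> d0 e0 px; rewrite /qbump.
have [h|h] := pselect (box p.1 d x.1); last by rewrite bump_eq0// mul0r.
by rewrite (@bump_eq0 _ e)// ?mulr0// => h2; apply: px.
Qed.

Lemma qbox_sub (p : P) d d' e e' : d <= d' -> e <= e' -> qbox p d e `<=` qbox p d' e'.
Proof. by move=> dd ee x [h1 h2]; split; [exact: box_sub h1|exact: box_sub h2]. Qed.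

Lemma integrable_qbump d e (p p0 : P) a b : 0 < a -> 0 < b ->
  mu.-integrable (qbox p0 a b) (EFin \o qbump d e p).
Proof. by move=> a0 b0; apply: integrable_qbox => // x _; exact: continuous_qbump. Qed.

(** The weight is at least [1 / 16] on the box with half the sides, whose measure is
    [d^2 e^2]. *)
Lemma qbump_mass d e (p p0 : P) a b : 0 < d -> 0 < e -> 0 < a -> 0 < b ->
  qbox p (d / 2) (e / 2) `<=` qbox p0 a b ->
  d ^+ 2 * e ^+ 2 / 16 <= \int[mu]_(x in qbox p0 a b) qbump d e p x.
Proof.
move=> d0 e0 a0 b0 sub.
have d2 : 0 < d / 2 by rewrite divr_gt0.
have e2 : 0 < e / 2 by rewrite divr_gt0.
have mQ := @measurable_qbox R p (d / 2) (e / 2).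
have mQ0 := @measurable_qbox R p0 a b.
have i1 := integrable_qbump d e p p d2 e2.
have i2 := integrable_qbump d e p p0 a0 b0.
apply: (@le_trans _ _ (\int[mu]_(x in qbox p (d / 2) (e / 2)) qbump d e p x)).
  apply: (@le_trans _ _ (\int[mu]_(x in qbox p (d / 2) (e / 2)) (16^-1 : R))).
    rewrite Rintegral_cst// (_ : fine _ = 16 * (d / 2) ^+ 2 * (e / 2) ^+ 2);
      last exact: (congr1 fine (lebesgue4_qbox p d2 e2)).
    by rewrite le_eqVlt; apply/orP; left; apply/eqP; field.
  apply: le_Rintegral => //.
    by apply: integrable_qbox => // x _; exact: contcst.
  move=> x [x1 x2]; rewrite /qbump.
  rewrite (_ : 16^-1 = 4^-1 * 4^-1 :> R); last by field.
  by apply: ler_pM; rewrite ?invr_ge0//; exact: bump_center_ge.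
apply: fine_le; [exact: integrable_fin_num i1|exact: integrable_fin_num i2|].
apply: ge0_subset_integral => //.
  by apply: measurable_int i2.
by move=> x _; rewrite lee_fin qbump_ge0.
Qed.

Section WithPair.
Variables (D : set P) (u v : P -> R).
Hypotheses (oD : open D) (uv : hol_pair D u v).

Let uc x : D x -> {for x, continuous u}.
Proof. by case: uv => uC _ _; exact: Ck1_cont uC. Qed.

(** Jensen's inequality: in the expansion of [u^2] around [u p] the linear term has
    weighted mean zero. *)
Lemma mean_value_sqr (p : P) d e : 0 < d -> 0 < e -> qbox p d e `<=` D ->
  u p ^+ 2 * (d ^+ 2 * e ^+ 2 / 16) <= \int[mu]_(x in qbox p d e) (u x ^+ 2).
Proof.
have half (r : R) : 0 < r -> r / 2 <= r by lra.
move=> d0 e0 QD; pose b := qbump d e p.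
have mQ := @measurable_qbox R p d e.
have H : \int[mu]_(x in qbox p d e) (b x * (u x - u p)) = 0.
  by rewrite /Rintegral (mean_value4 oD uv d0 e0 QD).
have ucQ x : qbox p d e x -> {for x, continuous u} by move=> /QD /uc.
have bc x : {for x, continuous b} by exact: continuous_qbump.
have c0 x : qbox p d e x -> {for x, continuous (fun x => u x - u p)}.
  by move=> xQ; apply: contS; [exact: ucQ|exact: contcst].
have i1 : mu.-integrable (qbox p d e) (EFin \o (fun x => b x * (u x - u p))).
  by apply: integrable_qbox => // x xQ; apply: contM => //; exact: c0.
have i2 : mu.-integrable (qbox p d e) (EFin \o (fun x => b x * (u x - u p) ^+ 2)).
  by apply: integrable_qbox => // x xQ; apply: contM => //; apply: contX; exact: c0.
have i3 := integrable_qbump d e p p d0 e0.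
have i4 : mu.-integrable (qbox p d e) (EFin \o (fun x => u x ^+ 2)).
  by apply: integrable_qbox => // x xQ; apply: contX; exact: ucQ.
have i5 : mu.-integrable (qbox p d e) (EFin \o (fun x => b x * u x ^+ 2)).
  by apply: integrable_qbox => // x xQ; apply: contM => //; apply: contX; exact: ucQ.
have i6 : mu.-integrable (qbox p d e) (EFin \o (fun x => 2 * u p * (b x * (u x - u p)))).
  apply: integrable_qbox => // x xQ; apply: contM; first exact: contcst.
  by apply: contM => //; exact: c0.
have i7 : mu.-integrable (qbox p d e) (EFin \o (fun x => u p ^+ 2 * b x)).
  by apply: integrable_qbox => // x xQ; apply: contM; first exact: contcst.
have i8 : mu.-integrable (qbox p d e) (EFin \o (fun x => 2 * u p * (b x * (u x - u p)) + u p ^+ 2 * b x)).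
  apply: integrable_qbox => // x xQ; apply: contD; apply: contM; try exact: contcst => //.
  - by apply: contM => //; exact: c0.
  - exact: bc.
apply: (@le_trans _ _ (\int[mu]_(x in qbox p d e) (b x * u x ^+ 2))); last first.
  apply: le_Rintegral => // x _; rewrite -[leRHS]mul1r ler_wpM2r ?sqr_ge0//.
  exact: qbump_le1.
have -> : \int[mu]_(x in qbox p d e) (b x * u x ^+ 2) =
    \int[mu]_(x in qbox p d e) (b x * (u x - u p) ^+ 2 +
      (2 * u p * (b x * (u x - u p)) + u p ^+ 2 * b x)).
  by apply: eq_Rintegral => x _ /=; ring.
rewrite RintegralD// RintegralD// RintegralZl// H mulr0 add0r RintegralZl//.
apply: ler_wpDl; first by apply: Rintegral_ge0 => x _; rewrite mulr_ge0 ?sqr_ge0// qbump_ge0.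
rewrite ler_wpM2l ?sqr_ge0//; apply: qbump_mass => //.
by apply: qbox_sub; exact: half.
Qed.

(** Weights with different centres will be compared over one common box. *)
Lemma mean_value_window (p p0 : P) d a : 0 < d -> 0 < a ->
  qbox p d d `<=` qbox p0 a a -> qbox p0 a a `<=` D ->
  \int[mu]_(x in qbox p0 a a) (qbump d d p x * (u x - u p)) = 0.
Proof.
move=> d0 a0 sub QD.
have H : \int[mu]_(x in qbox p d d) (qbump d d p x * (u x - u p)) = 0.
  by rewrite /Rintegral (mean_value4 oD uv d0 d0 (subset_trans sub QD)).
rewrite -[RHS]H Rintegral_mkcond [RHS]Rintegral_mkcond; apply: eq_Rintegral => x _.
rewrite /patch; case: ifPn => [|/negP] hx; case: ifPn => [|/negP] hy //.
  by rewrite qbump_eq0 ?mul0r// => h; apply: hy; rewrite inE.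
by case: hx; rewrite inE; apply: sub; rewrite inE in hy.
Qed.
End WithPair.

Lemma bump_lipschitz (a a' x : R * R) d del : 0 < d ->
  `|a'.1 - a.1| <= del -> `|a'.2 - a.2| <= del ->
  `|x.1 - a.1| <= 3 * d -> `|x.2 - a.2| <= 3 * d ->
  `|x.1 - a'.1| <= 3 * d -> `|x.2 - a'.2| <= 3 * d ->
  `|bump d a' x - bump d a x| <= 24 * del / d.
Proof.
move=> d0 A1 A2 X1 X2 Y1 Y2.
have del0 : 0 <= del by exact: le_trans A1.
set s := bump_arg d a' x; set s' := bump_arg d a x.
have s1 : s <= 1 by exact: bump_arg_le1.
have s1' : s' <= 1 by exact: bump_arg_le1.
have h : `|s - s'| <= 12 * del / d.
  have -> : s - s' = ((a'.1 - a.1) * ((x.1 - a.1) + (x.1 - a'.1)) +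
      (a'.2 - a.2) * ((x.2 - a.2) + (x.2 - a'.2))) / d ^+ 2.
    by rewrite /s /s' /bump_arg; field; rewrite gt_eqF.
  rewrite normrM [X in _ * X]ger0_norm ?invr_ge0 ?sqr_ge0// ler_pdivrMr ?exprn_gt0//.
  have -> : 12 * del / d * d ^+ 2 = del * (6 * d) + del * (6 * d) by field; rewrite gt_eqF.
  apply: le_trans (ler_normD _ _) _; rewrite !normrM.
  have t1 : `|x.1 - a.1 + (x.1 - a'.1)| <= 6 * d.
    by apply: le_trans (ler_normD _ _) _; lra.
  have t2 : `|x.2 - a.2 + (x.2 - a'.2)| <= 6 * d.
    by apply: le_trans (ler_normD _ _) _; lra.
  by apply: lerD; apply: ler_pM.
have : `|pos2 s - pos2 s'| <= 2 * `|s - s'|.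
  rewrite /pos2; clearbody s s'; clear -s1 s1'.
  have [s0|s0] := leP 0 s; have [t0|t0] := leP 0 s'.
  - rewrite subr_sqr normrM mulrC ler_wpM2r// ger0_norm; lra.
  - by rewrite (ger0_norm (_ : 0 <= s - s')) ?ger0_norm ?expr0n/= ?subr0 ?sqr_ge0//; nra.
  - by rewrite (ler0_norm (_ : s - s' <= 0)) ?ler0_norm ?expr0n/= ?sub0r ?oppr_le0 ?sqr_ge0//; nra.
  - by rewrite expr0n/= subrr normr0 mulr_ge0.
by rewrite /bump -/s -/s'; lra.
Qed.

Lemma normP_coord (q : P) del : `|q| <= del ->
  [/\ `|q.1.1| <= del, `|q.1.2| <= del, `|q.2.1| <= del & `|q.2.2| <= del].
Proof. by rewrite !prod_normE !ge_max => /andP[/andP[-> ->] /andP[-> ->]]. Qed.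

Lemma qbump_lipschitz (p p' x : P) d del : 0 < d -> `|p' - p| <= del ->
  qbox p (3 * d) (3 * d) x -> qbox p' (3 * d) (3 * d) x ->
  `|qbump d d p' x - qbump d d p x| <= 48 * del / d.
Proof.
move=> d0 /normP_coord[h1 h2 h3 h4] [[/= q1 q2] [/= q3 q4]] [[/= r1 r2] [/= r3 r4]].
have N c y : seg c (3 * d) y -> `|y - c| <= 3 * d.
  by rewrite /seg/= in_itv/= ler_norml => /andP[? ?]; apply/andP; split; lra.
have L1 : `|bump d p'.1 x.1 - bump d p.1 x.1| <= 24 * del / d.
  by apply: bump_lipschitz; rewrite ?N.
have L2 : `|bump d p'.2 x.2 - bump d p.2 x.2| <= 24 * del / d.
  by apply: bump_lipschitz; rewrite ?N.
have -> : qbump d d p' x - qbump d d p x =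
  (bump d p'.1 x.1 - bump d p.1 x.1) * bump d p'.2 x.2 +
  bump d p.1 x.1 * (bump d p'.2 x.2 - bump d p.2 x.2) by rewrite /qbump; ring.
have nb c y : `|bump d c y| <= 1 by rewrite (ger0_norm (bump_ge0 _ _ _)) bump_le1.
apply: le_trans (ler_normD _ _) _.
rewrite (normrM (bump d p'.1 x.1 - _)) (normrM (bump d p.1 x.1)) (_ : 48 * del / d = 24 * del / d + 24 * del / d); last by ring.
apply: lerD.
  by rewrite -[leRHS]mulr1; apply: ler_pM => //; exact: nb.
by rewrite -[leRHS]mul1r; apply: ler_pM => //; exact: nb.
Qed.
End Estimates.

Section LocalEstimates.
Variable R : realType.
Notation P := ((R * R) * (R * R))%type.
Notation mu := (lebesgue2 R \x lebesgue2 R)%E.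

Lemma ball_qbox (p x : P) d : ball p d x -> qbox p d d x.
Proof.
rewrite -ball_normE/= distrC => /ltW /normP_coord[] /=.
rewrite !ler_norml => /andP[? ?] /andP[? ?] /andP[? ?] /andP[? ?].
by split; split; rewrite /seg/= in_itv/=; apply/andP; split; lra.
Qed.

Lemma qbox_coord (p x : P) d e : qbox p d e x ->
  [/\ `|x.1.1 - p.1.1| <= d, `|x.1.2 - p.1.2| <= d, `|x.2.1 - p.2.1| <= e & `|x.2.2 - p.2.2| <= e].
Proof.
case=> -[/=]; rewrite /seg/= !in_itv/= => /andP[? ?] /andP[? ?] [/=].
rewrite /seg/= !in_itv/= => /andP[? ?] /andP[? ?].
by split; rewrite ler_norml; apply/andP; split; lra.
Qed.

Lemma qbox_intro (p x : P) d e :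
  `|x.1.1 - p.1.1| <= d -> `|x.1.2 - p.1.2| <= d -> `|x.2.1 - p.2.1| <= e ->
  `|x.2.2 - p.2.2| <= e -> qbox p d e x.
Proof.
rewrite !ler_norml => /andP[? ?] /andP[? ?] /andP[? ?] /andP[? ?].
by split; split; rewrite /seg/= in_itv/=; apply/andP; split; lra.
Qed.

Lemma qbox_trans (p q : P) a b : qbox p a a q -> qbox q b b `<=` qbox p (a + b) (a + b).
Proof.
move=> /qbox_coord[h1 h2 h3 h4] x /qbox_coord[k1 k2 k3 k4].
have T (s t w : R) : `|s - t| <= b -> `|t - w| <= a -> `|s - w| <= a + b.
  by move=> l1 l2; apply: le_trans (ler_distD t s w) _; rewrite addrC lerD.
by apply: qbox_intro; [exact: T k1 h1|exact: T k2 h2|exact: T k3 h3|exact: T k4 h4].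
Qed.

Lemma qbox_sym (p q : P) a : qbox p a a q -> qbox q a a p.
Proof. by move=> /qbox_coord[*]; apply: qbox_intro; rewrite distrC. Qed.

Lemma open_qbox (D : set P) p : open D -> D p -> exists2 d, 0 < d & qbox p d d `<=` D.
Proof.
move=> oD Dp; have /nbhs_ballP[e /= e0 eD] : nbhs p D by exact: open_nbhs_nbhs.
exists (e / 2); first by rewrite divr_gt0.
move=> x /qbox_coord[h1 h2 h3 h4]; apply: eD; rewrite -ball_normE/= distrC !prod_normE/=.
by rewrite !gt_max; apply/andP; split; apply/andP; split; apply: le_lt_trans (_ : e / 2 < e); rewrite ?ltr_pdivrMr//; lra.
Qed.

Section OnePair.
Variables (D : set P) (u v : P -> R).
Hypotheses (oD : open D) (uv : hol_pair D u v).

Let uc x : D x -> {for x, continuous u}.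
Proof. by case: uv => uC _ _; exact: Ck1_cont uC. Qed.

(** This takes the place of Cauchy's estimate for the derivatives.  The mass of the weight
    at [p] times [u p' - u p] is the integral of [u - u p'] against the difference of the
    weights at [p'] and [p], and the weights are Lipschitz in their centre.  The constant
    is [(48 * 2) * (16 * 2 ^ 4) * 16], the factors being the bound of the integrand, the
    measure of the box and the inverse of the mass. *)
Lemma lipschitz_estimate (p0 p p' : P) d M : 0 < d -> qbox p0 (2 * d) (2 * d) `<=` D ->
  (forall x, qbox p0 (2 * d) (2 * d) x -> `|u x| <= M) ->
  qbox p0 d d p -> qbox p0 d d p' ->
  `|u p' - u p| <= (3 * 2 ^+ 17) * `|p' - p| * M / d.
Proof.
move=> d0 QD uM pQ p'Q; pose del := `|p' - p|; pose Q := qbox p0 (2 * d) (2 * d).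
have d20 : 0 < 2 * d by rewrite mulr_gt0.
have mQ := @measurable_qbox R p0 (2 * d) (2 * d).
have dd : d + d = 2 * d by ring.
have subp : qbox p d d `<=` Q by rewrite /Q -dd; exact: qbox_trans.
have subp' : qbox p' d d `<=` Q by rewrite /Q -dd; exact: qbox_trans.
have ucQ x : Q x -> {for x, continuous u} by move=> /QD /uc.
have M0 : 0 <= M.
  apply: le_trans (normr_ge0 (u p)) _; apply: uM; apply: subp.
  by apply: qbox_intro; rewrite subrr normr0 ltW.
have int q c : mu.-integrable Q (EFin \o (fun x => qbump d d q x * (u x - c))).
  apply: integrable_qbox => // x xQ; apply: contM; first exact: continuous_qbump.
  by apply: contS; [exact: ucQ|exact: contcst].
have I' : \int[mu]_(x in Q) (qbump d d p' x * (u x - u p')) = 0.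
  exact: (mean_value_window oD uv d0 d20 subp' QD).
have I0 : \int[mu]_(x in Q) (qbump d d p x * (u x - u p)) = 0.
  exact: (mean_value_window oD uv d0 d20 subp QD).
pose c := \int[mu]_(x in Q) qbump d d p x.
have ib := integrable_qbump d d p p0 d20 d20.
have c0 : d ^+ 2 * d ^+ 2 / 16 <= c.
  by apply: qbump_mass => //; apply: subset_trans subp; apply: qbox_sub; lra.
have I1 : \int[mu]_(x in Q) (qbump d d p x * (u x - u p')) = (u p - u p') * c.
  have -> : \int[mu]_(x in Q) (qbump d d p x * (u x - u p')) =
    \int[mu]_(x in Q) (qbump d d p x * (u x - u p) + (u p - u p') * qbump d d p x).
    by apply: eq_Rintegral => x _ /=; ring.
  rewrite RintegralD//; last first.
    by apply: integrable_qbox => // x xQ; apply: contM; [exact: contcst|exact: continuous_qbump].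
  by rewrite I0 add0r RintegralZl.
have idiff : mu.-integrable Q (EFin \o (fun x => (qbump d d p' x - qbump d d p x) * (u x - u p'))).
  apply: integrable_qbox => // x xQ; apply: contM; last by apply: contS; [exact: ucQ|exact: contcst].
  by apply: contS; exact: continuous_qbump.
have I2 : (u p' - u p) * c = \int[mu]_(x in Q) ((qbump d d p' x - qbump d d p x) * (u x - u p')).
  have -> : \int[mu]_(x in Q) ((qbump d d p' x - qbump d d p x) * (u x - u p')) =
     \int[mu]_(x in Q) (qbump d d p' x * (u x - u p') - qbump d d p x * (u x - u p')).
    by apply: eq_Rintegral => x _ /=; ring.
  by rewrite RintegralB// I' I1; ring.
have muQ : fine (mu Q) = 16 * (2 * d) ^+ 2 * (2 * d) ^+ 2.
  exact: (congr1 fine (lebesgue4_qbox p0 d20 d20)).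
have I3 : `|(u p' - u p) * c| <= (48 * del / d * (2 * M)) * (16 * (2 * d) ^+ 2 * (2 * d) ^+ 2).
  rewrite I2; apply: le_trans (le_normr_Rintegral _ _) _ => //.
  apply: (@le_trans _ _ (\int[mu]_(x in Q) (48 * del / d * (2 * M)))).
    apply: le_Rintegral => //.
    - exact: integrable_norm idiff.
    - by apply: integrable_qbox => // x _; exact: contcst.
    move=> x xQ; rewrite normrM; apply: ler_pM => //.
      have tr : d + 2 * d = 3 * d by ring.
      apply: qbump_lipschitz => //.
      + by have := qbox_trans (qbox_sym pQ) xQ; rewrite tr.
      + by have := qbox_trans (qbox_sym p'Q) xQ; rewrite tr.
    rewrite mulr2n mulrDl mul1r; apply: le_trans (ler_normB _ _) _.
    by apply: lerD; apply: uM => //; apply: subp'; apply: qbox_intro; rewrite subrr normr0 ltW.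
  by rewrite Rintegral_cst// muQ.
have d4 : 0 < d ^+ 2 * d ^+ 2 / 16 by rewrite divr_gt0// mulr_gt0// exprn_gt0.
have del0 : 0 <= del by exact: normr_ge0.
rewrite -(ler_pM2r d4); apply: (@le_trans _ _ (`|u p' - u p| * c)); first by rewrite ler_wpM2l.
move: I3; rewrite normrM (ger0_norm (le_trans (ltW d4) c0)) => /le_trans; apply.
by rewrite -/del le_eqVlt; apply/orP; left; apply/eqP; field; rewrite gt_eqF.
Qed.

End OnePair.
End LocalEstimates.

(** * Limits of holomorphic functions *)

Section Limits.
Variable R : realType.
Notation P := ((R * R) * (R * R))%type.
Notation mu := (lebesgue2 R \x lebesgue2 R)%E.

Lemma near_cont (T : topologicalType) (f g : T -> R) x :
  (\near x, f x = g x) -> {for x, continuous f} -> {for x, continuous g}.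
Proof.
move=> fg fc; have fgx : f x = g x by exact: nbhs_singleton fg.
rewrite /prop_for /continuous_at -fgx; apply: cvg_trans fc.
by apply: near_eq_cvg.
Qed.

Lemma Ck1_intro (D : set P) (u : P -> R) (du : P -> P -> R) : open D ->
  (forall x, D x -> {for x, continuous u}) ->
  (forall e x, D x -> is_derive x e u (du e x)) ->
  (forall e x, D x -> {for x, continuous (du e)}) -> Ck_on 1 D u.
Proof.
move=> oD uc dd duc; split=> // e; split=> [x Dx|]; first by have [] := dd e x Dx.
split=> // x Dx; apply: near_cont (duc e x Dx).
have : nbhs x D by exact: open_nbhs_nbhs.
by apply: filterS => y Dy; have [_ ->] := dd e y Dy.
Qed.

Lemma Ck1_lin (D : set P) (u w : P -> R) (a b : R) : open D ->
  Ck_on 1 D u -> Ck_on 1 D w -> Ck_on 1 D (fun x => a * u x + b * w x).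
Proof.
move=> oD uC wC; apply: (@Ck1_intro _ _ (fun e x => a * 'D_e u x + b * 'D_e w x)) => //.
- move=> x Dx; have := Ck1_cont uC Dx; have := Ck1_cont wC Dx => ? ?; cts.
- move=> e x Dx; have := Ck1_is_derive e uC Dx; have := Ck1_is_derive e wC Dx => h1 h2.
  by apply: is_derive_eq; rewrite /GRing.scale/=; ring.
- move=> e x Dx; have := Ck1_dcont (e := e) uC Dx; have := Ck1_dcont (e := e) wC Dx => ? ?; cts.
Qed.

Lemma derive_lin (D : set P) (u w : P -> R) (a b : R) (e x : P) :
  Ck_on 1 D u -> Ck_on 1 D w -> D x ->
  'D_e (fun x => a * u x + b * w x) x = a * 'D_e u x + b * 'D_e w x.
Proof.
move=> uC wC Dx.
have h1 := Ck1_is_derive e uC Dx; have h2 := Ck1_is_derive e wC Dx.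
have : is_derive x e (fun x => a * u x + b * w x) (a * 'D_e u x + b * 'D_e w x).
  by apply: is_derive_eq; rewrite /GRing.scale/=; ring.
by case.
Qed.

Lemma hol_pair_lin (D : set P) (u v u' v' : P -> R) (a b : R) : open D ->
  hol_pair D u v -> hol_pair D u' v' ->
  hol_pair D (fun x => a * u x + b * u' x) (fun x => a * v x + b * v' x).
Proof.
move=> oD [uC vC uv] [uC' vC' uv']; split; try exact: Ck1_lin.
move=> j q Dq; rewrite !(@derive_lin D)//.
by have [-> ->] := uv j q Dq; have [-> ->] := uv' j q Dq; split; ring.
Qed.

(** Multiplication by [- i]. *)
Lemma hol_pair_rot (D : set P) (u v : P -> R) : open D ->
  hol_pair D u v -> hol_pair D v (fun x => - u x).
Proof.
move=> oD [uC vC uv].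
have e : (fun x => - u x) = (fun x => -1 * u x + 0 * u x).
  by apply/funext => x; rewrite mul0r addr0 mulN1r.
rewrite e; split; [exact: vC|exact: Ck1_lin|].
move=> j q Dq; rewrite !(@derive_lin D)//.
by have [h1 h2] := uv j q Dq; split; [rewrite h2|rewrite h1]; ring.
Qed.

Lemma norm_lim_le (T : Type) (F : set_system T) {FF : ProperFilter F} (f : T -> R) l K :
  f x @[x --> F] --> l -> (\forall x \near F, `|f x| <= K) -> `|l| <= K.
Proof.
move=> fl fK; apply/ler_addgt0Pr => e e0.
have /cvgrPdist_le /(_ e e0) h := fl.
have [x [h1 h2]] := filter_ex (filterI h fK).
by rewrite -(subrK (f x) l) addrC; apply: le_trans (ler_normD _ _) _; rewrite lerD.
Qed.

Lemma cvg_line (V : normedModType R) (e p : V) : h *: e + p @[h --> (0 : R)^'] --> p.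
Proof.
rewrite -[X in _ --> X]add0r -(scale0r e).
by apply: cvgD; [apply: cvgZr_tmp; exact: cvg_within|exact: cvg_cst].
Qed.

Lemma near_line (V : normedModType R) (e p : V) (A : set V) : nbhs p A ->
  \forall h \near (0 : R)^', A (h *: e + p).
Proof. by move=> pA; exact: (cvg_line e pA). Qed.

Lemma eps_small (eps : nat -> R) K e : eps n @[n --> \oo] --> 0 -> 0 < e ->
  exists n, K * eps n <= e.
Proof.
move=> eps0 e0.
have Keps : (K * eps n) @[n --> \oo] --> 0.
  by rewrite -[X in _ --> X](mulr0 K); apply: cvgM => //; exact: cvg_cst.
have /cvgrPdist_le /(_ e e0) [N _ HN] := Keps.
exists N; have := HN N (leqnn N); rewrite /= sub0r normrN; exact: le_trans (ler_norm _).
Qed.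

Lemma uniform_limit_cont (V : normedModType R) (fn : nat -> V -> R) (f : V -> R) (eps : nat -> R) K x d :
  eps n @[n --> \oo] --> 0 -> 0 < d -> (forall n, {for x, continuous (fn n)}) ->
  (forall n y, ball x d y -> `|fn n y - f y| <= K * eps n) -> {for x, continuous f}.
Proof.
move=> eps0 d0 fc fK; apply/cvgrPdist_le => e e0.
have e3 : 0 < e / 3 by rewrite divr_gt0.
have [n nK] := eps_small K eps0 e3.
have /cvgrPdist_le /(_ _ e3) nf := fc n.
near=> y; have yB : ball x d y by near: y; exact: nbhsx_ballx.
have h1 := le_trans (fK n y yB) nK.
have h2 := le_trans (fK n x (ballxx _ d0)) nK.
have h3 : `|fn n x - fn n y| <= e / 3 by near: y.
have -> : f x - f y = (fn n x - fn n y) - (fn n x - f x) + (fn n y - f y) by ring.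
apply: le_trans (ler_normD _ _) _; rewrite (_ : e = e / 3 + e / 3 + e / 3); last by field.
by rewrite lerD//; apply: le_trans (ler_normB _ _) _; rewrite lerD.
Unshelve. all: by end_near.
Qed.

(** The rate passes to the limit, which makes the convergence of functions uniform. *)
Lemma cauchy_rate (a eps : nat -> R) K : eps n @[n --> \oo] --> 0 ->
  (forall n m, (n <= m)%N -> `|a n - a m| <= K * eps n) ->
  exists2 l, a n @[n --> \oo] --> l & forall n, `|a n - l| <= K * eps n.
Proof.
move=> eps0 aK.
have Keps : (K * eps n) @[n --> \oo] --> 0.
  by rewrite -[X in _ --> X](mulr0 K); apply: cvgM => //; exact: cvg_cst.
have /cvg_ex[l al] : cvgn a.
  apply: cauchy_cvg; apply: cauchy_exP => e e0.
  have /cvgrPdist_lt /(_ e e0) [N _ HN] := Keps.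
  exists (a N); exists N => // n /= Nn; rewrite /ball/=.
  apply: le_lt_trans (aK _ _ Nn) _; have := HN N (leqnn N).
  by rewrite /= sub0r normrN => /ltr_normlW.
exists l => // n; apply/ler_addgt0Pr => e e0.
have /cvgrPdist_le /(_ e e0) [N _ HN] := al.
have h1 := HN (maxn n N) (leq_maxr _ _).
have h2 := aK n (maxn n N) (leq_maxl _ _).
apply: le_trans (ler_distD (a (maxn n N)) _ _) _.
by rewrite lerD// distrC.
Qed.

(** Uniform Cauchy estimates near a point, both for the values and for the increments. *)
Definition rate_at (D : set P) (un : nat -> P -> R) (eps : nat -> R) (p0 : P) d C :=
  [/\ 0 < d, 0 <= C, ball p0 d `<=` D &
   forall n m, (n <= m)%N -> forall p p', ball p0 d p -> ball p0 d p' ->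
    `|un n p - un m p| <= C * eps n /\
    `|(un n p' - un m p') - (un n p - un m p)| <= C * `|p' - p| * eps n].

(** The estimate on increments makes the difference quotients converge uniformly in the
    step, so that differentiation and the limit can be exchanged. *)
Lemma C1_limit (D : set P) (un : nat -> P -> R) (eps : nat -> R) : open D ->
  eps n @[n --> \oo] --> 0 -> (forall n, Ck_on 1 D (un n)) ->
  (forall p0, D p0 -> exists d C, rate_at D un eps p0 d C) ->
  exists2 u : P -> R, Ck_on 1 D u &
    forall x, D x -> un n x @[n --> \oo] --> u x /\
       forall e, 'D_e (un n) x @[n --> \oo] --> 'D_e u x.
Proof.
move=> oD eps0 unC H.
pose u x := lim (un n x @[n --> \oo]).
pose du e x := lim ('D_e (un n) x @[n --> \oo]).
have lims p0 d C : rate_at D un eps p0 d C -> forall p, ball p0 d p ->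
    un n p @[n --> \oo] --> u p /\ forall n, `|un n p - u p| <= C * eps n.
  move=> [d0 C0 sub rt] p pB.
  have [|l al ale] := @cauchy_rate (fun n => un n p) eps C eps0.
    by move=> n m nm; have [] := rt n m nm p p pB pB.
  by rewrite /u (cvg_lim _ al).
have limsL p0 d C : rate_at D un eps p0 d C -> forall p p', ball p0 d p -> ball p0 d p' ->
    forall n, `|(un n p' - u p') - (un n p - u p)| <= C * `|p' - p| * eps n.
  move=> rt p p' pB pB' n.
  have [l1 _] := lims _ _ _ rt _ pB; have [l2 _] := lims _ _ _ rt _ pB'.
  case: rt => d0 C0 sub rt.
  have [|l al ale] := @cauchy_rate (fun n => un n p' - un n p) eps (C * `|p' - p|) eps0.
    move=> i j ij; have [_] := rt i j ij p p' pB pB'; apply: le_trans.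
    by rewrite le_eqVlt; apply/orP; left; apply/eqP; congr (`| _ |); ring.
  have -> : (un n p' - u p') - (un n p - u p) = (un n p' - un n p) - l; last exact: ale.
  have <- : u p' - u p = l; last by ring.
  by apply: (cvg_unique _ (cvgB l2 l1) al).
have limsD p0 d C : rate_at D un eps p0 d C -> forall e p, ball p0 d p ->
    'D_e (un n) p @[n --> \oo] --> du e p /\ forall n, `|'D_e (un n) p - du e p| <= C * `|e| * eps n.
  move=> [d0 C0 sub rt] e p pB.
  have [|l al ale] := @cauchy_rate (fun n => 'D_e (un n) p) eps (C * `|e|) eps0; last first.
    by rewrite /du (cvg_lim _ al).
  move=> n m nm.
  have dn i : h^-1 *: (un i (h *: e + p) - un i p) @[h --> 0^'] --> 'D_e (un i) p.
    exact: (Ck1_derivable (unC i) (sub _ pB)).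
  have dnm : (h^-1 *: (un n (h *: e + p) - un n p) - h^-1 *: (un m (h *: e + p) - un m p))
      @[h --> (0 : R)^'] --> ('D_e (un n) p - 'D_e (un m) p : R).
    exact: cvgB (dn n) (dn m).
  have nB : \forall h \near (0 : R)^', ball p0 d (h *: e + p).
    by apply: near_line; apply: open_nbhs_nbhs; split => //; exact: ball_open.
  apply: (@norm_lim_le _ (0 : R)^' _ _ _ _ dnm).
  near=> h; have h0 : h != 0 by near: h; exact: nbhs_dnbhs_neq.
  have hB : ball p0 d (h *: e + p) by near: h.
  have [_] := rt n m nm p (h *: e + p) pB hB.
  rewrite addrK normrZ => hle.
  have -> : h^-1 *: (un n (h *: e + p) - un n p) - h^-1 *: (un m (h *: e + p) - un m p) =
     h^-1 * (un n (h *: e + p) - un m (h *: e + p) - (un n p - un m p)).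
    by rewrite /GRing.scale/=; ring.
  rewrite normrM normfV mulrC ler_pdivrMr ?normr_gt0//; apply: le_trans hle _.
  by rewrite le_eqVlt; apply/orP; left; apply/eqP; ring.
have dux e x : D x -> is_derive x e u (du e x).
  move=> Dx; have [d [C rt]] := H x Dx; have [d0 C0 sub _] := rt.
  have xB : ball x d x by exact: ballxx.
  have [_ Dle] := limsD _ _ _ rt e x xB.
  apply: is_derive_cvg; apply/cvgrPdist_le => ep ep0.
  have e3 : 0 < ep / 3 by rewrite divr_gt0.
  have [n nK] := eps_small (C * `|e|) eps0 e3.
  have dn : h^-1 *: (un n (h *: e + x) - un n x) @[h --> 0^'] --> 'D_e (un n) x.
    exact: (Ck1_derivable (unC n) Dx).
  have /cvgrPdist_le /(_ _ e3) ndn := dn.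
  near=> h; have h0 : h != 0 by near: h; exact: nbhs_dnbhs_neq.
  have hB : ball x d (h *: e + x) by near: h; apply: near_line; exact: nbhsx_ballx.
  have h1 : `|'D_e (un n) x - h^-1 *: (un n (h *: e + x) - un n x)| <= ep / 3 by near: h.
  have h2 := le_trans (Dle n) nK.
  have h3 : `|h^-1 * ((un n (h *: e + x) - u (h *: e + x)) - (un n x - u x))| <= ep / 3.
    rewrite normrM normfV mulrC ler_pdivrMr ?normr_gt0//.
    apply: le_trans (limsL _ _ _ rt _ _ xB hB n) _.
    rewrite addrK normrZ (_ : C * _ * eps n = C * `|e| * eps n * `|h|); last by ring.
    by rewrite ler_wpM2r.
  have -> : du e x - h^-1 *: (u (h *: e + x) - u x) =
    ('D_e (un n) x - h^-1 *: (un n (h *: e + x) - un n x)) - ('D_e (un n) x - du e x)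
    + h^-1 * ((un n (h *: e + x) - u (h *: e + x)) - (un n x - u x)).
    by rewrite /GRing.scale/=; ring.
  apply: le_trans (ler_normD _ _) _; rewrite (_ : ep = ep / 3 + ep / 3 + ep / 3); last by field.
  by rewrite lerD//; apply: le_trans (ler_normB _ _) _; rewrite lerD.
exists u.
  apply: (@Ck1_intro _ _ du) => // [x Dx|e x Dx].
    have [d [C rt]] := H x Dx; have [d0 C0 sub _] := rt.
    apply: (@uniform_limit_cont _ un u eps C x d) => // [n|n y yB].
      exact: Ck1_cont (unC n) Dx.
    by have [_] := lims _ _ _ rt y yB.
  have [d [C rt]] := H x Dx; have [d0 C0 sub _] := rt.
  apply: (@uniform_limit_cont _ (fun n => 'D_e (un n)) (du e) eps (C * `|e|) x d) => // [n|n y yB].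
    exact: Ck1_dcont (unC n) Dx.
  by have [_] := limsD _ _ _ rt e y yB.
move=> x Dx; have [d [C rt]] := H x Dx; have [d0 _ _ _] := rt.
have xB : ball x d x by exact: ballxx.
split; first by have [] := lims _ _ _ rt x xB.
by move=> e; have [l _] := limsD _ _ _ rt e x xB; have [_ ->] := dux e x Dx.
Unshelve. all: by end_near.
Qed.

Definition norm2 (D : set P) (u v : P -> R) : \bar R :=
  (\int[mu]_(x in D) (u x ^+ 2 + v x ^+ 2)%:E)%E.

Lemma norm2_sup (D : set P) (u v : P -> R) (p : P) d e (N : R) : open D -> hol_pair D u v ->
  0 < d -> 0 < e -> qbox p d e `<=` D -> (norm2 D u v <= N%:E)%E ->
  u p ^+ 2 * (d ^+ 2 * e ^+ 2 / 16) <= N.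
Proof.
move=> oD uv d0 e0 sub uvN.
apply: le_trans (mean_value_sqr oD uv d0 e0 sub) _.
have [uC vC _] := uv.
have uc x : D x -> {for x, continuous u} by exact: Ck1_cont uC.
have vc x : D x -> {for x, continuous v} by exact: Ck1_cont vC.
have mQ := @measurable_qbox R p d e.
have mD := open_measurable4 oD.
have i1 : mu.-integrable (qbox p d e) (EFin \o (fun x => u x ^+ 2)).
  by apply: integrable_qbox => // x /sub /uc; exact: contX.
rewrite -lee_fin /Rintegral fineK; last exact: (integrable_fin_num mQ i1).
apply: le_trans uvN.
have mf : measurable_fun (D : set ((measurableTypeR R * measurableTypeR R) *
    (measurableTypeR R * measurableTypeR R))) (fun x => u x ^+ 2 + v x ^+ 2).
  apply: measurable_fun_cont4 => // x Dx.
  by apply: contD; apply: contX; [exact: uc|exact: vc].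
have mf2 : measurable_fun (D : set ((measurableTypeR R * measurableTypeR R) *
    (measurableTypeR R * measurableTypeR R))) (EFin \o (fun x => u x ^+ 2 + v x ^+ 2)).
  exact/measurable_EFinP.
apply: (@le_trans _ _ (\int[mu]_(x in qbox p d e) (u x ^+ 2 + v x ^+ 2)%:E)%E).
  apply: ge0_le_integral => //.
  - by move=> x _; rewrite lee_fin sqr_ge0.
  - exact: measurable_int i1.
  - exact: measurable_funS mf2.
  - by move=> x _; rewrite lee_fin lerDl sqr_ge0.
by apply: ge0_subset_integral => // x _; rewrite lee_fin addr_ge0// sqr_ge0.
Qed.

(** The two local estimates, applied to the differences [un n - un m]. *)
Lemma norm2_rate (D : set P) (un vn : nat -> P -> R) (eps : nat -> R) p0 : open D ->
  (forall n, hol_pair D (un n) (vn n)) -> (forall n, 0 <= eps n) ->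
  (forall n m, (n <= m)%N ->
    (norm2 D (fun x => un n x - un m x)%R (fun x => vn n x - vn m x)%R <= (eps n ^+ 2)%:E)%E) ->
  D p0 -> exists d C, rate_at D un eps p0 d C.
Proof.
move=> oD uvn e0 H Dp0.
have [d3 d30 sub] := open_qbox oD Dp0.
pose d := d3 / 3; have d0 : 0 < d by rewrite divr_gt0.
have d3E : d3 = 2 * d + d by rewrite /d; field.
pose M := 4 / d ^+ 2; have M0 : 0 <= M by rewrite divr_ge0// sqr_ge0.
have sub2 : qbox p0 (2 * d) (2 * d) `<=` D.
  by apply: subset_trans sub; apply: qbox_sub; rewrite d3E; lra.
have sub1 : qbox p0 d d `<=` D.
  by apply: subset_trans sub; apply: qbox_sub; rewrite d3E; lra.
have CM : 0 <= (3 * 2 ^+ 17) * M / d.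
  apply: divr_ge0; last exact: ltW.
  by apply: mulr_ge0 => //; apply: mulr_ge0 => //; exact: exprn_ge0.
exists d, (M + (3 * 2 ^+ 17) * M / d); split => //.
- exact: addr_ge0.
- by move=> x /ball_qbox /sub1.
move=> n m nm p p' /ball_qbox pB /ball_qbox pB'.
have hw : hol_pair D (fun x => un n x - un m x) (fun x => vn n x - vn m x).
  have := hol_pair_lin 1 (-1) oD (uvn n) (uvn m).
  by congr hol_pair; apply/funext => x; rewrite mul1r mulN1r.
have sup x : qbox p0 (2 * d) (2 * d) x -> `|un n x - un m x| <= M * eps n.
  move=> xQ; have := norm2_sup oD hw d0 d0 _ (H n m nm) (p := x).
  have : qbox x d d `<=` D by apply: subset_trans sub; rewrite d3E; exact: qbox_trans.
  move=> h /(_ h) hle.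
  suff h2 : `|un n x - un m x| ^+ 2 <= (M * eps n) ^+ 2.
    by move: h2; rewrite ler_sqr// nnegrE mulr_ge0.
  rewrite real_normK ?num_real//.
  have d4 : 0 < d ^+ 2 * d ^+ 2 / 16 by rewrite divr_gt0// mulr_gt0// exprn_gt0.
  rewrite -(ler_pM2r d4); apply: le_trans hle _.
  by rewrite /M le_eqVlt; apply/orP; left; apply/eqP; field; rewrite gt_eqF.
have in2 q : qbox p0 d d q -> qbox p0 (2 * d) (2 * d) q by apply: qbox_sub; lra.
split.
  apply: le_trans (sup _ (in2 _ pB)) _; by rewrite ler_wpM2r// lerDl.
apply: le_trans (lipschitz_estimate oD hw d0 sub2 sup pB pB') _.
have -> : (3 * 2 ^+ 17) * `|p' - p| * (M * eps n) / d = ((3 * 2 ^+ 17) * M / d) * `|p' - p| * eps n.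
  by field; rewrite gt_eqF.
by rewrite ler_wpM2r// ler_wpM2r// lerDr.
Qed.

Lemma hol_pair_limit (D : set P) (un vn : nat -> P -> R) (eps : nat -> R) : open D ->
  (forall n, hol_pair D (un n) (vn n)) -> (forall n, 0 <= eps n) ->
  eps n @[n --> \oo] --> 0 ->
  (forall n m, (n <= m)%N ->
    (norm2 D (fun x => un n x - un m x)%R (fun x => vn n x - vn m x)%R <= (eps n ^+ 2)%:E)%E) ->
  exists u v, hol_pair D u v /\ forall x, D x ->
    un n x @[n --> \oo] --> u x /\ vn n x @[n --> \oo] --> v x.
Proof.
move=> oD uvn e0 eps0 H.
have [|u uC ul] := C1_limit oD eps0 (fun n => let: And3 h _ _ := uvn n in h).
  by move=> p0; exact: norm2_rate uvn e0 H.
(* The imaginary part of [h] is the real part of [- i h]. *)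
have [|v vC vl] := C1_limit oD eps0 (fun n => let: And3 _ h _ := uvn n in h).
  move=> p0 Dp0; apply: (@norm2_rate D vn (fun n x => - un n x) eps p0 oD _ e0 _ Dp0) => [n|n m nm].
    exact: hol_pair_rot.
  apply: le_trans (H n m nm).
  by rewrite /norm2 le_eqVlt; apply/orP; left; apply/eqP; apply: eq_integral => x _; congr EFin; ring.
exists u, v; split; last by move=> x Dx; split; [case: (ul x Dx)|case: (vl x Dx)].
split=> // j q Dq; have [_ ud] := ul q Dq; have [_ vd] := vl q Dq.
have CR n : 'D_(dir_x j) (un n) q = 'D_(dir_y j) (vn n) q /\
    'D_(dir_y j) (un n) q = - 'D_(dir_x j) (vn n) q.
  by have [_ _] := uvn n; exact.
split.
  have h : (fun n => 'D_(dir_y j) (vn n) q) x @[x --> \oo] --> 'D_(dir_x j) u q.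
    have <- : (fun n => 'D_(dir_x j) (un n) q) = (fun n => 'D_(dir_y j) (vn n) q).
      by apply/funext => n; case: (CR n).
    exact: ud.
  exact: (cvg_unique _ h (vd (dir_y j))).
have h : (fun n => - 'D_(dir_x j) (vn n) q) x @[x --> \oo] --> 'D_(dir_y j) u q.
  have <- : (fun n => 'D_(dir_y j) (un n) q) = (fun n => - 'D_(dir_x j) (vn n) q).
    by apply/funext => n; case: (CR n).
  exact: ud.
have h2 : (fun n => - 'D_(dir_x j) (vn n) q) x @[x --> \oo] --> - 'D_(dir_x j) v q.
  by apply: cvgN; exact: vd.
exact: (cvg_unique _ h h2).
Qed.

End Limits.

(** * Representation of the evaluation at a point *)

Section Riesz.
Variable R : realType.
Notation P := ((R * R) * (R * R))%type.
Notation E4 := ((measurableTypeR R * measurableTypeR R) *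
    (measurableTypeR R * measurableTypeR R))%type.
Notation mu := (lebesgue2 R \x lebesgue2 R)%E.

Lemma fatou_bound (D : set P) (fn : nat -> P -> R) (f : P -> R) (K : R) :
  measurable (D : set E4) ->
  (forall n, measurable_fun (D : set E4) (fn n)) ->
  (forall n x, D x -> 0 <= fn n x) ->
  (forall x, D x -> fn n x @[n --> \oo] --> f x) ->
  (forall n, (\int[mu]_(x in D) (fn n x)%:E <= K%:E)%E) ->
  (\int[mu]_(x in D) (f x)%:E <= K%:E)%E.
Proof.
move=> mD mf f0 fl fK.
have F := @fatou _ _ _ mu D mD (fun n x => (fn n x)%:E) _ _.
have -> : (\int[mu]_(x in D) (f x)%:E = \int[mu]_(x in D) limn_einf (fun n => (fn n x)%:E))%E.
  apply: eq_integral => x; rewrite inE => Dx.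
  have c : (fn n x)%:E @[n --> \oo] --> (f x)%:E.
    by apply/fine_cvgP; split; [apply: nearW|exact: fl].
  by rewrite (cvg_limn_einf_sup c).1.
apply: le_trans (F _ _) _.
- by move=> n; apply/measurable_EFinP; exact: mf.
- by move=> n x Dx; rewrite lee_fin f0.
rewrite limn_einf_lim; apply: lime_le; first exact: is_cvg_einfs.
apply: nearW => n; apply: le_trans (fK n).
by apply: ereal_inf_lbound; exists n => /=.
Qed.

Variable D : set P.
Hypothesis oD : open D.
Let mD : measurable (D : set E4) := open_measurable4 oD.

Definition L2hol (u v : P -> R) :=
  hol_pair D u v /\ mu.-integrable D (EFin \o (fun x => u x ^+ 2 + v x ^+ 2)).

(** The real part of the hermitian product of [u + i v] and [u' + i v']. *)
Definition ip (u v u' v' : P -> R) : R := \int[mu]_(x in D) (u x * u' x + v x * v' x).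
Definition sqn (u v : P -> R) : R := \int[mu]_(x in D) (u x ^+ 2 + v x ^+ 2).

Lemma hol_pair_cont1 u v x : hol_pair D u v -> D x -> {for x, continuous u}.
Proof. by case=> uC _ _; exact: Ck1_cont. Qed.

Lemma hol_pair_cont2 u v x : hol_pair D u v -> D x -> {for x, continuous v}.
Proof. by case=> _ vC _; exact: Ck1_cont. Qed.

Lemma measurable_sqr u v : hol_pair D u v ->
  measurable_fun (D : set E4) (fun x => u x ^+ 2 + v x ^+ 2).
Proof.
move=> uv; apply: measurable_fun_cont4 => // x Dx.
by apply: contD; apply: contX; [exact: hol_pair_cont1 uv Dx|exact: hol_pair_cont2 uv Dx].
Qed.

Lemma sqn_norm2 u v : L2hol u v -> norm2 D u v = (sqn u v)%:E.
Proof. by move=> [_ i]; rewrite /sqn /Rintegral fineK// (integrable_fin_num mD i). Qed.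

Lemma sqn_ge0 u v : 0 <= sqn u v.
Proof. by apply: Rintegral_ge0 => x _; rewrite addr_ge0// sqr_ge0. Qed.

Lemma L2hol_norm2 u v (K : R) : hol_pair D u v -> (norm2 D u v <= K%:E)%E -> L2hol u v.
Proof.
move=> uv uvK; split => //; apply/integrableP; split.
  by apply/measurable_EFinP; exact: measurable_sqr.
apply: le_lt_trans (ltry K); apply: le_trans uvK.
rewrite le_eqVlt; apply/orP; left; apply/eqP; apply: eq_integral => x _ /=.
by rewrite ger0_norm// addr_ge0// sqr_ge0.
Qed.

Lemma integrable_ip u v u' v' : L2hol u v -> L2hol u' v' ->
  mu.-integrable D (EFin \o (fun x => u x * u' x + v x * v' x)).
Proof.
move=> [uv i] [uv' i'].
have i2 := integrableD mD i i'.
apply: (le_integrable mD _ _ i2).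
  apply/measurable_EFinP; apply: measurable_fun_cont4 => // x Dx.
  apply: contD; apply: contM; [exact: hol_pair_cont1 uv Dx|exact: hol_pair_cont1 uv' Dx|
    exact: hol_pair_cont2 uv Dx|exact: hol_pair_cont2 uv' Dx].
move=> x Dx /=; rewrite lee_fin.
rewrite [leRHS]ger0_norm; last by rewrite !addr_ge0// sqr_ge0.
have A (s t : R) : `|s * t| <= s ^+ 2 + t ^+ 2.
  have := sqr_ge0 (s - t); have := sqr_ge0 (s + t); have := sqr_ge0 s; have := sqr_ge0 t.
  by rewrite ler_norml => ? ? ? ?; apply/andP; split; nra.
apply: le_trans (ler_normD _ _) _; have := A (u x) (u' x); have := A (v x) (v' x); lra.
Qed.

Lemma L2hol_lin u v u' v' (a b : R) : L2hol u v -> L2hol u' v' ->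
  L2hol (fun x => a * u x + b * u' x) (fun x => a * v x + b * v' x) /\
  sqn (fun x => a * u x + b * u' x) (fun x => a * v x + b * v' x) =
    a ^+ 2 * sqn u v + 2 * a * b * ip u v u' v' + b ^+ 2 * sqn u' v'.
Proof.
move=> huv huv'; have [uv i] := huv; have [uv' i'] := huv'.
have ii := integrable_ip huv huv'.
have e : (fun x => (a * u x + b * u' x) ^+ 2 + (a * v x + b * v' x) ^+ 2) =
  (fun x => a ^+ 2 * (u x ^+ 2 + v x ^+ 2) + 2 * a * b * (u x * u' x + v x * v' x) +
     b ^+ 2 * (u' x ^+ 2 + v' x ^+ 2)).
  by apply/funext => x; ring.
have j1 : mu.-integrable D (EFin \o (fun x => a ^+ 2 * (u x ^+ 2 + v x ^+ 2))).
  by have := integrableZl mD (a ^+ 2) i.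
have j2 : mu.-integrable D (EFin \o (fun x => 2 * a * b * (u x * u' x + v x * v' x))).
  by have := integrableZl mD (2 * a * b) ii.
have j3 : mu.-integrable D (EFin \o (fun x => b ^+ 2 * (u' x ^+ 2 + v' x ^+ 2))).
  by have := integrableZl mD (b ^+ 2) i'.
have j12 : mu.-integrable D (EFin \o (fun x => a ^+ 2 * (u x ^+ 2 + v x ^+ 2) + 2 * a * b * (u x * u' x + v x * v' x))).
  exact: (integrableD mD j1 j2).
split.
  split; first exact: hol_pair_lin.
  by rewrite e; exact: (integrableD mD j12 j3).
by rewrite /sqn e RintegralD// RintegralD// !RintegralZl.
Qed.

Lemma L2hol_rot u v : L2hol u v -> L2hol v (fun x => - u x).
Proof.
move=> [uv i]; split; first exact: hol_pair_rot.
by rewrite (_ : (fun x => _) = (fun x => u x ^+ 2 + v x ^+ 2))//; apply/funext => x; ring.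
Qed.

Lemma L2hol0 : L2hol (fun=> 0) (fun=> 0).
Proof.
have c0 : Ck_on 1 D (fun=> 0 : R).
  apply: (@Ck1_intro _ _ _ (fun _ _ => 0)) => // [x _|e x _].
  - exact: contcst.
  - exact: contcst.
split; first by split; [exact: c0|exact: c0|move=> j q _; rewrite !derive_cst oppr0].
apply: (@eq_integrable _ _ _ mu D mD (cst 0%E)); last exact: integrable0.
by move=> x _ /=; rewrite expr0n /= addr0.
Qed.

Lemma eval_bound q : D q -> exists2 C : R, 0 < C &
  forall u v, L2hol u v -> u q ^+ 2 <= C * sqn u v.
Proof.
move=> Dq; have [d d0 sub] := open_qbox oD Dq.
have d4 : 0 < d ^+ 2 * d ^+ 2 / 16 by rewrite divr_gt0// mulr_gt0// exprn_gt0.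
exists (d ^+ 2 * d ^+ 2 / 16)^-1; first by rewrite invr_gt0.
move=> u v uv; rewrite mulrC ler_pdivlMr//.
by apply: (norm2_sup oD uv.1 d0 d0 sub); rewrite sqn_norm2.
Qed.

(** The representing function maximises [J h = 2 Re h(q) - |h|^2], which is bounded above
    because the evaluation is.  By the parallelogram identity a maximising sequence is a
    Cauchy sequence; its limit is holomorphic, attains the supremum by Fatou's lemma, and the
    vanishing of the first variation is the reproducing property. *)
Lemma riesz q : D q -> exists b1 b2, L2hol b1 b2 /\
  forall u v, L2hol u v -> u q = ip u v b1 b2.
Proof.
move=> Dq; have [C C0 HC] := eval_bound Dq.
pose J u v := 2 * u q - sqn u v.
pose S := [set j | exists u v, L2hol u v /\ J u v = j].
have JC u v : L2hol u v -> J u v <= C.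
  move=> /HC h; rewrite /J; have s0 := sqn_ge0 u v.
  have : (2 * u q) * C <= u q ^+ 2 + C ^+ 2 by have := sqr_ge0 (u q - C); nra.
  by move=> h2; rewrite -(ler_pM2r C0); nra.
have S0 : S (J (fun=> 0) (fun=> 0)) by exists (fun=> 0), (fun=> 0); split; first exact: L2hol0.
have hS : has_sup S.
  by split; [exists (J (fun=> 0) (fun=> 0))|exists C => _ [u [v [uv <-]]]; exact: JC].
pose M := sup S.
have JM u v : L2hol u v -> J u v <= M.
  by move=> uv; apply: ub_le_sup; [case: hS|exists u, v].
pose eps n : R := n.+1%:R^-1.
have eps_gt0 n : 0 < eps n by rewrite invr_gt0.
have seq n : exists uv : (P -> R) * (P -> R), L2hol uv.1 uv.2 /\ M - eps n ^+ 2 / 4 < J uv.1 uv.2.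
  have [|j [u [v [uv <-]]] h] := @sup_adherent _ S (eps n ^+ 2 / 4) _ hS.
    by rewrite divr_gt0// exprn_gt0.
  by exists (u, v).
have [h hP] := choice seq.
pose un n := (h n).1; pose vn n := (h n).2.
have hL n : L2hol (un n) (vn n) by case: (hP n).
have hJ n : M - eps n ^+ 2 / 4 < J (un n) (vn n) by case: (hP n).
have eps_le n m : (n <= m)%N -> eps m <= eps n.
  by move=> nm; rewrite lef_pV2 ?posrE// ler_nat.
(* Parallelogram identity, with the value of [J] at the midpoint at most [M]. *)
have cauchy n m : (n <= m)%N ->
    (norm2 D (fun x => un n x - un m x)%R (fun x => vn n x - vn m x)%R <= (eps n ^+ 2)%:E)%E.
  move=> nm.
  have [dL dE] := L2hol_lin 1 (-1) (hL n) (hL m).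
  have [mL mE] := L2hol_lin 2^-1 2^-1 (hL n) (hL m).
  have := JM _ _ mL; rewrite /J mE => h1.
  have f1 : (fun x => un n x - un m x) = (fun x => 1 * un n x + -1 * un m x).
    by apply/funext => x; rewrite mul1r mulN1r.
  have f2 : (fun x => vn n x - vn m x) = (fun x => 1 * vn n x + -1 * vn m x).
    by apply/funext => x; rewrite mul1r mulN1r.
  rewrite f1 f2 sqn_norm2// dE lee_fin.
  have := hJ n; have := hJ m; rewrite /J => h2 h3.
  have : eps m ^+ 2 <= eps n ^+ 2 by apply: lerXn2r; rewrite ?nnegrE ?eps_le// ltW.
  lra.
have eps0 : eps n @[n --> \oo] --> 0 by exact: cvg_harmonic.
have [b1 [b2 [bh blim]]] := hol_pair_limit oD (fun n => (hL n).1) (fun n => ltW (eps_gt0 n)) eps0 cauchy.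
have blq : un n q @[n --> \oo] --> b1 q by case: (blim q Dq).
(* Fatou's lemma along the tail of the sequence gives [M <= J b + e] in this form. *)
have bnorm e : 0 < e -> (norm2 D b1 b2 <= (2 * b1 q - M + e)%:E)%E.
  move=> e0.
  have e2 : 0 < e / 4 by rewrite divr_gt0.
  have /cvgrPdist_le /(_ _ e2) [N1 _ HN1] := blq.
  have m0 : 0 < Num.min 1 e by rewrite lt_min ltr01 e0.
  have [N2 HN2] := eps_small 1 eps0 m0.
  pose N := maxn N1 N2.
  apply: (@fatou_bound D (fun n x => un (n + N)%N x ^+ 2 + vn (n + N)%N x ^+ 2)) => //.
  - by move=> n; apply: measurable_sqr; exact: (hL _).1.
  - by move=> n x _; rewrite addr_ge0// sqr_ge0.
  - move=> x Dx; have [l1 l2] := blim x Dx.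
    have s1 : un (n + N)%N x @[n --> \oo] --> b1 x by rewrite (cvg_shiftn N (un ^~ x)).
    have s2 : vn (n + N)%N x @[n --> \oo] --> b2 x by rewrite (cvg_shiftn N (vn ^~ x)).
    by rewrite !expr2; apply: cvgD; apply: cvgM.
  - move=> n; have := sqn_norm2 (hL (n + N)%N); rewrite /norm2 => ->; rewrite lee_fin.
    have := hJ (n + N)%N; rewrite /J => h1.
    have h2 : `|b1 q - un (n + N)%N q| <= e / 4.
      by apply: HN1; rewrite /= (leq_trans (leq_maxl N1 N2))// leq_addl.
    have h3 : eps (n + N)%N ^+ 2 <= e.
      have h4 : eps (n + N)%N <= Num.min 1 e.
        by apply: le_trans (eps_le _ _ _) _; last (rewrite mul1r in HN2; exact: HN2);
          rewrite (leq_trans (leq_maxr N1 N2))// leq_addl.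
      move: h4; rewrite le_min => /andP[h5 h6]; have := eps_gt0 (n + N)%N; nra.
    by move: h2; rewrite ler_norml => /andP[? ?]; lra.
have bL : L2hol b1 b2 by apply: (L2hol_norm2 bh (bnorm 1 ltr01)).
have bM : M <= J b1 b2.
  rewrite /J; apply/ler_addgt0Pr => e e0.
  by have := bnorm e e0; rewrite sqn_norm2// lee_fin; lra.
exists b1, b2; split=> // u v uv.
pose a := u q - ip u v b1 b2.
(* [J (b + s h) <= J b]; [a = 0] follows by choosing [s] proportional to [a]. *)
have var s : 2 * s * a <= s ^+ 2 * sqn u v.
  have [sL sE] := L2hol_lin s 1 uv bL.
  have := JM _ _ sL; rewrite /J sE !mulr1 expr1n !mul1r => h1.
  by move: bM; rewrite /J /a; lra.
have N1 : 0 < sqn u v + 1 by rewrite ltr_wpDl// sqn_ge0.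
have hv := var (a / (sqn u v + 1)).
have : 2 * a ^+ 2 * (sqn u v + 1) <= a ^+ 2 * sqn u v.
  have N2 : 0 < (sqn u v + 1) ^+ 2 by rewrite exprn_gt0.
  rewrite -(ler_pM2r N2) in hv.
  have e1 : 2 * (a / (sqn u v + 1)) * a * (sqn u v + 1) ^+ 2 = 2 * a ^+ 2 * (sqn u v + 1).
    by field; rewrite gt_eqF.
  have e2 : (a / (sqn u v + 1)) ^+ 2 * sqn u v * (sqn u v + 1) ^+ 2 = a ^+ 2 * sqn u v.
    by field; rewrite gt_eqF.
  by rewrite e1 e2 in hv.
have s0 := sqn_ge0 u v; have a0 := sqr_ge0 a.
move=> h2; have a20 : a ^+ 2 <= 0 by nra.
have : a ^+ 2 == 0 by rewrite eq_le a20.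
by rewrite sqrf_eq0 subr_eq0 => /eqP.
Qed.

Lemma cauchy_schwarz u v u' v' : L2hol u v -> L2hol u' v' ->
  ip u v u' v' ^+ 2 <= sqn u v * sqn u' v'.
Proof.
move=> uv uv'.
have H s : 0 <= sqn u v + 2 * s * ip u v u' v' + s ^+ 2 * sqn u' v'.
  have [_ e] := L2hol_lin 1 s uv uv'; have := sqn_ge0 (fun x => 1 * u x + s * u' x) (fun x => 1 * v x + s * v' x).
  by rewrite e expr1n mul1r mulr1.
set a := ip _ _ _ _ in H *; have n1 := sqn_ge0 u v; have n2 := sqn_ge0 u' v'.
set A := sqn u v in H n1 *; set B := sqn u' v' in H n2 *; clearbody a A B.
have [B0|B0] := eqVneq B 0.
  have := H (- (A + 1) / (2 * a)); rewrite B0 !mulr0 addr0.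
  have [->|a0] := eqVneq a 0; first by rewrite expr0n /=.
  have -> : 2 * (- (A + 1) / (2 * a)) * a = - (A + 1) by field.
  by lra.
have Bp : 0 < B by rewrite lt_neqAle eq_sym B0.
have := H (- a / B).
have -> : A + 2 * (- a / B) * a + (- a / B) ^+ 2 * B = (A * B - a ^+ 2) / B by field.
by rewrite pmulr_lge0 ?invr_gt0// subr_ge0.
Qed.
End Riesz.

(** * The Bergman kernel on the diagonal *)

Section Kernel.
Variable R : realType.
Notation P := ((R * R) * (R * R))%type.
Notation mu := (lebesgue2 R \x lebesgue2 R)%E.
Variable Omega : set (R[i] * R[i]).
Let D : set P := toC2 @^-1` Omega.
Hypothesis oD : open D.

Definition fromC2 (q : R[i] * R[i]) : P :=
  ((complex.Re q.1, complex.Im q.1), (complex.Re q.2, complex.Im q.2)).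

Lemma toC2K (p : P) : fromC2 (toC2 p) = p. Proof. by case: p => [[? ?] [? ?]]. Qed.
Lemma fromC2K q : toC2 (fromC2 q) = q. Proof. by case: q => [[? ?] [? ?]]. Qed.

Let re (h : R[i] * R[i] -> R[i]) (q : P) : R := complex.Re (h (toC2 q)).
Let im (h : R[i] * R[i] -> R[i]) (q : P) : R := complex.Im (h (toC2 q)).

Lemma d_zbar_eq0 (j : 'I_2) (h : R[i] * R[i] -> R[i]) (q : P) :
  d_zbar j (h \o toC2) q = 0 <->
  'D_(dir_x j) (re h) q = 'D_(dir_y j) (im h) q /\
  'D_(dir_y j) (re h) q = - 'D_(dir_x j) (im h) q.
Proof.
set a := 'D_(dir_x j) (re h) q; set b := 'D_(dir_x j) (im h) q.
set c := 'D_(dir_y j) (re h) q; set d := 'D_(dir_y j) (im h) q.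
have -> : d_zbar j (h \o toC2) q = 2^-1 * ((a +i* b) + 'i * (c +i* d)) by [].
have -> : a +i* b + 'i * (c +i* d) = (a - d) +i* (b + c) by simpc.
clearbody a b c d; split=> [/eqP|[ad cb]].
  rewrite mulf_eq0 invr_eq0 pnatr_eq0/= eq_complex/= => /andP[/eqP e1 /eqP e2].
  by split; lra.
rewrite -[RHS](mulr0 2^-1); congr (_ * _); apply/eqP.
by rewrite eq_complex/= ad cb !subrr eqxx.
Qed.

Lemma holomorphic_hol_pair h : holomorphic_on Omega h <-> hol_pair D (re h) (im h).
Proof.
by split=> -[h1 h2 h3]; split; [exact: h1|exact: h2|move=> j q Dq; apply/d_zbar_eq0; exact: h3|
  exact: h1|exact: h2|move=> j q Dq; apply/d_zbar_eq0; exact: h3].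
Qed.

Lemma sqr_normc (z : R[i]) : complex.Re `|z| ^+ 2 = complex.Re z ^+ 2 + complex.Im z ^+ 2.
Proof. by rewrite normc_def/= sqr_sqrtr// addr_ge0// sqr_ge0. Qed.

Lemma A2_L2hol h : A2 Omega h <-> L2hol D (re h) (im h).
Proof.
have e : (fun q => (complex.Re `|h (toC2 q)| ^+ 2)%:E) =
   EFin \o (fun q : P => re h q ^+ 2 + im h q ^+ 2).
  by apply/funext => q /=; rewrite sqr_normc.
split=> -[h1 h2]; split; try exact/holomorphic_hol_pair.
  by rewrite -e.
by rewrite e.
Qed.

Lemma cintegral_ip h b :
  cintegral Omega (fun p => h p * (b p)^*) =
  (ip D (re h) (im h) (re b) (im b)) +i* (ip D (im h) (fun q => - re h q) (re b) (im b)).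
Proof.
rewrite /cintegral; congr (_ +i* _); apply: eq_Rintegral => q _; rewrite /re /im.
  by case: (h _) => a1 a2; case: (b _) => c1 c2 /=; ring.
by case: (h _) => a1 a2; case: (b _) => c1 c2 /=; ring.
Qed.

(** The real identity [Re h(q) = Re <h, b>] for [h] and for [- i h] gives the complex
    one. *)
Lemma bergman_kernel_exists : exists B, is_bergman_kernel Omega B.
Proof.
have H (q : P) : exists b : (P -> R) * (P -> R), D q -> L2hol D b.1 b.2 /\
    forall u v, L2hol D u v -> u q = ip D u v b.1 b.2.
  have [Dq|Dq] := pselect (D q); last by exists (fun=> 0, fun=> 0).
  by have [b1 [b2 [h1 h2]]] := riesz oD Dq; exists (b1, b2).
have [b bP] := choice H.
exists (fun p q => (b (fromC2 q)).1 (fromC2 p) +i* (b (fromC2 q)).2 (fromC2 p)) => q Oq.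
have Dq : D (fromC2 q) by rewrite /D/= fromC2K.
have [bL br] := bP _ Dq.
set Bq := (fun p => _).
have r1 : re Bq = (b (fromC2 q)).1 by apply/funext => p; rewrite /re /Bq/= toC2K.
have r2 : im Bq = (b (fromC2 q)).2 by apply/funext => p; rewrite /im /Bq/= toC2K.
split; first by apply/A2_L2hol; rewrite r1 r2.
move=> h /A2_L2hol hL; rewrite cintegral_ip r1 r2 -br// -br; last exact: L2hol_rot.
by rewrite /re /im fromC2K; case: (h q).
Qed.

(** The reproducing property of the kernel function at itself: its value at its own point is
    its squared norm. *)
Lemma bergman_kernel_diag p : D p -> exists b1 b2, [/\ L2hol D b1 b2,
  forall u v, L2hol D u v -> u p = ip D u v b1 b2 &
  bergman_kernel Omega (toC2 p) (toC2 p) = (sqn D b1 b2)%:C].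
Proof.
move=> Dp; have := xgetPex (fun _ _ => 0) bergman_kernel_exists.
rewrite -/(bergman_kernel Omega); set B := bergman_kernel Omega => HB.
have [BA Br] := HB _ Dp.
have BL := (A2_L2hol _).1 BA.
have repr u v : L2hol D u v -> u p = ip D u v (re (B ^~ (toC2 p))) (im (B ^~ (toC2 p))).
  move=> uv; pose h q := u (fromC2 q) +i* v (fromC2 q).
  have r1 : re h = u by apply/funext => x; rewrite /re /h/= toC2K.
  have r2 : im h = v by apply/funext => x; rewrite /im /h/= toC2K.
  have := Br h; rewrite A2_L2hol r1 r2 => /(_ uv) /(congr1 (@complex.Re R)).
  by rewrite cintegral_ip r1 r2 /h/= toC2K.
exists (re (B ^~ (toC2 p))), (im (B ^~ (toC2 p))); split => //.
have k1 := repr _ _ BL; have k2 := repr _ _ (L2hol_rot oD BL).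
rewrite [LHS](_ : _ = re (B ^~ (toC2 p)) p +i* im (B ^~ (toC2 p)) p); last by rewrite /re /im; case: (B _ _).
rewrite k1 k2; congr (_ +i* _).
transitivity (\int[mu]_(x in D) (0 : R)).
  by rewrite /ip; apply: eq_Rintegral => x _; ring.
by rewrite Rintegral_cst ?mul0r//; exact: open_measurable4.
Qed.

(** The Cauchy-Schwarz inequality for [h] multiplied by the conjugate of [h(p)], the value
    of which at [p] is real. *)
Lemma bergman_kernel_ge p u v : D p -> L2hol D u v ->
  exists2 K, bergman_kernel Omega (toC2 p) (toC2 p) = K%:C &
    u p ^+ 2 + v p ^+ 2 <= sqn D u v * K.
Proof.
move=> Dp uv; have [b1 [b2 [bL br ->]]] := bergman_kernel_diag Dp.
exists (sqn D b1 b2) => //.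
set a := u p; set b := v p.
have [gL gE] := L2hol_lin oD a b uv (L2hol_rot oD uv).
have := cauchy_schwarz oD gL bL; rewrite -br//= -/a -/b.
have -> : sqn D (fun x => a * u x + b * v x) (fun x => a * v x + b * - u x) =
   (a ^+ 2 + b ^+ 2) * sqn D u v.
  rewrite -RintegralZl//; [|exact: open_measurable4|exact: uv.2].
  by apply: eq_Rintegral => x _ /=; ring.
have -> : a * a + b * b = a ^+ 2 + b ^+ 2 by ring.
have [->|n0] := eqVneq (a ^+ 2 + b ^+ 2) 0.
  by move=> _; rewrite mulr_ge0 ?sqn_ge0.
have np : 0 < a ^+ 2 + b ^+ 2 by rewrite lt_neqAle eq_sym n0 addr_ge0// sqr_ge0.
by rewrite expr2 -mulrA ler_pM2l.
Qed.

(** For the kernel function itself, the bound of the value by the norm is quadratic in [K] on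
    the left and linear on the right. *)
Lemma bergman_kernel_le p d e : 0 < d -> 0 < e -> qbox p d e `<=` D ->
  exists2 K, bergman_kernel Omega (toC2 p) (toC2 p) = K%:C & K * (d ^+ 2 * e ^+ 2) <= 16.
Proof.
move=> d0 e0 sub.
have Dp : D p by apply: sub; apply: qbox_intro; rewrite subrr normr0 ltW.
have [b1 [b2 [bL br ->]]] := bergman_kernel_diag Dp.
exists (sqn D b1 b2) => //.
have h : b1 p ^+ 2 * (d ^+ 2 * e ^+ 2 / 16) <= sqn D b1 b2.
  by apply: (norm2_sup oD bL.1 d0 e0 sub); rewrite sqn_norm2.
have k1 : b1 p = sqn D b1 b2.
  exact: br bL.
rewrite k1 in h; have s0 := sqn_ge0 D b1 b2.
have [->|n0] := eqVneq (sqn D b1 b2) 0; first by rewrite mul0r.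
have np : 0 < sqn D b1 b2 by rewrite lt_neqAle eq_sym n0.
move: h; rewrite expr2 -mulrA -[leRHS]mulr1 ler_pM2l// mulrA ler_pdivrMr//.
by rewrite mul1r.
Qed.

End Kernel.

(** * Test functions *)

Lemma is_derive_inv (R : realType) (x : R) : x != 0 ->
  is_derive (x : R) (1 : R) (fun y : R => y^-1) (- x ^- 2).
Proof.
move=> nz.
have [d1 d2] : is_derive (x : R) (1 : R) (fun y : R => y) 1 by exact: is_derive_id.
split; first exact: (derivableV nz d1).
by rewrite (deriveV nz d1) d2 [_ *: _]mulr1.
Qed.

Section TestFunction.
Variable R : realType.
Notation P := ((R * R) * (R * R))%type.

Lemma is_derive_line0 (V : normedModType R) (f : V -> R) p v l :
  is_derive (0 : R) (1 : R) (fun s : R => f (p + s *: v)) l -> is_derive p v f l.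
Proof.
move=> [df fl]; apply: is_derive_cvg.
have -> : (fun h : R => h^-1 *: (f (h *: v + p) - f p)) =
  (fun h : R => h^-1 *: (((fun s : R => f (p + s *: v)) \o shift 0) (h *: (1 : R)) - f (p + 0 *: v))).
  apply/funext => h; rewrite scale0r addr0; congr (_ *: (f _ - _)).
  rewrite addrC; congr (_ + _ *: _).
  exact: (esym (etrans (addr0 _) (mulr1 _))).
by rewrite -fl; exact: df.
Qed.

Lemma is_derive_comp (V : normedModType R) (f : R -> R) (g : V -> R) p v df dg :
  is_derive (g p : R) (1 : R) f df -> is_derive p v g dg -> is_derive p v (fun x => f (g x)) (df * dg).
Proof.
move=> fd gd; apply: is_derive_line0.
have e : p + 0 *: v = p by rewrite scale0r addr0.
have gd0 : is_derive (0 : R) (1 : R) (fun s : R => g (p + s *: v)) dg.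
  by apply: is_derive_line; rewrite e.
by apply: (@is_derive1_comp _ f (fun s : R => g (p + s *: v)) 0 df dg) => //; rewrite e.
Qed.

Lemma hol_pair_intro (D : set P) (u v : P -> R) (du dv : P -> P -> R) : open D ->
  (forall q, D q -> {for q, continuous u}) -> (forall q, D q -> {for q, continuous v}) ->
  (forall e q, D q -> is_derive q e u (du e q)) ->
  (forall e q, D q -> is_derive q e v (dv e q)) ->
  (forall e q, D q -> {for q, continuous (du e)}) ->
  (forall e q, D q -> {for q, continuous (dv e)}) ->
  (forall j q, D q -> du (dir_x j) q = dv (dir_y j) q /\ du (dir_y j) q = - dv (dir_x j) q) ->
  hol_pair D u v.
Proof.
move=> oD uc vc ud vd duc dvc CR; split; [exact: Ck1_intro ud duc|exact: Ck1_intro vd dvc|].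
move=> j q Dq; have [c1 c2] := CR j q Dq.
have [_ ->] := ud (dir_x j) q Dq; have [_ ->] := ud (dir_y j) q Dq.
by have [_ ->] := vd (dir_x j) q Dq; have [_ ->] := vd (dir_y j) q Dq.
Qed.

Lemma hol_pair_mul (D : set P) (u v u' v' : P -> R) : open D -> hol_pair D u v -> hol_pair D u' v' ->
  hol_pair D (fun q => u q * u' q - v q * v' q) (fun q => u q * v' q + v q * u' q).
Proof.
move=> oD [uC vC CR] [uC' vC' CR'].
apply: (@hol_pair_intro D _ _
  (fun e q => (u q * 'D_e u' q + u' q * 'D_e u q) - (v q * 'D_e v' q + v' q * 'D_e v q))
  (fun e q => (u q * 'D_e v' q + v' q * 'D_e u q) + (v q * 'D_e u' q + u' q * 'D_e v q)) oD).
- by move=> q Dq; apply: contS; apply: contM; exact: (Ck1_cont _ Dq).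
- by move=> q Dq; apply: contD; apply: contM; exact: (Ck1_cont _ Dq).
- move=> e q Dq.
  have h1 := Ck1_is_derive e uC Dq; have h2 := Ck1_is_derive e vC Dq.
  have h3 := Ck1_is_derive e uC' Dq; have h4 := Ck1_is_derive e vC' Dq.
  exact: (is_deriveB (is_deriveM h1 h3) (is_deriveM h2 h4)).
- move=> e q Dq.
  have h1 := Ck1_is_derive e uC Dq; have h2 := Ck1_is_derive e vC Dq.
  have h3 := Ck1_is_derive e uC' Dq; have h4 := Ck1_is_derive e vC' Dq.
  exact: (is_deriveD (is_deriveM h1 h4) (is_deriveM h2 h3)).
- move=> e q Dq.
  have cu := Ck1_cont uC Dq; have cv := Ck1_cont vC Dq.
  have cu' := Ck1_cont uC' Dq; have cv' := Ck1_cont vC' Dq.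
  have du := Ck1_dcont (e := e) uC Dq; have dv := Ck1_dcont (e := e) vC Dq.
  have du' := Ck1_dcont (e := e) uC' Dq; have dv' := Ck1_dcont (e := e) vC' Dq.
  exact: (contS (contD (contM cu du') (contM cu' du)) (contD (contM cv dv') (contM cv' dv))).
- move=> e q Dq.
  have cu := Ck1_cont uC Dq; have cv := Ck1_cont vC Dq.
  have cu' := Ck1_cont uC' Dq; have cv' := Ck1_cont vC' Dq.
  have du := Ck1_dcont (e := e) uC Dq; have dv := Ck1_dcont (e := e) vC Dq.
  have du' := Ck1_dcont (e := e) uC' Dq; have dv' := Ck1_dcont (e := e) vC' Dq.
  exact: (contD (contD (contM cu dv') (contM cv' du)) (contD (contM cv du') (contM cu' dv))).
- move=> j q Dq; have [-> ->] := CR j q Dq; have [-> ->] := CR' j q Dq.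
  move: (u q) (v q) (u' q) (v' q) ('D_(dir_x j) v q) ('D_(dir_y j) v q)
    ('D_(dir_x j) v' q) ('D_(dir_y j) v' q) => a b c d A B C E.
  by split; ring.
Qed.

Let X (q : P) : R := q.2.1.
Let Y (q : P) : R := q.2.2.

Lemma is_derive_X (q e : P) : is_derive q e X (X e).
Proof. by apply: is_derive_linear_map => h x y. Qed.

Lemma is_derive_Y (q e : P) : is_derive q e Y (Y e).
Proof. by apply: is_derive_linear_map => h x y. Qed.

Lemma cont_rew q : {for q, continuous X}.
Proof. by suff : {for q, continuous (fun q : P => q.2.1)} by []; cts. Qed.

Lemma cont_imw q : {for q, continuous Y}.
Proof. by suff : {for q, continuous (fun q : P => q.2.2)} by []; cts. Qed.

Lemma dirXY j : [/\ X (dir_y j) = 0, Y (dir_x j) = 0 & X (dir_x j) = Y (dir_y j)].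
Proof. by rewrite /X /Y /dir_x /dir_y; case: ifP. Qed.

(** The function [exp (i a w)]. *)
Lemma hol_pair_exp (D : set P) (a : R) : open D ->
  hol_pair D (fun q => expR (- a * Y q) * cos (a * X q)) (fun q => expR (- a * Y q) * sin (a * X q)).
Proof.
move=> oD; set u := (fun q => _ * cos _); set v := (fun q => _ * sin _).
have ce q : {for q, continuous (fun q => expR (- a * Y q))}.
  apply: (@contcomp _ _ _ expR (fun q => - a * Y q)); first exact: continuous_expR.
  by apply: contM; [exact: contcst|exact: cont_imw].
have cX q : {for q, continuous (fun q => a * X q)} by apply: contM; [exact: contcst|exact: cont_rew].
have cu q : {for q, continuous u}.
  apply: contM => //; apply: (@contcomp _ _ _ cos (fun q => a * X q)) => //.
  exact: continuous_cos.
have cv q : {for q, continuous v}.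
  apply: contM => //; apply: (@contcomp _ _ _ sin (fun q => a * X q)) => //.
  exact: continuous_sin.
have dX q e : is_derive q e (fun q => a * X q) (a * X e).
  by have H := is_derive_X q e; apply: (is_derive_eq (is_deriveM (is_derive_cst a q e) H)); rewrite /GRing.scale/=; ring.
have dY q e : is_derive q e (fun q => - a * Y q) (- a * Y e).
  by have H := is_derive_Y q e; apply: (is_derive_eq (is_deriveM (is_derive_cst (- a) q e) H)); rewrite /GRing.scale/=; ring.
have dE q e := @is_derive_comp _ expR (fun q => - a * Y q) q e _ _ (is_derive_expR _) (dY q e).
have dC q e := @is_derive_comp _ cos (fun q => a * X q) q e _ _ (is_derive_cos _) (dX q e).
have dS q e := @is_derive_comp _ sin (fun q => a * X q) q e _ _ (is_derive_sin _) (dX q e).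
apply: (@hol_pair_intro D u v (fun e q => - a * Y e * u q - a * X e * v q)
   (fun e q => - a * Y e * v q + a * X e * u q) oD).
- by move=> q _; exact: cu.
- by move=> q _; exact: cv.
- move=> e q _; apply: (is_derive_eq (is_deriveM (dE q e) (dC q e))).
  by rewrite /u /v /GRing.scale/=; ring.
- move=> e q _; apply: (is_derive_eq (is_deriveM (dE q e) (dS q e))).
  by rewrite /u /v /GRing.scale/=; ring.
- by move=> e q _; apply: contS; apply: contM => //; exact: contcst.
- by move=> e q _; apply: contD; apply: contM => //; exact: contcst.
- move=> j q _; have [-> -> ->] := dirXY j; split; ring.
Qed.

(** The function [1 / (w - conj w0)], where [w0 = x0 + i t]. *)
Lemma hol_pair_inv (D : set P) (x0 t : R) : open D ->
  (forall q, D q -> 0 < Y q + t) ->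
  hol_pair D (fun q => (X q - x0) * ((X q - x0) ^+ 2 + (Y q + t) ^+ 2)^-1)
         (fun q => - (Y q + t) * ((X q - x0) ^+ 2 + (Y q + t) ^+ 2)^-1).
Proof.
move=> oD Dpos; set n := (fun q => (X q - x0) ^+ 2 + (Y q + t) ^+ 2).
have n0 q : D q -> 0 < n q.
  by move=> /Dpos h; rewrite /n ltr_wpDl ?sqr_ge0// exprn_gt0.
set u := (fun q => (X q - x0) * _); set v := (fun q => - (Y q + t) * _).
have cX q : {for q, continuous (fun q => X q - x0)} by apply: contS; [exact: cont_rew|exact: contcst].
have cY q : {for q, continuous (fun q => Y q + t)} by apply: contD; [exact: cont_imw|exact: contcst].
have cn q : {for q, continuous n} by apply: contD; exact: contX.
have cni q : D q -> {for q, continuous (fun q => (n q)^-1)}.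
  by move=> /n0 nq; apply: cvgV (cn q); rewrite gt_eqF.
have cu q : D q -> {for q, continuous u} by move=> Dq; apply: contM => //; exact: cni.
have cv q : D q -> {for q, continuous v}.
  by move=> Dq; apply: contM; [exact: contN|exact: cni].
have dX q e : is_derive q e (fun q => X q - x0) (X e).
  have H := is_derive_X q e.
  by apply: (is_derive_eq (is_deriveB H (is_derive_cst x0 q e))); rewrite subr0.
have dY q e : is_derive q e (fun q => Y q + t) (Y e).
  have H := is_derive_Y q e.
  by apply: (is_derive_eq (is_deriveD H (is_derive_cst t q e))); rewrite addr0.
have dNY q e : is_derive q e (fun q => - (Y q + t)) (- Y e) := is_deriveN (dY q e).
have dn q e : is_derive q e n (2 * (X q - x0) * X e + 2 * (Y q + t) * Y e).
  apply: (is_derive_eq (is_deriveD (is_deriveX 2 (dX q e)) (is_deriveX 2 (dY q e)))).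
  by rewrite /GRing.scale/=; ring.
have dni q e : D q -> is_derive q e (fun q => (n q)^-1)
   (- (n q ^- 2) * (2 * (X q - x0) * X e + 2 * (Y q + t) * Y e)).
  move=> /n0 nq; apply: (@is_derive_comp _ (fun x => x^-1) n) => //.
  have nz : n q != 0 by rewrite gt_eqF.
  exact: is_derive_inv.
apply: (@hol_pair_intro D u v (fun e q => - (u q ^+ 2 - v q ^+ 2) * X e + 2 * u q * v q * Y e)
   (fun e q => - (u q ^+ 2 - v q ^+ 2) * Y e - 2 * u q * v q * X e) oD).
- exact: cu.
- exact: cv.
- move=> e q Dq; apply: (is_derive_eq (is_deriveM (dX q e) (dni q e Dq))).
  have := n0 q Dq; rewrite /u /v /GRing.scale/= -/(n q) => nq.
  have nE : n q = (X q - x0) ^+ 2 + (Y q + t) ^+ 2 by [].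
  by rewrite nE in nq *; field; rewrite gt_eqF.
- move=> e q Dq; apply: (is_derive_eq (is_deriveM (dNY q e) (dni q e Dq))).
  have := n0 q Dq; rewrite /u /v /GRing.scale/= -/(n q) => nq.
  have nE : n q = (X q - x0) ^+ 2 + (Y q + t) ^+ 2 by [].
  by rewrite nE in nq *; field; rewrite gt_eqF.
- move=> e q Dq; apply: contD; apply: contM; try exact: contcst.
    by apply: contN; apply: contS; apply: contX; [exact: cu|exact: cv].
  by apply: contM; [apply: contM; [exact: contcst|exact: cu]|exact: cv].
- move=> e q Dq; apply: contS; apply: contM; try exact: contcst.
    by apply: contN; apply: contS; apply: contX; [exact: cu|exact: cv].
  by apply: contM; [apply: contM; [exact: contcst|exact: cu]|exact: cv].
- move=> j q _; have [-> -> ->] := dirXY j; split; ring.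
Qed.

(** The squared modulus of [exp (i a w) / (w - conj w0)^k], where [w0 = x0 + i t]. *)
Lemma test_function (D : set P) (a x0 t : R) k : open D ->
  (forall q, D q -> 0 < Y q + t) ->
  exists u v, hol_pair D u v /\ forall q, D q -> u q ^+ 2 + v q ^+ 2 =
     expR (- a * Y q) ^+ 2 * ((X q - x0) ^+ 2 + (Y q + t) ^+ 2)^-1 ^+ k.
Proof.
move=> oD Dpos; elim: k => [|k [u [v [uv uvE]]]].
  exists (fun q => expR (- a * Y q) * cos (a * X q)), (fun q => expR (- a * Y q) * sin (a * X q)).
  split; first exact: hol_pair_exp.
  by move=> q _; rewrite !exprMn -mulrDr cos2Dsin2 expr0.
have hi := hol_pair_inv x0 oD Dpos.
exists (fun q => u q * ((X q - x0) * ((X q - x0) ^+ 2 + (Y q + t) ^+ 2)^-1)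
    - v q * (- (Y q + t) * ((X q - x0) ^+ 2 + (Y q + t) ^+ 2)^-1)),
  (fun q => u q * (- (Y q + t) * ((X q - x0) ^+ 2 + (Y q + t) ^+ 2)^-1)
    + v q * ((X q - x0) * ((X q - x0) ^+ 2 + (Y q + t) ^+ 2)^-1)).
split; first exact: (hol_pair_mul oD uv hi).
move=> q Dq; set n := (X q - x0) ^+ 2 + (Y q + t) ^+ 2.
have nq : 0 < n by apply: ltr_wpDl; [exact: sqr_ge0|apply: exprn_gt0; exact: Dpos].
have h := uvE q Dq; rewrite -/n in h.
have -> : expR (- a * Y q) ^+ 2 * n^-1 ^+ k.+1 = (u q ^+ 2 + v q ^+ 2) * (n * n^-1 ^+ 2).
  rewrite h [n^-1 ^+ k.+1]exprSr; move: (n^-1 ^+ k) (expR _) => b c.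
  by clearbody n; field; rewrite gt_eqF.
transitivity ((u q ^+ 2 + v q ^+ 2) * (((X q - x0) ^+ 2 + (Y q + t) ^+ 2) * n^-1 ^+ 2)); last by [].
by move: (n^-1) => m; ring.
Qed.
End TestFunction.

(** * Integrals over domains with bounded slices *)

Section Integrals.
Variable R : realType.
Notation P := ((R * R) * (R * R))%type.
Notation E2 := (measurableTypeR R * measurableTypeR R)%type.
Notation E4 := ((measurableTypeR R * measurableTypeR R) *
    (measurableTypeR R * measurableTypeR R))%type.
Notation leb := (@lebesgue_measure R).
Notation mu2 := (lebesgue2 R).
Notation mu := (lebesgue2 R \x lebesgue2 R)%E.

Lemma integral_inv_sqr (c t : R) : 0 < t ->
  (\int[leb]_(s in `[c, +oo[) ((s - c + t) ^- 2)%:E = (t^-1)%:E)%E.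
Proof.
move=> t0; pose F (s : R) : R := - (s - c + t)^-1; pose f (s : R) : R := (s - c + t) ^- 2.
have pos s : c <= s -> s - c + t != 0 by move=> cs; rewrite gt_eqF// ltr_wpDl// subr_ge0.
have dlin (s : R) : is_derive (s : R) (1 : R) (fun s : R => s - c + t) 1.
  by apply: is_derive_eq; rewrite subr0 addr0.
have dF (s : R) : c <= s -> is_derive (s : R) (1 : R) F (f s).
  move=> cs; have h := @is_derive1_comp _ (fun y => y^-1) (fun s => s - c + t) s _ _ (is_derive_inv (pos s cs)) (dlin s).
  by apply: (is_derive_eq (is_deriveN h)); rewrite /f mulr1 opprK.
have Fc : F c = - t^-1 by rewrite /F subrr add0r.
rewrite (@ge0_continuous_FTC2y _ f F c 0) ?Fc.
- by rewrite sub0e -EFinN opprK.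
- by move=> s cs; rewrite /f invr_ge0 sqr_ge0.
- apply: continuous_in_subspaceT => s; rewrite inE/= in_itv/= andbT => cs.
  have h1 : {for s, continuous (fun s : R => (s - c + t) ^+ 2)} by cts.
  by apply: cvgV h1; rewrite expf_neq0// pos.
- rewrite -oppr0; apply: cvgN; apply/cvgrPdist_le => e e0; near=> s.
  have se : e^-1 + c <= s by near: s; apply: nbhs_pinfty_ge; exact: num_real.
  have e1 : 0 < e^-1 by rewrite invr_gt0.
  have s0 : 0 < s - c + t by lra.
  rewrite sub0r normrN ger0_norm; last by rewrite invr_ge0 ltW.
  by rewrite -[leRHS]invrK lef_pV2 ?posrE//; lra.
- by move=> s cs; case: (dF s (ltW cs)).
- apply: cvg_at_right_filter; rewrite -Fc.
  exact: (@continuous_is_derive _ F f c (dF c (lexx _))).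
- move=> s; rewrite in_itv/= andbT => cs; rewrite derive1E.
  by have [_ ->] := dF s (ltW cs).
Unshelve. all: by end_near.
Qed.

(** The right-hand side has a rational primitive on each half-line. *)
Lemma cauchy_density_le (X t : R) : 0 < t ->
  (X ^+ 2 + t ^+ 2)^-1 <= 2 * (`|X| + t) ^- 2.
Proof.
move=> t0; have n0 := normr_ge0 X; have nX : `|X| ^+ 2 = X ^+ 2 by rewrite real_normK ?num_real.
have h1 : 0 < X ^+ 2 + t ^+ 2 by rewrite ltr_wpDl ?sqr_ge0// exprn_gt0.
have h3 : 0 < `|X| + t by rewrite ltr_wpDl.
rewrite -[leRHS]invrK invfM invrK lef_pV2 ?posrE ?mulr_gt0 ?invr_gt0//.
rewrite -nX; have := sqr_ge0 (`|X| - t); lra.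
Qed.

Lemma integral_cauchy (x0 t : R) : 0 < t ->
  (\int[leb]_x (((x - x0) ^+ 2 + t ^+ 2)^-1)%:E <= (4 * t^-1)%:E)%E.
Proof.
move=> t0; pose f (x : R) := ((x - x0) ^+ 2 + t ^+ 2)^-1.
have fp x : 0 < (x - x0) ^+ 2 + t ^+ 2 by rewrite ltr_wpDl ?sqr_ge0// exprn_gt0.
have f0 x : 0 <= f x by rewrite invr_ge0 ltW.
have fc : continuous f.
  move=> x; have h1 : {for x, continuous (fun x : R => (x - x0) ^+ 2 + t ^+ 2)} by cts.
  by apply: cvgV h1; rewrite gt_eqF.
have mf : measurable_fun setT (EFin \o f).
  by apply/measurable_EFinP; exact: continuous_measurable_fun.
have half (c : R) (g : R -> R) : measurable_fun ([set` `[c, +oo[] : set R) (EFin \o g) -> (forall s, c <= s -> 0 <= g s <= 2 * (s - c + t) ^- 2) ->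
    (\int[leb]_(s in `[c, +oo[) (g s)%:E <= (2 * t^-1)%:E)%E.
  move=> mg gb.
  rewrite EFinM -(integral_inv_sqr c t0) -ge0_integralZl_EFin//; first last.
  - apply/measurable_EFinP; apply: subspace_continuous_measurable_fun => //.
    apply: continuous_in_subspaceT => s; rewrite inE/= in_itv/= andbT => cs.
    have h1 : {for s, continuous (fun s : R => (s - c + t) ^+ 2)} by cts.
    by apply: cvgV h1; rewrite expf_neq0// gt_eqF// ltr_wpDl// subr_ge0.
  - by move=> s _; rewrite lee_fin invr_ge0 sqr_ge0.
  apply: ge0_le_integral => //.
  - by move=> s; rewrite /= in_itv/= andbT => cs; rewrite lee_fin; case/andP: (gb s cs).
  - apply/measurable_EFinP; apply: subspace_continuous_measurable_fun => //.
    apply: continuous_in_subspaceT => s; rewrite inE/= in_itv/= andbT => cs.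
    have h1 : {for s, continuous (fun s : R => (s - c + t) ^+ 2)} by cts.
    apply: cvgM; first exact: cvg_cst.
    by apply: cvgV h1; rewrite expf_neq0// gt_eqF// ltr_wpDl// subr_ge0.
  - by move=> s; rewrite /= in_itv/= andbT => cs; rewrite -EFinM lee_fin; case/andP: (gb s cs).
have right_half : (\int[leb]_(x in `[x0, +oo[) (f x)%:E <= (2 * t^-1)%:E)%E.
  apply: half; first exact: measurable_funTS.
  move=> s cs; rewrite f0/=; have := cauchy_density_le (s - x0) t0.
  by rewrite ger0_norm// subr_ge0.
have left_half : (\int[leb]_(x in `]-oo, x0]) (f x)%:E <= (2 * t^-1)%:E)%E.
  have := @ge0_integration_by_substitutionNy _ f (- x0); rewrite opprK => ->.
  - apply: half.
      apply: measurable_funTS; apply/measurable_EFinP; apply: continuous_measurable_fun.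
      by move=> x; apply: continuous_comp; [exact: opp_continuous|exact: fc].
    move=> s cs; rewrite f0/=; have := cauchy_density_le (- s - x0) t0.
    have s0 : - s - x0 <= 0 by lra.
    by rewrite ler0_norm// /f (_ : s - - x0 + t = - (- s - x0) + t)//; ring.
  - exact: continuous_subspaceT.
  - by move=> x _; exact: f0.
have -> : [set: R] = `]-oo, x0[ `|` `[x0, +oo[.
  apply/seteqP; split=> x _ //=; rewrite !in_itv/= andbT.
  by case: (ltP x x0) => h; [left|right].
rewrite ge0_integral_setU//=; first last.
- apply/disj_set2P; apply/seteqP; split=> x //= []; rewrite !in_itv/= andbT => h1 h2.
  by have := lt_le_trans h1 h2; rewrite ltxx.
- by move=> x _; rewrite lee_fin f0.
- exact: measurable_funTS.
rewrite (_ : 4 * t^-1 = 2 * t^-1 + 2 * t^-1); last by ring.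
rewrite EFinD; apply: leeD => //; apply: le_trans left_half.
apply: ge0_subset_integral => //.
- exact: measurable_funTS.
- by move=> x _; rewrite lee_fin f0.
- by move=> x /=; rewrite !in_itv/= => /ltW.
Qed.

(** The integrand depends on [w] only, so that integrating in [z] first gives at most the
    area [4 g^2] of the square around the slice.  The remaining integral splits into one in
    [Re w], at most [4 / t], and one in [Im w], equal to [1 / t]. *)
Lemma slab_integral_le (D : set P) (W : P -> R) (G : R * R -> R) (g : R -> R) (C x0 t : R) :
  open D -> 0 < t -> 0 <= C ->
  measurable_fun (D : set E4) W ->
  (forall q, D q -> 0 < q.2.2 /\ box (0, 0) (g q.2.2) q.1) ->
  (forall q, D q -> W q = G q.2) ->
  (forall s, 0 < s -> 0 < g s) -> (forall w, 0 < w.2 -> 0 <= G w) ->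
  (forall w, 0 < w.2 -> 4 * g w.2 ^+ 2 * G w <=
      C * (((w.1 - x0) ^+ 2 + t ^+ 2)^-1 * (w.2 + t) ^- 2)) ->
  (\int[mu]_(q in D) (W q)%:E <= (C * 4 * t ^- 2)%:E)%E.
Proof.
move=> oD t0 C0 mW Dg WG g0 G0 Gb.
have mD := open_measurable4 oD.
pose f := (EFin \o W) \_ D.
have fge0 q : (0 <= f q)%E.
  rewrite /f /patch; case: ifPn => //; rewrite inE => Dq.
  by rewrite lee_fin WG// G0//; case: (Dg q Dq).
have mf : measurable_fun [set: E4] f.
  by apply/(measurable_restrictT _ mD); exact/measurable_EFinP.
rewrite integral_mkcond -/f (fubini_tonelli2 _ mf)//.
pose H (w : R * R) := C * (((w.1 - x0) ^+ 2 + t ^+ 2)^-1 * (w.2 + t) ^- 2).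
pose A : set E2 := [set: R] `*` [set` `]0%R, +oo[].
have mA : measurable A by apply: measurableX => //; exact: measurable_itv.
have H0 w : 0 <= H w.
  by rewrite mulr_ge0// mulr_ge0// invr_ge0 ?sqr_ge0// addr_ge0// sqr_ge0.
have mH : measurable_fun (A : set E2) H.
  apply: measurable_fun_cont2 => // w [_ /=]; rewrite in_itv/= andbT => w2.
  have h1 : {for w, continuous (fun w : R * R => (w.1 - x0) ^+ 2 + t ^+ 2)} by cts.
  have h2 : {for w, continuous (fun w : R * R => (w.2 + t) ^+ 2)} by cts.
  have n1 : (w.1 - x0) ^+ 2 + t ^+ 2 != 0 by rewrite gt_eqF// ltr_wpDl ?sqr_ge0// exprn_gt0.
  have n2 : (w.2 + t) ^+ 2 != 0 by rewrite gt_eqF// exprn_gt0// addr_gt0.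
  apply: contM; first exact: contcst.
  by apply: contM; [exact: (cvgV n1 h1)|exact: (cvgV n2 h2)].
pose h := (EFin \o H) \_ A.
have mh : measurable_fun [set: E2] h.
  by apply/(measurable_restrictT _ mA); exact/measurable_EFinP.
have hge0 w : (0 <= h w)%E.
  by rewrite /h /patch; case: ifPn => //= _; rewrite lee_fin.
apply: (@le_trans _ _ (\int[mu2]_w h w)%E).
  apply: ge0_le_integral => //.
  - by move=> w _; apply: integral_ge0 => z _; exact: fge0.
  - exact: (measurable_fun_fubini_tonelli_G _ mf).
  move=> w _; rewrite /fubini_G.
  have [w2|w2] := ltP 0 w.2; last first.
    rewrite integral0_eq// => z _; rewrite /f /patch; case: ifPn => //.
    by rewrite inE => /Dg[/=]; rewrite ltNge w2.
  have wA : w \in A by rewrite inE; split => //=; rewrite in_itv/= andbT.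
  have -> : h w = (H w)%:E by rewrite /h /patch wA.
  have bm := @measurable_box R (0, 0) (g w.2).
  suff K : (\int[mu2]_z f (z, w) <= (H w)%:E)%E by exact: K.
  refine (le_trans (_ : (_ <= \int[mu2]_(z in box (0%R, 0%R) (g w.2)) (G w)%:E)%E) _).
    rewrite [leRHS]integral_mkcond; apply: ge0_le_integral => //.
    - exact: (measurableT_comp mf (measurable_pair2 w)).
    - by apply/(measurable_restrictT _ bm); exact: measurable_cst.
    move=> z _; rewrite /f /patch; case: ifPn.
      rewrite inE => Dzw; have [_ zb] := Dg _ Dzw; rewrite (mem_set zb) /=.
      by rewrite (WG _ Dzw).
    by move=> _; case: ifP => // _; rewrite lee_fin G0.
  rewrite integral_cst//.
  have bE := lebesgue2_box (0%R, 0%R) (g0 _ w2).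
  suff K : ((G w)%:E * (4 * g w.2 ^+ 2)%:E <= (H w)%:E)%E.
    by apply: le_trans K; rewrite -bE.
  by rewrite -EFinM lee_fin mulrC Gb.
have -> : (\int[mu2]_w h w = \int[leb]_x \int[leb]_s h (x, s))%E.
  exact: (@fubini_tonelli1 _ _ _ _ _ leb leb h mh hge0).
pose phi (x : R) : R := ((x - x0) ^+ 2 + t ^+ 2)^-1.
have phi0 x : 0 <= phi x by rewrite invr_ge0 addr_ge0// sqr_ge0.
have phic : continuous phi.
  move=> x; have h1 : {for x, continuous (fun x : R => (x - x0) ^+ 2 + t ^+ 2)} by cts.
  by apply: cvgV h1; rewrite gt_eqF// ltr_wpDl ?sqr_ge0// exprn_gt0.
have ti : 0 <= t^-1 by rewrite invr_ge0 ltW.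
apply: (@le_trans _ _ (\int[leb]_x ((C * t^-1)%:E * (phi x)%:E))%E); last first.
  rewrite ge0_integralZl_EFin//; first last.
  - by rewrite mulr_ge0.
  - by apply/measurable_EFinP; exact: continuous_measurable_fun.
  - by move=> x _; rewrite lee_fin.
  apply: le_trans (lee_wpmul2l _ (integral_cauchy x0 t0)) _; first by rewrite lee_fin mulr_ge0.
  by rewrite -EFinM lee_fin le_eqVlt; apply/orP; left; apply/eqP; field; rewrite gt_eqF.
pose chi (s : R) : R := (s - 0 + t) ^- 2.
have mchi : measurable_fun ([set` `[0%R, +oo[] : set R) chi.
  apply: subspace_continuous_measurable_fun => //.
  apply: continuous_in_subspaceT => s; rewrite inE/= in_itv/= andbT => s0.
  have h1 : {for s, continuous (fun s : R => (s - 0 + t) ^+ 2)} by cts.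
  by apply: cvgV h1; rewrite expf_neq0// gt_eqF// subr0 ltr_wpDl.
apply: ge0_le_integral => //.
- by move=> x _; apply: integral_ge0 => s _; exact: hge0.
- exact: (measurable_fun_fubini_tonelli_F _ mh).
- by apply/measurable_EFinP; apply: measurable_funM => //; exact: continuous_measurable_fun.
move=> x _.
have Cphi : 0 <= C * phi x by rewrite mulr_ge0.
apply: (@le_trans _ _ (\int[leb]_(s in `[0%R, +oo[) ((C * phi x)%:E * (chi s)%:E))%E); last first.
  rewrite ge0_integralZl_EFin//; last 2 first.
  - by move=> s _; rewrite lee_fin invr_ge0 sqr_ge0.
  - exact/measurable_EFinP.
  by rewrite (integral_inv_sqr 0 t0) -!EFinM lee_fin mulrAC.
rewrite [leRHS]integral_mkcond; apply: ge0_le_integral => //.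
- exact: (measurableT_comp mh (measurable_pair1 x)).
- apply/(measurable_restrictT _ (measurable_itv _)).
  by apply/measurable_EFinP; apply: measurable_funM => //; exact: measurable_cst.
move=> s _; rewrite /h /patch.
have -> : ((x, s) \in A) = (0 < s).
  by apply/idP/idP; rewrite inE /A/= in_itv/= andbT // => -[].
have -> : (s \in [set` `[0%R, +oo[]) = (0 <= s).
  by apply/idP/idP; rewrite inE /= in_itv/= andbT.
case: ifPn => [s0|_]; last by case: ifP => // _; rewrite -EFinM lee_fin mulr_ge0// invr_ge0 sqr_ge0.
by rewrite (ltW s0) -EFinM lee_fin /H /phi /chi /= subr0 mulrA.
Qed.
End Integrals.

(** * The domain above a radial graph *)

Section Domain.
Variables (R : realType) (F : R[i] -> R) (f : R -> R).
Notation P := ((R * R) * (R * R))%type.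
Hypothesis Fc : continuous (F \o toC).
Hypothesis F_profile : forall z, f (complex.Re `|z|) = F z.
Hypothesis f0 : f 0 = 0.
Hypothesis f_inc : {in `[0, +oo[ &, {homo f : x y / x < y}}.
Hypothesis f_cvgy : f r @[r --> +oo] --> +oo.

Let D : set P := toC2 @^-1` (Omega_ F).
Let g := half_inverse f.

Lemma profile_lt x y : 0 <= x -> 0 <= y -> (f x < f y) = (x < y).
Proof.
move=> x0 y0; apply/idP/idP; last by apply: f_inc; rewrite in_itv/= andbT.
apply: contraTT; rewrite -!leNgt le_eqVlt => /predU1P[->//|yx].
by apply: ltW; apply: f_inc => //; rewrite in_itv/= andbT.
Qed.

Lemma profile_surj s : 0 <= s -> exists2 x, 0 <= x & f x = s.
Proof.
move=> s0; have /cvgryPge /(_ s) [M [_ HM]] := f_cvgy.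
pose b := Num.max 0 (M + 1).
have b0 : 0 <= b by rewrite le_max lexx.
have fb : s <= f b by apply: HM; rewrite lt_max; apply/orP; right; lra.
have [|c] := @IVT _ (fun x => F (x +i* 0)) 0 b s b0 (continuous_subspaceT (axis_continuous Fc)).
  rewrite -!(profileE F_profile)// f0 ge_min le_max s0 fb orbT.
  by [].
rewrite in_itv/= => /andP[c0 cb] cE; exists c => //.
by rewrite (profileE F_profile).
Qed.

Lemma half_inverse_spec s : 0 <= s -> 0 <= g s /\ f (g s) = s.
Proof.
move=> s0; have [x x0 xs] := profile_surj s0.
have fim : s \in [set f x | x in [set` `[0, +oo[]].
  by rewrite inE; exists x => //=; rewrite in_itv/= andbT.
split; last exact: (pinvK (fun=> 0) fim).
have inj : {in [set` `[0, +oo[] &, injective f}.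
  move=> a b; rewrite !inE/= !in_itv/= !andbT => a0 b0 ab.
  by case: (ltgtP a b) => // h; [have := profile_lt a0 b0|have := profile_lt b0 a0]; rewrite ab ltxx h.
have := injpinv_image (fun=> 0) inj => /seteqP[H _].
have : [set` `[0, +oo[] (g s) by apply: H; exists s => //; rewrite inE in fim.
by rewrite /= in_itv/= andbT.
Qed.

Lemma half_inverse_gt0 s : 0 < s -> 0 < g s.
Proof.
by move=> s0; have [g0 gs] := half_inverse_spec (ltW s0); rewrite -(profile_lt (lexx 0) g0) gs f0.
Qed.

Lemma half_inverse_le s t : 0 <= s -> s <= t -> g s <= g t.
Proof.
move=> s0 st; have [gs0 gs] := half_inverse_spec s0.
have [gt0 gt] := half_inverse_spec (le_trans s0 st).
by rewrite leNgt -(profile_lt gt0 gs0) gs gt -leNgt.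
Qed.

Lemma domainE (q : P) : D q <-> f (Num.sqrt (q.1.1 ^+ 2 + q.1.2 ^+ 2)) < q.2.2.
Proof. by rewrite /D /Omega_/= /toC (profile_normE F_profile). Qed.

Lemma domain_open : open D.
Proof.
pose h (q : P) := q.2.2 - (F \o toC) q.1.
have hc : continuous h.
  move=> q; have h1 : {for q, continuous (fun q : P => q.2.2)} by cts.
  have h2 : {for q, continuous (fun q : P => q.1)} by cts.
  have h3 : {for q, continuous (fun q : P => (F \o toC) q.1)}.
    by apply: (@contcomp _ _ _ (F \o toC) (fun q : P => q.1)) => //; exact: Fc.
  exact: (contS h1 h3).
rewrite (_ : D = h @^-1` [set x | 0 < x]).
  by apply: open_comp => [q _|]; [exact: hc|exact: open_gt].
by apply/seteqP; split=> q; rewrite /D /h /Omega_/= subr_gt0.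
Qed.

Lemma domain_pos (q : P) : D q -> 0 < q.2.2 /\ box (0, 0) (g q.2.2) q.1.
Proof.
move=> /domainE h.
set r := Num.sqrt _ in h; have r0 : 0 <= r by exact: sqrtr_ge0.
have fr : 0 <= f r.
  by rewrite -f0 leNgt (profile_lt r0 (lexx 0)) -leNgt.
have q2 : 0 < q.2.2 by exact: le_lt_trans h.
have [gq gE] := half_inverse_spec (ltW q2).
have rg : r < g q.2.2 by rewrite -(profile_lt r0 gq) gE.
have c1 : `|q.1.1| <= r by rewrite -sqrtr_sqr ler_wsqrtr// lerDl sqr_ge0.
have c2 : `|q.1.2| <= r by rewrite -sqrtr_sqr ler_wsqrtr// lerDr sqr_ge0.
split=> //; move: c1 c2; rewrite !ler_norml => /andP[? ?] /andP[? ?].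
by split; rewrite /seg/= in_itv/=; apply/andP; split; lra.
Qed.

(** ** Consequences of the doubling condition *)

Variables (rho sigma : R).
Hypothesis rho_bounds : 0 < rho < g 1.
Hypothesis sigma_gt1 : 1 < sigma.
Hypothesis doubling : forall x, x \in `[0, rho / sigma] -> 2 * Lambda f x <= Lambda f (sigma * x).

Let sigma_gt0 : 0 < sigma. Proof. by apply: lt_trans sigma_gt1. Qed.

Lemma profile_pos y : 0 < y -> 0 < f y.
Proof. by move=> y0; rewrite -f0 (profile_lt (lexx 0) (ltW y0)). Qed.

(** With [a = ln f(y / sigma)] and [b = ln f(y)], both negative, the doubling inequality at
    [y / sigma] reads [- 2 / a <= - 1 / b], that is [a <= 2 b]. *)
Lemma doubling_square y : 0 < y -> y <= rho -> f (y / sigma) <= f y ^+ 2.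
Proof.
move=> y0 yr; have /andP[r0 r1] := rho_bounds.
have [g10 g1] := half_inverse_spec (ler01 : 0 <= 1 :> R).
have ys : 0 < y / sigma by rewrite divr_gt0.
have fy0 := profile_pos y0; have fys0 := profile_pos ys.
have fy1 : f y < 1 by rewrite -g1 (profile_lt (ltW y0) g10) (le_lt_trans yr).
have ysy : y / sigma < y by rewrite ltr_pdivrMr// ltr_pMr.
have fys1 : f (y / sigma) < 1.
  by apply: lt_trans fy1; rewrite (profile_lt (ltW ys) (ltW y0)).
have := @doubling (y / sigma).
rewrite in_itv/= (ltW ys) ler_pM2r ?invr_gt0// yr => /(_ isT).
rewrite mulrC [sigma * _]mulrC divfK ?gt_eqF// /Lambda !gt_eqF//.
have l1 : ln (f (y / sigma)) < 0 by rewrite ln_lt0// fys0.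
have l2 : ln (f y) < 0 by rewrite ln_lt0// fy0.
rewrite -(@ler_ln _ (f (y / sigma)) _) ?posrE ?exprn_gt0// lnXn//.
move: (ln (f (y / sigma))) (ln (f y)) l1 l2 => a b l1 l2 h.
have : - a^-1 * 2 * (a * b) <= - b^-1 * (a * b).
  by rewrite ler_wpM2r// nmulr_lge0 // ltW.
have -> : - a^-1 * 2 * (a * b) = - 2 * b by field; rewrite lt_eqF.
have -> : - b^-1 * (a * b) = - a by field; rewrite lt_eqF.
rewrite mulr2n; lra.
Qed.

(** Below the level [f rho] the inverse of [f] takes values in [[0, rho]]; below [1 / 4] the
    square of a level is less than half of it. *)
Let s0 := Num.min (f rho) (4^-1).

Lemma small_level_gt0 : 0 < s0.
Proof. by have /andP[r0 _] := rho_bounds; rewrite lt_min profile_pos//; lra. Qed.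

Lemma half_inverse_doubling s : 0 < s -> s <= s0 -> f (g s / sigma) < s / 2.
Proof.
move=> sp; rewrite le_min => /andP[s1 s2].
have /andP[r0 r1] := rho_bounds.
have [g0 gs] := half_inverse_spec (ltW sp); have gp := half_inverse_gt0 sp.
have gr : g s <= rho by rewrite leNgt -(profile_lt (ltW r0) g0) gs -leNgt.
have := doubling_square gp gr; rewrite gs expr2 => /le_lt_trans; apply.
by rewrite ltr_pM2l//; lra.
Qed.

Lemma half_inverse_half s : 0 < s -> s <= s0 -> g s <= sigma * g (s / 2).
Proof.
move=> sp ss; have h := half_inverse_doubling sp ss.
have s2 : 0 < s / 2 by rewrite divr_gt0.
have [g0 gs] := half_inverse_spec (ltW s2); have gp := half_inverse_gt0 sp.
rewrite mulrC -ler_pdivrMr// ltW//.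
by rewrite -(profile_lt _ g0) ?gs// divr_ge0// ltW.
Qed.

Variable m : nat.
Hypothesis sigma_m : sigma <= 2 ^+ m.

(** Halve the level at most [n] times; each step costs a factor [sigma <= 2^m]. *)
Lemma half_inverse_growth_le n s t : 0 < t -> t <= s -> s <= 2 ^+ n * t -> s <= s0 ->
  g s <= g t * (2 * s / t) ^+ m.
Proof.
elim: n s => [|n IH] s t0 ts sn ss.
  have -> : s = t by apply/eqP; rewrite eq_le ts andbT -[t]mul1r.
  rewrite mulfK ?gt_eqF// ler_peMr ?exprn_ege1 ?ler1n//.
  exact: ltW (half_inverse_gt0 t0).
have sp : 0 < s by exact: lt_le_trans ts.
have gp := half_inverse_gt0 t0.
have s2t : 1 <= s / t by rewrite ler_pdivlMr// mul1r.
have [h|h] := leP s (2 * t).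
  have g1 : g (s / 2) <= g t by apply: half_inverse_le; lra.
  apply: le_trans (half_inverse_half sp ss) _.
  apply: (@le_trans _ _ (2 ^+ m * g t)).
    by apply: ler_pM => //; [exact: ltW|exact: ltW (half_inverse_gt0 (divr_gt0 sp _))].
  have e : 2 <= 2 * s / t by rewrite -mulrA; lra.
  by rewrite mulrC ler_pM2l// lerXn2r// nnegrE ?(le_trans _ e).
have e1 : t <= s / 2 by lra.
have e2 : s / 2 <= 2 ^+ n * t by move: sn; rewrite exprS; lra.
have e3 : s / 2 <= s0 by lra.
have := IH _ t0 e1 e2 e3.
rewrite (_ : 2 * (s / 2) = s); last by lra.
move=> h3.
apply: le_trans (half_inverse_half sp ss) _.
apply: (@le_trans _ _ (2 ^+ m * (g t * (s / t) ^+ m))).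
  by apply: ler_pM => //; [exact: ltW|exact: ltW (half_inverse_gt0 (divr_gt0 sp _))].
by rewrite mulrCA -exprMn mulrA.
Qed.

Lemma half_inverse_growth s t : 0 < t -> 0 < s -> s <= s0 ->
  g s <= g t * (2 * (s + t) / t) ^+ m.
Proof.
move=> t0 sp ss; have gp := half_inverse_gt0 t0.
have [st|ts] := leP s t.
  apply: le_trans (half_inverse_le (ltW sp) st) _.
  rewrite ler_peMr ?(ltW gp)// exprn_ege1// ler_pdivlMr//; lra.
have [n hn] : exists n, s <= 2 ^+ n * t.
  exists (Num.Def.truncn (s / t)).+1; rewrite -ler_pdivrMr//.
  have h0 : 0 <= s / t by rewrite divr_ge0// ltW.
  apply: ltW; apply: lt_trans (truncnS_gt _) _.
  by rewrite -natrX ltr_nat ltn_expl.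
apply: le_trans (half_inverse_growth_le t0 (ltW ts) hn ss) _.
have e1 : 0 <= 2 * s / t by rewrite ltW// divr_gt0// mulr_gt0.
have e2 : 2 * s / t <= 2 * (s + t) / t by rewrite ler_pM2r ?invr_gt0//; lra.
by rewrite ler_pM2l// lerXn2r// nnegrE ?(le_trans e1).
Qed.

Variable B : R.
Hypothesis B_gt0 : 0 < B.
Hypothesis f_log : forall s, 1 <= s -> B * ln s <= f s.

Lemma half_inverse_exp s : 0 < s -> g s * expR (- B^-1 * s) <= 1.
Proof.
move=> sp; have gp := half_inverse_gt0 sp; have [_ gs] := half_inverse_spec (ltW sp).
have Bs : 0 <= B^-1 * s by rewrite ltW// mulr_gt0// invr_gt0.
rewrite mulNr expRN ler_pdivrMr ?expR_gt0// mul1r.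
have [g1|g1] := leP (g s) 1; first by rewrite (le_trans g1)// -expR0 ler_expR.
rewrite -ler_ln ?posrE ?expR_gt0// expRK ler_pdivlMl//.
by have := f_log (ltW g1); rewrite gs.
Qed.

(** The factor needed at levels above [s0], where only the exponential bound is available. *)
Let A := Num.max 1 (g s0)^-1.

Lemma half_inverse_weighted s t : 0 < t -> t <= s0 -> 0 < s ->
  g s * expR (- B^-1 * s) <= A * g t * (2 * (s + t) / t) ^+ m.
Proof.
move=> t0 ts sp; have gp := half_inverse_gt0 t0; have sp0 := small_level_gt0.
have gsp := half_inverse_gt0 sp; have gs0 := half_inverse_gt0 sp0.
have A1 : 1 <= A by rewrite le_max lexx.
have Ag : 1 <= A * g s0 by rewrite -ler_pdivrMr// mul1r le_max lexx orbT.
have [ss|ss] := leP s s0.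
  have Bs : 0 <= B^-1 * s by rewrite ltW// mulr_gt0// invr_gt0.
  have h := half_inverse_growth t0 sp ss.
  apply: (@le_trans _ _ (g s)).
    by rewrite ler_piMr ?(ltW gsp)// -expR0 ler_expR mulNr oppr_le0.
  apply: (le_trans h); rewrite -[A * g t * _]mulrA.
  by rewrite ler_peMl// (le_trans _ h)// ltW.
apply: le_trans (half_inverse_exp sp) _; apply: le_trans Ag _.
rewrite -[A * g t * _]mulrA ler_pM2l; last exact: lt_le_trans A1.
apply: le_trans (half_inverse_growth t0 sp0 (lexx _)) _.
have e1 : 0 <= 2 * (s0 + t) / t by rewrite ltW// divr_gt0// mulr_gt0// addr_gt0.
have e2 : 2 * (s0 + t) / t <= 2 * (s + t) / t by rewrite ler_pM2r ?invr_gt0//; lra.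
by rewrite ler_pM2l// lerXn2r// nnegrE ?(le_trans e1).
Qed.

Lemma test_density_le s t X : 0 < t -> t <= s0 -> 0 < s ->
  4 * g s ^+ 2 * (expR (- B^-1 * s) ^+ 2 * (X ^+ 2 + (s + t) ^+ 2)^-1 ^+ (m + 2)) <=
  4 * A ^+ 2 * g t ^+ 2 * 4 ^+ m * t ^- (2 * m) * ((X ^+ 2 + t ^+ 2)^-1 * (s + t) ^- 2).
Proof.
move=> t0 ts sp; have gp := half_inverse_gt0 t0; have gsp := half_inverse_gt0 sp.
have A0 : 0 < A by rewrite lt_max ltr01.
have st : 0 < s + t by exact: addr_gt0.
have S0 : 0 < (s + t) ^+ 2 by rewrite exprn_gt0.
have T0 : 0 < t ^+ 2 by rewrite exprn_gt0.
have X0 := sqr_ge0 X.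
have Y0 : 0 < X ^+ 2 + (s + t) ^+ 2 by lra.
have Z0 : 0 < X ^+ 2 + t ^+ 2 by lra.
have YS : (X ^+ 2 + (s + t) ^+ 2)^-1 <= (s + t) ^- 2 by rewrite lef_pV2 ?posrE//; lra.
have YZ : (X ^+ 2 + (s + t) ^+ 2)^-1 <= (X ^+ 2 + t ^+ 2)^-1.
  by rewrite lef_pV2 ?posrE// lerD2l lerXn2r ?nnegrE//; lra.
have W := half_inverse_weighted t0 ts sp.
have {}W : (g s * expR (- B^-1 * s)) ^+ 2 <= (A * g t * (2 * (s + t) / t) ^+ m) ^+ 2.
  have h0 : 0 <= g s * expR (- B^-1 * s) by rewrite mulr_ge0 ?expR_ge0 ?(ltW gsp).
  by rewrite lerXn2r// nnegrE ?(le_trans h0).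
have iY : 0 <= (X ^+ 2 + (s + t) ^+ 2)^-1 by rewrite invr_ge0 ltW.
have V : (X ^+ 2 + (s + t) ^+ 2)^-1 ^+ (m + 2) <=
    ((s + t) ^- 2) ^+ m * ((X ^+ 2 + t ^+ 2)^-1 * (s + t) ^- 2).
  rewrite exprD expr2; apply: ler_pM; rewrite ?exprn_ge0 ?mulr_ge0//.
    by rewrite lerXn2r// nnegrE// invr_ge0 ltW.
  exact: ler_pM.
have -> : 4 * g s ^+ 2 * (expR (- B^-1 * s) ^+ 2 * (X ^+ 2 + (s + t) ^+ 2)^-1 ^+ (m + 2)) =
   4 * ((g s * expR (- B^-1 * s)) ^+ 2 * (X ^+ 2 + (s + t) ^+ 2)^-1 ^+ (m + 2)).
  by rewrite exprMn !mulrA.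
have -> : 4 * A ^+ 2 * g t ^+ 2 * 4 ^+ m * t ^- (2 * m) * ((X ^+ 2 + t ^+ 2)^-1 * (s + t) ^- 2) =
   4 * ((A * g t * (2 * (s + t) / t) ^+ m) ^+ 2 * 
    (((s + t) ^- 2) ^+ m * ((X ^+ 2 + t ^+ 2)^-1 * (s + t) ^- 2))).
  have H : (A * g t * (2 * (s + t) / t) ^+ m) ^+ 2 * ((s + t) ^- 2) ^+ m =
      A ^+ 2 * g t ^+ 2 * 4 ^+ m * t ^- (2 * m).
    have H0 : (2 * (s + t) / t) ^+ 2 * (s + t) ^- 2 = 4 * t ^- 2.
      by field; rewrite !gt_eqF.
    rewrite exprMn -[_ ^+ m ^+ 2]exprM mulnC exprM -[LHS]mulrA -[X in _ * X = _]exprMn H0.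
    by rewrite (exprMn _ 4) exprM exprVn exprMn !mulrA.
  rewrite [_ ^+ 2 * (_ * _)]mulrA H.
  move: (t ^- _) (4 ^+ m) (_ + t ^+ 2)^-1 ((s + t) ^- 2) => a b c d; ring.
rewrite ler_pM2l//; apply: ler_pM => //; first exact: sqr_ge0.
by rewrite exprn_ge0.
Qed.

(** ** Estimates of the kernel *)

Let CL := 16 * A ^+ 2 * 4 ^+ m * 4 ^+ (m + 2) / expR (- B^-1) ^+ 2.

Lemma lower_const_gt0 : 0 < CL.
Proof.
have A0 : 0 < A by rewrite lt_max ltr01.
by rewrite divr_gt0 ?exprn_gt0 ?expR_gt0// !mulr_gt0 ?exprn_gt0.
Qed.

(** [bergman_kernel_ge] for the test function centred at the second coordinate of the
    point. *)
Lemma kernel_lower (p : P) : D p -> p.2.2 <= s0 -> exists2 K,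
  bergman_kernel (Omega_ F) (toC2 p) (toC2 p) = K%:C &
  CL^-1 * p.2.2 ^- 2 * g p.2.2 ^- 2 <= K.
Proof.
move=> Dp ps; have [t0 _] := domain_pos Dp.
set t := p.2.2 in t0 ps *; have gp := half_inverse_gt0 t0.
have A0 : 0 < A by rewrite lt_max ltr01.
have pos q : D q -> 0 < q.2.2 + t by move=> /domain_pos[q0 _]; exact: addr_gt0.
have [u [v [uv uvE]]] := test_function B^-1 p.2.1 (m + 2) domain_open pos.
pose C := 4 * A ^+ 2 * g t ^+ 2 * 4 ^+ m * t ^- (2 * m).
have C0 : 0 <= C.
  by rewrite ltW// /C; apply: divr_gt0; rewrite ?exprn_gt0// !mulr_gt0 ?exprn_gt0.
pose G (w : R * R) := expR (- B^-1 * w.2) ^+ 2 *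
  ((w.1 - p.2.1) ^+ 2 + (w.2 + t) ^+ 2)^-1 ^+ (m + 2).
have uvn : (norm2 D u v <= (C * 4 * t ^- 2)%:E)%E.
  rewrite /norm2; apply: (@slab_integral_le _ D _ G g C p.2.1 t) => //.
  - exact: domain_open.
  - exact: (measurable_sqr domain_open uv).
  - exact: domain_pos.
  - exact: half_inverse_gt0.
  - move=> w w0; rewrite /G mulr_ge0 ?sqr_ge0// exprn_ge0// invr_ge0 addr_ge0 ?sqr_ge0//.
  - by move=> w w0; exact: test_density_le.
have uvL := L2hol_norm2 domain_open uv uvn.
have [K KE Kge] := bergman_kernel_ge domain_open Dp uvL.
exists K => //.
have sq : sqn D u v <= C * 4 * t ^- 2 by rewrite -lee_fin -(sqn_norm2 domain_open).
move: Kge; rewrite (uvE p Dp) subrr expr0n/= add0r -/t => Kge.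
have K0 : 0 < K.
  rewrite ltNge; apply/negP => K0.
  have : 0 < sqn D u v * K.
    by apply: lt_le_trans Kge; rewrite mulr_gt0 ?exprn_gt0 ?expR_gt0 ?invr_gt0 ?exprn_gt0 ?addr_gt0.
  by apply/negP; rewrite -leNgt mulr_ge0_le0// sqn_ge0.
have {}Kge : expR (- B^-1 * t) ^+ 2 * ((t + t) ^+ 2)^-1 ^+ (m + 2) <= C * 4 * t ^- 2 * K.
  by apply: le_trans Kge _; rewrite ler_pM2r.
have t1 : t <= 1 by move: ps; rewrite le_min => /andP[_]; lra.
have E1 : expR (- B^-1) ^+ 2 <= expR (- B^-1 * t) ^+ 2.
  rewrite lerXn2r ?nnegrE ?expR_ge0// ler_expR !mulNr lerN2.
  by rewrite ler_piMr// invr_ge0 ltW.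
have {}Kge : expR (- B^-1) ^+ 2 * ((t + t) ^+ 2)^-1 ^+ (m + 2) <= C * 4 * t ^- 2 * K.
  by apply: le_trans Kge; rewrite ler_pM2r// exprn_gt0// invr_gt0 exprn_gt0// addr_gt0.
have E0 : 0 < expR (- B^-1 : R) by exact: expR_gt0.
have c0 : 0 < C * 4 * t ^- 2.
  apply: divr_gt0; rewrite ?exprn_gt0// mulr_gt0// /C.
  by apply: divr_gt0; rewrite ?exprn_gt0// !mulr_gt0 ?exprn_gt0.
rewrite -(ler_pM2l c0); apply: le_trans Kge; rewrite le_eqVlt; apply/orP; left; apply/eqP.
have -> : (t + t) ^+ 2 = 4 * t ^+ 2 by ring.
have -> : (4 * t ^+ 2)^-1 ^+ (m + 2) = (4 ^+ (m + 2))^-1 * (t ^- (2 * m) * t ^- 4).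
  by rewrite invfM exprMn !exprVn -exprM; congr (_ * _); rewrite -invfM -exprD mulnDr.
have f4 : 4 ^+ (m + 2) != 0 :> R by rewrite expf_neq0// pnatr_eq0.
have f4' : 4 ^+ m != 0 :> R by rewrite expf_neq0// pnatr_eq0.
rewrite /C /CL; move: (t ^- (2 * m)) f4 f4' => a; move: (4 ^+ (m + 2)) (4 ^+ m) => b c b0 c'0.
field.
by rewrite b0 c'0 !gt_eqF.
Qed.

(** On the box the modulus of [z] is at most [g t / sigma], where [f] is less than
    [t / 2], the least value of [Im w]. *)
Lemma kernel_upper (p : P) : 0 < p.2.2 -> p.2.2 <= s0 ->
  `|p.1.1| <= g p.2.2 / (4 * sigma) -> `|p.1.2| <= g p.2.2 / (4 * sigma) -> exists2 K,
  bergman_kernel (Omega_ F) (toC2 p) (toC2 p) = K%:C &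
  K <= 2 ^+ 10 * sigma ^+ 2 * p.2.2 ^- 2 * g p.2.2 ^- 2.
Proof.
set t := p.2.2 => t0 ts p1 p2; have gp := half_inverse_gt0 t0.
have d0 : 0 < g t / (4 * sigma) by rewrite divr_gt0// mulr_gt0.
have e0 : 0 < t / 2 by rewrite divr_gt0.
have sub : qbox p (g t / (4 * sigma)) (t / 2) `<=` D.
  move=> x /qbox_coord[]; rewrite -/t; set d := g t / (4 * sigma) in d0 p1 p2 *.
  move=> x1 x2 _ x4; apply/domainE.
  have gs : 0 <= g t / sigma by rewrite ltW// divr_gt0.
  apply: (@le_lt_trans _ _ (f (g t / sigma))).
    rewrite leNgt profile_lt// ?sqrtr_ge0// -leNgt.
    rewrite -(ger0_norm gs) -sqrtr_sqr ler_wsqrtr//.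
    have -> : g t / sigma = 4 * d by rewrite /d; field; rewrite gt_eqF.
    move: x1 x2 p1 p2; rewrite !ler_norml => /andP[? ?] /andP[? ?] /andP[? ?] /andP[? ?].
    have sq (y : R) : - (2 * d) <= y -> y <= 2 * d -> y ^+ 2 <= 4 * d ^+ 2.
      move=> ? ?; rewrite -subr_ge0 (_ : _ - _ = (2 * d - y) * (2 * d + y)); last by ring.
      by rewrite mulr_ge0//; lra.
    have h1 : x.1.1 ^+ 2 <= 4 * d ^+ 2 by apply: sq; lra.
    have h2 : x.1.2 ^+ 2 <= 4 * d ^+ 2 by apply: sq; lra.
    have -> : (4 * d) ^+ 2 = 16 * d ^+ 2 by ring.
    by have := sqr_ge0 d; lra.
  apply: lt_le_trans (half_inverse_doubling t0 ts) _.
  by move: x4; rewrite ler_norml => /andP[? ?]; lra.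
have [K KE Kle] := bergman_kernel_le domain_open d0 e0 sub; exists K => //.
have -> : 2 ^+ 10 * sigma ^+ 2 * t ^- 2 * g t ^- 2 = 16 / ((g t / (4 * sigma)) ^+ 2 * (t / 2) ^+ 2).
  by field; rewrite !gt_eqF.
by rewrite ler_pdivlMr// mulr_gt0// exprn_gt0.
Qed.

(** Let [y = 4 sigma alpha t^(1/N)].  By the flatness of order [N] of [f],
    [f y <= y^N / (4 sigma alpha)^N = t] for small [t], hence [y <= g t]. *)
Lemma approach_region_narrow (alpha : R) (N : nat) : 0 < alpha -> (0 < N)%N ->
  (forall n, (f x / x ^+ n) @[x --> 0^'+] --> (0 : R)) ->
  exists2 r, 0 < r <= s0 &
    forall t, 0 < t -> t < r -> alpha * t `^ (N%:R^-1) <= g t / (4 * sigma).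
Proof.
move=> a0 N0 /(_ N) /cvgrPdist_lt flat.
pose k := 4 * sigma * alpha; have k0 : 0 < k by rewrite !mulr_gt0.
have kN : 0 < k ^- N by rewrite invr_gt0 exprn_gt0.
have [d /= d0 Hd] := flat _ kN.
exists (Num.min s0 ((d / k) ^+ N)).
  by rewrite ge_min lexx/= lt_min small_level_gt0 exprn_gt0// divr_gt0.
move=> t t0; rewrite lt_min => /andP[ts td].
set tau := _ `^ _; have tau0 : 0 < tau by exact: powR_gt0.
have tauN : tau ^+ N = t.
  rewrite -powR_mulrn ?(ltW tau0)// /tau -powRrM mulVf ?pnatr_eq0 -?lt0n//.
  by rewrite powRr1// ltW.
have tk : tau < d / k.
  rewrite ltNge; apply/negP => h; move: td; rewrite -tauN ltNge => /negP; apply.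
  by rewrite lerXn2r// nnegrE ltW// divr_gt0.
have y0 : 0 < k * tau by exact: mulr_gt0.
have := Hd (k * tau); rewrite /ball_/= sub0r normrN gtr0_norm//.
rewrite -[k * tau < d]ltr_pdivlMl// [k^-1 * d]mulrC => /(_ tk y0).
rewrite sub0r normrN gtr0_norm; last by rewrite divr_gt0 ?exprn_gt0 ?profile_pos.
rewrite ltr_pdivrMr ?exprn_gt0// [(k * tau) ^+ N]exprMn tauN mulKf ?expf_neq0 ?gt_eqF// => ft.
have [g0 gs] := half_inverse_spec (ltW t0).
have yg : k * tau < g t by rewrite -(profile_lt (ltW y0) g0) gs.
rewrite ler_pdivlMr ?mulr_gt0// ltW//; apply: le_lt_trans yg.
by rewrite le_eqVlt; apply/orP; left; apply/eqP; rewrite /k; ring.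
Qed.

Lemma kernel_estimates :
  (forall n, (f x / x ^+ n) @[x --> 0^'+] --> (0 : R)) ->
  exists2 C1 : R, 0 < C1 &
   (forall (alpha : R) (N : nat), 0 < alpha -> (0 < N)%N ->
      exists2 r : R, 0 < r &
        forall z w : R[i], approach_region F alpha N (z, w) ->
          complex.Im w < r ->
          (C1^-1 * complex.Im w ^- 2 * g (complex.Im w) ^- 2)%:C
            <= K_ F z w
            <= (C1 * complex.Im w ^- 2 * g (complex.Im w) ^- 2)%:C) /\
   (exists2 r0 : R, 0 < r0 &
      forall z w : R[i], Omega_ F (z, w) -> complex.Im w < r0 ->
        (C1^-1 * complex.Im w ^- 2 * g (complex.Im w) ^- 2)%:C
          <= K_ F z w).
Proof.
move=> flat; have L0 := lower_const_gt0.
have U0 : 0 < 2 ^+ 10 * sigma ^+ 2 by apply: mulr_gt0; exact: exprn_gt0.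
pose C1 := 2 ^+ 10 * sigma ^+ 2 + CL; have C0 : 0 < C1 by exact: addr_gt0.
have CLe : C1^-1 <= CL^-1 by rewrite lef_pV2 ?posrE// lerDr ltW.
have CUe : 2 ^+ 10 * sigma ^+ 2 <= C1 by rewrite lerDl ltW.
have lower z w : Omega_ F (z, w) -> complex.Im w < s0 ->
   (C1^-1 * complex.Im w ^- 2 * g (complex.Im w) ^- 2)%:C <= K_ F z w.
  move=> zw ws; have Dp : D (fromC2 (z, w)) by rewrite /D/= fromC2K.
  have [K] := kernel_lower Dp (ltW ws).
  rewrite fromC2K /K_ => -> h; rewrite lecR; apply: le_trans h.
  by rewrite -!mulrA ler_wpM2r// mulr_ge0// invr_ge0 ?sqr_ge0.
exists C1 => //; split; last by exists s0 => //; exact: small_level_gt0.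
move=> alpha N a0 N0; have [r /andP[r0 rs] Hr] := approach_region_narrow a0 N0 flat.
exists r => // z w [zw ap] wr; rewrite lower ?(lt_le_trans wr)//=.
have Dp : D (fromC2 (z, w)) by rewrite /D/= fromC2K.
have [t0 _] := domain_pos Dp.
have := Hr _ t0 wr; move: ap => /= /ltW /le_trans ap /ap.
rewrite sqr_normc => h.
have c1 : `|complex.Re z| <= g (complex.Im w) / (4 * sigma).
  apply: le_trans h; rewrite -sqrtr_sqr ler_wsqrtr// -addrA lerDl addr_ge0 ?sqr_ge0//.
have c2 : `|complex.Im z| <= g (complex.Im w) / (4 * sigma).
  apply: le_trans h; rewrite -sqrtr_sqr ler_wsqrtr// addrAC lerDr addr_ge0 ?sqr_ge0//.
have [K] := kernel_upper t0 (ltW (lt_le_trans wr rs)) c1 c2.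
rewrite fromC2K /K_ => -> hK; rewrite lecR; apply: (le_trans hK).
by rewrite !ler_wpM2r// invr_ge0 sqr_ge0.
Qed.

End Domain.

Theorem theorem1p2 (R : realType) (F : R[i] -> R) (f : R -> R)
  (F_smooth : smooth F)
  (F_subharmonic : subharmonic F)
  (F_radial : forall z, F z = F `|z|)
  (F_profile : forall z, f (complex.Re `|z|) = F z)
  (F_flat : vanishes_to_infinite_order f)
  (not_levi_flat : ~ levi_flat_around (Omega_ F) (rho_ F) ((0, 0), (0, 0))) :
  ({in `[0, +oo[ &, {homo f : x y / x < y}} /\ f r @[r --> +oo] --> +oo) /\
  ((exists2 r, 0 < r < half_inverse f 1 & doubling_on r (Lambda f)) ->
   exists2 C1 : R, 0 < C1 &
     (forall (alpha : R) (N : nat), 0 < alpha -> (0 < N)%N ->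
        exists2 r : R, 0 < r &
          forall z w : R[i], approach_region F alpha N (z, w) ->
            complex.Im w < r ->
            (C1^-1 * complex.Im w ^- 2 * half_inverse f (complex.Im w) ^- 2)%:C
              <= K_ F z w
              <= (C1 * complex.Im w ^- 2 * half_inverse f (complex.Im w) ^- 2)%:C) /\
     (exists2 r0 : R, 0 < r0 &
        forall z w : R[i], Omega_ F (z, w) -> complex.Im w < r0 ->
          (C1^-1 * complex.Im w ^- 2 * half_inverse f (complex.Im w) ^- 2)%:C
            <= K_ F z w)).
Proof.
have Fc : continuous (F \o toC) by have [h _] := F_smooth 0%N; move=> x; exact: h.
have F_mean := F_subharmonic.2.
have f0 : f 0 = 0 by case: F_flat => _ /(_ 0%N).
have f_not0 r : 0 < r -> exists2 x, 0 <= x < r & f x != 0.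
  move=> r0; apply: contrapT => h; apply: not_levi_flat.
  apply: (levi_flat_of_zero F_profile r0) => x xr; apply: contrapT => /eqP fx.
  by apply: h; exists x.
have f_inc := profile_increasing Fc F_mean F_profile f0 f_not0.
have f_cvgy := profile_cvgy Fc F_mean F_profile f0 f_not0.
split=> // -[rho rhoB [_ _ [sigma s1 dbl]]].
have [B B0 f_log] := profile_exp_bound Fc F_mean F_profile f0 f_not0.
have sm : sigma <= 2 ^+ (Num.Def.truncn sigma).+1.
  by apply: ltW; apply: lt_trans (truncnS_gt _) _; rewrite -natrX ltr_nat ltn_expl.
have [_ _ flat] := F_flat.
exact: (kernel_estimates Fc F_profile f0 f_inc f_cvgy rhoB s1 dbl sm B0 f_log flat).
Qed.
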